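(* The system $\mathsf{ACA}_0^\omega$ proves $\mathsf{WTE}\to\mathsf{WHBU}_{\mathbf m}$.
   Context: Finite types: $0$ is the type of natural numbers, $\sigma\to\tau$ is the type of maps from type $\sigma$ objects to type $\tau$ objects; $1=0\to0$, $n+1=n\to0$. The language $L_\omega$ has variables of all finite types and constants $0,1,<_0,+_0,\times_0,=_0$, combinators and recursors; for $\tau=\tau_1\to\dots\to\tau_k\to0$, $x=_\tau y$ abbreviates $\forall z_1^{\tau_1}\dots z_k^{\tau_k}(xz_1\dots z_k=_0yz_1\dots z_k)$. $\mathsf{RCA}_0^\omega$ is the theory in classical logic with axioms: (1) $0,1,<_0,+_0,\times_0$ form an ordered semi-ring with equality $=_0$; (2) the defining axioms of the combinators $\Pi,\Sigma$ (giving $\lambda$-abstraction); (3) $\mathbf R_0(f,m,0)=m$, $\mathbf R_0(f,m,n+1)=f(n,\mathbf R_0(f,m,n))$; (4) extensionality: $x=_\rho y\to\varphi(x)=_\tau\varphi(y)$ for all $\varphi^{\rho\to\tau}$ and all types; (5) induction for quantifier-free formulas of $L_\omega$ (variables of any type allowed); (6) $\mathsf{QF\text{-}AC}^{1,0}$: $(\forall x^1)(\exists y^0)A(x,y)\to(\exists Y^{2})(\forall x^1)A(x,Y(x))$ for quantifier-free $A$. $\mathsf{ACA}_0^\omega$ is $\mathsf{RCA}_0^\omega$ plus $(\mu^2)$: there is $\mu^2$ such that for all $f^1$, if $(\exists n)(f(n)=0)$ then $\mu(f)$ is the least such $n$, and otherwise $\mu(f)=0$. Reals are represented by sequences of rationals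 $(q_n)$ with $|q_n-q_{n+i}|<2^{-n}$ for all $n,i$; $(q_n)=_{\mathbb R}(r_n)$ iff $|q_n-r_n|\le2^{-n+1}$ for all $n$; functions on $\mathbb R$ or $I=[0,1]$ are type $1\to1$ objects mapping equal reals to equal reals. A subset of $\mathbb R$ is given by $Y:\mathbb R\to\mathbb R$, with $x\in Y$ iff $Y(x)>_{\mathbb R}0$. Measure convention: statements about Lebesgue measure $\lambda(E)=\inf\{\sum_k|J_k|:(J_k)_{k\in\mathbb N}\text{ a sequence of open intervals with }E\subset\bigcup_kJ_k\}$ are read comparatively, without assuming the infimum exists: $\lambda(E)\ge a$ means that $a\le\sum_k|J_k|$ for each such cover of $E$; $\lambda(E)\le a$ means that for each $\delta>0$ there is such a cover with $\sum_k|J_k|\le a+\delta$; and so on. ''For almost all $x$'' means outside a set of measure $0$. $E\subseteq[0,1]$ is measurable if $\lambda(E)+\lambda([0,1]\setminus E)\le1$. $f$ is measurable if for all $t\in\mathbb R$ the set $\{x:f(x)>t\}$ is measurable. A sequence $(f_n)$ converges to $f$ in measure on $X$ if for every $\varepsilon>0$ and $k\in\mathbb N$ there is $N\in\mathbb N$ such that for $n\ge N$ the measure of $\{x\in X:|f_n(x)-f(x)|\ge\varepsilon\}$ is at most $\frac1{2^k}$. $\mathsf{WTE}$: let $f_n,f$ be measurable (on $I$) and such that $(f_n(x))_{n\in\mathbb N}$ converges to $f(x)$ for almost all $x\in I$; then $(f_n)_{n\in\mathbb N}$ converges to $f$ in measure (on $I$). $\mathsf{WHBU}_{\mathbf m}$: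 for every measurable $\Psi:[0,1]\to\mathbb R^+$ and $\varepsilon>0$ there are $y_0,\dots,y_n\in[0,1]$ such that the measure of $\bigcup_{i\le n}(y_i-\Psi(y_i),y_i+\Psi(y_i))$ is at least $1-\varepsilon$. *)

(* Defs.v *)
(* Provability in the higher-order systems RCA_0^omega and ACA_0^omega is
   derivability in a deep embedding of the language L_omega.

   Syntax is intrinsically typed and well scoped: [tm G s] and [fm G] are the
   terms of type [s] and the formulas whose free variables are listed in [G].
   Binders are entered by name through the notations below; [^^ t] weakens [t]
   from its own context to the larger one expected at the place of use, and is
   the identity on the underlying mathematics. *)

From Stdlib Require Import List.
Import ListNotations.
Set Implicit Arguments.
Unset Strict Implicit.
Unset Printing Implicit Defensive.

Inductive ty : Type := T0 | Arr (s t : ty).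

Declare Scope ty_scope.
Delimit Scope ty_scope with ty.
Bind Scope ty_scope with ty.
Notation "s ⇒ t" := (Arr s t) (at level 60, right associativity) : ty_scope.

Definition T1 : ty := Arr T0 T0.
Definition T2 : ty := Arr T1 T0.

Definition ctx := list ty.

Inductive var : ctx -> ty -> Type :=
| vz G s : var (s :: G) s
| vs G s t : var G s -> var (t :: G) s.

Inductive const : ty -> Type :=
| Zero : const T0
| One : const T0
| Plus : const (T0 ⇒ T0 ⇒ T0)
| Times : const (T0 ⇒ T0 ⇒ T0)
| Pi s t : const (s ⇒ t ⇒ s)
| Sigma r s t : const ((r ⇒ s ⇒ t) ⇒ (r ⇒ s) ⇒ r ⇒ t)
| Rec : const ((T0 ⇒ T0 ⇒ T0) ⇒ T0 ⇒ T0 ⇒ T0).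

Inductive tm (G : ctx) : ty -> Type :=
| Var s : var G s -> tm G s
| Con s : const s -> tm G s
| App s t : tm G (s ⇒ t) -> tm G s -> tm G t.

Arguments Var {G s}.
Arguments Con {G s}.
Arguments App {G s t}.

(* The logic is classical, so absurdity, implication and the universal
   quantifier are taken as primitive and the other connectives as defined. *)
Inductive fm : ctx -> Type :=
| Bot G : fm G
| Eq0 G : tm G T0 -> tm G T0 -> fm G
| Lt0 G : tm G T0 -> tm G T0 -> fm G
| Imp G : fm G -> fm G -> fm G
| All G s : fm (s :: G) -> fm G.

Arguments Bot {G}.

Declare Scope hol_scope.
Delimit Scope hol_scope with hol.
Bind Scope hol_scope with tm.
Bind Scope hol_scope with fm.
Local Open Scope hol_scope.

Definition ren (G D : ctx) := forall s, var G s -> var D s.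
Definition sub (G D : ctx) := forall s, var G s -> tm D s.

Definition case_var (P : ty -> Type) G t (h : P t) (f : forall s, var G s -> P s)
    s (x : var (t :: G) s) : P s :=
  match x in var G' s' return
    match G' with
    | [] => unit
    | t' :: G0 => P t' -> (forall s, var G0 s -> P s) -> P s'
    end
  with
  | vz _ _ => fun h _ => h
  | vs _ y => fun _ f => f _ y
  end h f.

Fixpoint ren_tm G D (r : ren G D) s (a : tm G s) : tm D s :=
  match a with
  | Var x => Var (r _ x)
  | Con c => Con c
  | App a b => App (ren_tm r a) (ren_tm r b)
  end.

Fixpoint sub_tm G D (r : sub G D) s (a : tm G s) : tm D s :=
  match a with
  | Var x => r _ x
  | Con c => Con c
  | App a b => App (sub_tm r a) (sub_tm r b)
  end.

Definition scons G D t (a : tm D t) (r : sub G D) : sub (t :: G) D :=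
  @case_var (tm D) G t a r.

Definition up_ren G D t (r : ren G D) : ren (t :: G) (t :: D) :=
  @case_var (var (t :: D)) G t (vz D t) (fun _ x => vs t (r _ x)).

Definition up_sub G D t (r : sub G D) : sub (t :: G) (t :: D) :=
  scons (Var (vz D t)) (fun _ x => ren_tm (fun _ y => vs t y) (r _ x)).

Fixpoint ren_fm G (A : fm G) : forall D, ren G D -> fm D :=
  match A with
  | Bot => fun _ _ => Bot
  | Eq0 a b => fun _ r => Eq0 (ren_tm r a) (ren_tm r b)
  | Lt0 a b => fun _ r => Lt0 (ren_tm r a) (ren_tm r b)
  | Imp A B => fun _ r => Imp (ren_fm A r) (ren_fm B r)
  | All A => fun _ r => All (ren_fm A (up_ren r))
  end.

Fixpoint sub_fm G (A : fm G) : forall D, sub G D -> fm D :=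
  match A with
  | Bot => fun _ _ => Bot
  | Eq0 a b => fun _ r => Eq0 (sub_tm r a) (sub_tm r b)
  | Lt0 a b => fun _ r => Lt0 (sub_tm r a) (sub_tm r b)
  | Imp A B => fun _ r => Imp (sub_fm A r) (sub_fm B r)
  | All A => fun _ r => All (sub_fm A (up_sub r))
  end.

Definition shift_fm G t (A : fm G) : fm (t :: G) := ren_fm A (fun _ x => vs t x).

(* [ext G D] : the context [D] is [G] with further variables added in front;
   it is found by instance resolution. *)
Class ext (G D : ctx) := ext_ren : ren G D.
#[global] Instance ext_refl G : ext G G | 0 := fun _ x => x.
#[global] Instance ext_cons G D t (e : ext G D) : ext G (t :: D) | 1 :=
  fun _ x => vs t (e _ x).

Definition wk G D (e : ext G D) s (a : tm G s) : tm D s := ren_tm e a.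

(* Bracket abstraction: lambda abstraction by means of the combinators. *)
Definition Icomb G s : tm G (s ⇒ s) :=
  App (App (Con (Sigma s (s ⇒ s) s)) (Con (Pi s (s ⇒ s)))) (Con (Pi s s)).

Fixpoint abs G s t (a : tm (s :: G) t) : tm G (s ⇒ t) :=
  match a in tm _ t return tm G (s ⇒ t) with
  | Var x => @case_var (fun u => tm G (s ⇒ u)) G s (Icomb G s)
               (fun u y => App (Con (Pi u s)) (Var y)) _ x
  | @Con _ u c => App (Con (Pi u s)) (Con c)
  | @App _ u v a b => App (App (Con (Sigma s u v)) (abs a)) (abs b)
  end.

Definition lam G s t (F : tm (s :: G) s -> tm (s :: G) t) : tm G (s ⇒ t) :=
  abs (F (Var (vz G s))).
Definition f_all G s (F : tm (s :: G) s -> fm (s :: G)) : fm G :=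
  All (F (Var (vz G s))).
Definition f_not G (A : fm G) : fm G := Imp A Bot.
Definition f_and G (A B : fm G) : fm G := f_not (Imp A (f_not B)).
Definition f_or G (A B : fm G) : fm G := Imp (f_not A) B.
Definition f_ex G s (F : tm (s :: G) s -> fm (s :: G)) : fm G :=
  f_not (f_all (fun x => f_not (F x))).

Notation "^^ a" := (wk _ a) (at level 5, a at level 5, format "^^ a") : hol_scope.
Notation "f · a" := (App f a) (at level 20, left associativity) : hol_scope.
Notation "0" := (Con Zero) : hol_scope.
Notation "1" := (Con One) : hol_scope.
Notation "a + b" := (Con Plus · a · b) : hol_scope.
Notation "a * b" := (Con Times · a · b) : hol_scope.
Notation "a ≐ b" := (Eq0 a b) (at level 70, no associativity) : hol_scope.
Notation "a ≺ b" := (Lt0 a b) (at level 70, no associativity) : hol_scope.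
Notation "a ≼ b" := (f_not (Lt0 b a)) (at level 70, no associativity) : hol_scope.
Notation "¬ A" := (f_not A) (at level 75, right associativity) : hol_scope.
Notation "A ∧ B" := (f_and A B) (at level 80, right associativity) : hol_scope.
Notation "A ∨ B" := (f_or A B) (at level 85, right associativity) : hol_scope.
Notation "A ⊃ B" := (Imp A B) (at level 90, right associativity) : hol_scope.
Notation "∀ x : s , A" := (f_all (s := s) (fun x => A))
  (at level 200, x name, s at level 60, A at level 200) : hol_scope.
Notation "∃ x : s , A" := (f_ex (s := s) (fun x => A))
  (at level 200, x name, s at level 60, A at level 200) : hol_scope.
Notation "'λ' x : s , a" := (lam (s := s) (fun x => a))
  (at level 200, x name, s at level 60, a at level 200) : hol_scope.

(* [A ⟦ a ⟧] and [A ⟦ a , b ⟧]: instances of a formula with one, respectively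
   two, distinguished free variables. *)
Definition inst1 G D (e : ext G D) s (A : fm (s :: G)) (a : tm D s) : fm D :=
  sub_fm A (scons a (fun _ x => Var (e _ x))).
Definition inst2 G D (e : ext G D) s t (A : fm (t :: s :: G))
    (a : tm D s) (b : tm D t) : fm D :=
  sub_fm A (scons b (scons a (fun _ x => Var (e _ x)))).
Notation "A ⟦ a ⟧" := (inst1 _ A a) (at level 8) : hol_scope.
Notation "A ⟦ a , b ⟧" := (inst2 _ A a b) (at level 8) : hol_scope.

Fixpoint eqt s : forall G, tm G s -> tm G s -> fm G :=
  match s with
  | T0 => fun _ a b => a ≐ b
  | Arr t u => fun _ a b => ∀ z : t, eqt (^^a · z) (^^b · z)
  end.

Fixpoint qf G (A : fm G) : Prop :=
  match A with
  | All _ => False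
  | Imp A B => qf A /\ qf B
  | _ => True
  end.

Definition theory := forall G, fm G -> Prop.

Inductive prv (T : theory) : forall G, list (fm G) -> fm G -> Prop :=
| prv_ax G H (A : fm G) : T G A -> prv T H A
| prv_hyp G H (A : fm G) : In A H -> prv T H A
| prv_impI G H (A B : fm G) : prv T (A :: H) B -> prv T H (A ⊃ B)
| prv_impE G H (A B : fm G) : prv T H (A ⊃ B) -> prv T H A -> prv T H B
| prv_raa G H (A : fm G) : prv T ((¬ A) :: H) Bot -> prv T H A
| prv_allI G H s (A : fm (s :: G)) :
    prv T (map (shift_fm s) H) A -> prv T H (All A)
| prv_allE G H s (A : fm (s :: G)) (a : tm G s) :
    prv T H (All A) -> prv T H (A⟦a⟧).

Definition proves (T : theory) (A : fm []) : Prop := prv T [] A.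

(* An axiom may have free variables; by [prv_allI] these amount to universally
   quantified parameters. *)

Inductive basic_ax G : fm G -> Prop :=
| ax_refl (a : tm G T0) : basic_ax (a ≐ a)
| ax_sym (a b : tm G T0) : basic_ax (a ≐ b ⊃ b ≐ a)
| ax_trans (a b c : tm G T0) : basic_ax (a ≐ b ⊃ b ≐ c ⊃ a ≐ c)
| ax_ltcong (a a' b b' : tm G T0) :
    basic_ax (a ≐ a' ⊃ b ≐ b' ⊃ a ≺ b ⊃ a' ≺ b')
| ax_addcong (a a' b b' : tm G T0) :
    basic_ax (a ≐ a' ⊃ b ≐ b' ⊃ a + b ≐ a' + b')
| ax_mulcong (a a' b b' : tm G T0) :
    basic_ax (a ≐ a' ⊃ b ≐ b' ⊃ a * b ≐ a' * b')
| ax_addA (a b c : tm G T0) : basic_ax ((a + b) + c ≐ a + (b + c))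
| ax_addC (a b : tm G T0) : basic_ax (a + b ≐ b + a)
| ax_add0 (a : tm G T0) : basic_ax (a + 0 ≐ a)
| ax_mulA (a b c : tm G T0) : basic_ax ((a * b) * c ≐ a * (b * c))
| ax_mulC (a b : tm G T0) : basic_ax (a * b ≐ b * a)
| ax_mul1 (a : tm G T0) : basic_ax (a * 1 ≐ a)
| ax_mul0 (a : tm G T0) : basic_ax (a * 0 ≐ 0)
| ax_mulD (a b c : tm G T0) : basic_ax (a * (b + c) ≐ a * b + a * c)
| ax_ltirr (a : tm G T0) : basic_ax (¬ (a ≺ a))
| ax_lttrans (a b c : tm G T0) : basic_ax (a ≺ b ⊃ b ≺ c ⊃ a ≺ c)
| ax_lttot (a b : tm G T0) : basic_ax (a ≺ b ∨ a ≐ b ∨ b ≺ a)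
| ax_ltadd (a b c : tm G T0) : basic_ax (a ≺ b ⊃ a + c ≺ b + c)
| ax_ltmul (a b c : tm G T0) : basic_ax (0 ≺ c ⊃ a ≺ b ⊃ a * c ≺ b * c)
| ax_ge0 (a : tm G T0) : basic_ax (0 ≼ a)
| ax_lt01 : basic_ax (0 ≺ 1).

Inductive RCA0w : theory :=
| rca_basic G (A : fm G) : basic_ax A -> RCA0w A
| rca_Pi G s t (a : tm G s) (b : tm G t) :
    RCA0w (eqt (Con (Pi s t) · a · b) a)
| rca_Sigma G r s t (a : tm G (r ⇒ s ⇒ t)) (b : tm G (r ⇒ s)) (c : tm G r) :
    RCA0w (eqt (Con (Sigma r s t) · a · b · c) (a · c · (b · c)))
| rca_Rec0 G (f : tm G (T0 ⇒ T0 ⇒ T0)) (m : tm G T0) :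
    RCA0w (Con Rec · f · m · 0 ≐ m)
| rca_RecS G (f : tm G (T0 ⇒ T0 ⇒ T0)) (m n : tm G T0) :
    RCA0w (Con Rec · f · m · (n + 1) ≐ f · n · (Con Rec · f · m · n))
| rca_ext G r t (f : tm G (r ⇒ t)) (a b : tm G r) :
    RCA0w (eqt a b ⊃ eqt (f · a) (f · b))
| rca_ind G (A : fm (T0 :: G)) : qf A ->
    RCA0w (A⟦0⟧ ∧ (∀ n : T0, A⟦n⟧ ⊃ A⟦n + 1⟧) ⊃ ∀ n : T0, A⟦n⟧)
| rca_QFAC10 G (A : fm (T0 :: T1 :: G)) : qf A ->
    RCA0w ((∀ x : T1, ∃ y : T0, A⟦^^x, y⟧) ⊃
           ∃ Y : T2, ∀ x : T1, A⟦x, ^^Y · x⟧).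

Definition mu2 G : fm G :=
  ∃ mu : T2, ∀ f : T1,
    ((∃ n : T0, ^^f · n ≐ 0) ⊃
       f · (^^mu · f) ≐ 0 ∧ ∀ i : T0, i ≺ ^^mu · ^^f ⊃ ¬ (^^f · i ≐ 0))
    ∧ (¬ (∃ n : T0, ^^f · n ≐ 0) ⊃ ^^mu · f ≐ 0).

Inductive ACA0w : theory :=
| aca_rca G (A : fm G) : RCA0w A -> ACA0w A
| aca_mu G : ACA0w (mu2 G).

Definition cpred' G : tm G (T0 ⇒ T0) := λ n : T0, Con Rec · (λ k : T0, λ r : T0, ^^k) · 0 · n.
Definition cpred G (a : tm G T0) : tm G T0 := cpred' G · a.

Definition monus' G : tm G (T0 ⇒ T0 ⇒ T0) :=
  λ a : T0, λ b : T0, Con Rec · (λ k : T0, λ r : T0, cpred r) · ^^a · b.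
Definition monus G (a b : tm G T0) : tm G T0 := monus' G · a · b.

(* integer square root: it grows by one exactly at the squares *)
Definition isqrt' G : tm G (T0 ⇒ T0) :=
  λ a : T0, Con Rec
    · (λ k : T0, λ r : T0, r + monus 1 (monus ((r + 1) * (r + 1)) (^^k + 1)))
    · 0 · a.
Definition isqrt G (a : tm G T0) : tm G T0 := isqrt' G · a.

Definition cpair' G : tm G (T0 ⇒ T0 ⇒ T0) :=
  λ a : T0, λ b : T0, (^^a + b) * (^^a + b) + ^^a.
Definition cpair G (a b : tm G T0) : tm G T0 := cpair' G · a · b.
Definition cfst' G : tm G (T0 ⇒ T0) := λ c : T0, monus c (isqrt c * isqrt c).
Definition cfst G (c : tm G T0) : tm G T0 := cfst' G · c.
Definition csnd' G : tm G (T0 ⇒ T0) := λ c : T0, monus (isqrt c) (cfst c).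
Definition csnd G (c : tm G T0) : tm G T0 := csnd' G · c.

Definition pow2' G : tm G (T0 ⇒ T0) :=
  λ n : T0, Con Rec · (λ k : T0, λ r : T0, r + r) · 1 · n.
Definition pow2 G (n : tm G T0) : tm G T0 := pow2' G · n.

(* Every number [q] codes a rational, namely (p - m) / (d + 1) for
   q = cpair (cpair p m) d; codes are not unique, and are only compared with
   [Qlt], [Qle]. *)
Definition Qmk G (p m d : tm G T0) : tm G T0 := cpair (cpair p m) d.
Definition Qpos G (q : tm G T0) : tm G T0 := cfst (cfst q).
Definition Qneg G (q : tm G T0) : tm G T0 := csnd (cfst q).
Definition Qden G (q : tm G T0) : tm G T0 := csnd q + 1.

Definition Qlt G (q r : tm G T0) : fm G :=
  Qpos q * Qden r + Qneg r * Qden q ≺ Qpos r * Qden q + Qneg q * Qden r.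
Definition Qle G (q r : tm G T0) : fm G := ¬ Qlt r q.
Definition Qadd' G : tm G (T0 ⇒ T0 ⇒ T0) :=
  λ q : T0, λ r : T0,
    Qmk (Qpos ^^q * Qden r + Qpos r * Qden ^^q)
        (Qneg ^^q * Qden r + Qneg r * Qden ^^q)
        (cpred (Qden ^^q * Qden r)).
Definition Qadd G (q r : tm G T0) : tm G T0 := Qadd' G · q · r.
Definition Qopp' G : tm G (T0 ⇒ T0) := λ q : T0, Qmk (Qneg q) (Qpos q) (csnd q).
Definition Qopp G (q : tm G T0) : tm G T0 := Qopp' G · q.
Definition Qabs' G : tm G (T0 ⇒ T0) :=
  λ q : T0, Qmk (monus (Qpos q) (Qneg q) + monus (Qneg q) (Qpos q)) 0 (csnd q).
Definition Qabs G (q : tm G T0) : tm G T0 := Qabs' G · q.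
Definition Qsub G (q r : tm G T0) : tm G T0 := Qadd q (Qopp r).
Definition Q0 G : tm G T0 := Qmk 0 0 0.
Definition Q1 G : tm G T0 := Qmk 1 0 0.
(* 2^(-n) and 2^(-n+1) *)
Definition Qexp G (n : tm G T0) : tm G T0 := Qmk 1 0 (cpred (pow2 n)).
Definition Qexp' G (n : tm G T0) : tm G T0 := Qadd (Qexp n) (Qexp n).

Definition isReal G (x : tm G T1) : fm G :=
  ∀ n : T0, ∀ i : T0,
    Qlt (Qabs (Qsub (^^x · ^^n) (^^x · (^^n + i)))) (Qexp ^^n).
Definition Req G (x y : tm G T1) : fm G :=
  ∀ n : T0, Qle (Qabs (Qsub (^^x · n) (^^y · n))) (Qexp' n).
Definition Rlt G (x y : tm G T1) : fm G :=
  ∃ n : T0, Qlt (Qadd (^^x · n) (Qexp' n)) (^^y · n).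
Definition Rle G (x y : tm G T1) : fm G := ¬ Rlt y x.

Definition RofQ G (q : tm G T0) : tm G T1 := λ n : T0, ^^q.
Definition R0 G : tm G T1 := RofQ (Q0 G).
Definition R1 G : tm G T1 := RofQ (Q1 G).
(* the shift of index keeps the rate of convergence required by [isReal] *)
Definition Radd G (x y : tm G T1) : tm G T1 :=
  λ n : T0, Qadd (^^x · (n + 1)) (^^y · (n + 1)).
Definition Rsub G (x y : tm G T1) : tm G T1 :=
  λ n : T0, Qsub (^^x · (n + 1)) (^^y · (n + 1)).
Definition Rabs G (x : tm G T1) : tm G T1 := λ n : T0, Qabs (^^x · n).
(* u(0) + ... + u(N-1), again with an index shift, as N < 2^N *)
Definition Rsum G (u : tm G (T0 ⇒ T1)) (N : tm G T0) : tm G T1 :=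
  λ n : T0, Con Rec
    · (λ k : T0, λ r : T0, Qadd r (^^u · ^^k · (^^n + ^^N)))
    · Q0 _ · ^^N.

(* A set of reals is a formula with a distinguished variable of type 1, of
   which only the instances at (codes of) reals matter. *)
Definition rset (G : ctx) := fm (T1 :: G).
Definition mkset G (F : tm (T1 :: G) T1 -> fm (T1 :: G)) : rset G :=
  F (Var (vz G T1)).
Notation "⦃ x | A ⦄" := (mkset (fun x => A)) (at level 0, x name) : hol_scope.
Notation "x ∈ E" := (inst1 _ E x) (at level 70, no associativity) : hol_scope.

Definition wkset G D (e : ext G D) (E : rset G) : rset D := ⦃ x | x ∈ E ⦄.
Notation "^: E" := (wkset _ E) (at level 5, E at level 5, format "^: E") : hol_scope.

Definition Rline G : rset G := ⦃ x | isReal x ⦄.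
Definition I01 G : rset G := ⦃ x | isReal x ∧ Rle (R0 _) x ∧ Rle x (R1 _) ⦄.
Definition setD G (D E : rset G) : rset G := ⦃ x | x ∈ D ∧ ¬ (x ∈ E) ⦄.

Definition isFun G (D : rset G) (f : tm G (T1 ⇒ T1)) : fm G :=
  (∀ x : T1, x ∈ D ⊃ isReal (^^f · x)) ∧
  (∀ x : T1, ∀ y : T1,
     ^^x ∈ D ⊃ y ∈ D ⊃ Req ^^x y ⊃ Req (^^f · ^^x) (^^f · y)).

Definition set_of G (Y : tm G (T1 ⇒ T1)) : rset G :=
  ⦃ x | isReal x ∧ Rlt (R0 _) (^^Y · x) ⦄.

(* A sequence of open intervals J_k = (a_k, b_k); a_k = b_k gives the empty one. *)
Definition intervals G (a b : tm G (T0 ⇒ T1)) : fm G :=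
  ∀ k : T0, isReal (^^a · k) ∧ isReal (^^b · k) ∧ Rle (^^a · k) (^^b · k).
Definition covers G (a b : tm G (T0 ⇒ T1)) (E : rset G) : fm G :=
  intervals a b ∧
  ∀ x : T1, isReal x ⊃ x ∈ E ⊃
    ∃ k : T0, Rlt (^^a · k) ^^x ∧ Rlt ^^x (^^b · k).

Definition total G (a b : tm G (T0 ⇒ T1)) (N : tm G T0) : tm G T1 :=
  Rsum (λ k : T0, Rsub (^^b · k) (^^a · k)) N.

(* sum_k |J_k| <= c, and c <= sum_k |J_k|, where the sum is the possibly
   infinite supremum of the partial sums *)
Definition total_le G (a b : tm G (T0 ⇒ T1)) (c : tm G T1) : fm G :=
  ∀ N : T0, Rle (total ^^a ^^b N) ^^c.
Definition total_ge G (a b : tm G (T0 ⇒ T1)) (c : tm G T1) : fm G :=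
  ∀ d : T1, isReal d ⊃ Rlt (R0 _) d ⊃
    ∃ N : T0, Rle ^^c (Radd (total ^^a ^^b N) ^^d).

Definition measure_le G (E : rset G) (c : tm G T1) : fm G :=
  ∀ d : T1, isReal d ⊃ Rlt (R0 _) d ⊃
    ∃ a : T0 ⇒ T1, ∃ b : T0 ⇒ T1,
      covers ^^a b ^:E ∧ total_le ^^a b (Radd ^^c ^^d).
Definition measure_ge G (E : rset G) (c : tm G T1) : fm G :=
  ∀ a : T0 ⇒ T1, ∀ b : T0 ⇒ T1, covers ^^a b ^:E ⊃ total_ge ^^a b ^^c.

Definition measure2_le G (E F : rset G) (c : tm G T1) : fm G :=
  ∀ d : T1, isReal d ⊃ Rlt (R0 _) d ⊃
    ∃ a : T0 ⇒ T1, ∃ b : T0 ⇒ T1, ∃ a' : T0 ⇒ T1, ∃ b' : T0 ⇒ T1,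
      covers ^^a ^^b ^:E ∧ covers ^^a' b' ^:F ∧
      ∀ N : T0, Rle (Radd (total ^^a ^^b N) (total ^^a' ^^b' N)) (Radd ^^c ^^d).

Definition measurable_set G (E : rset G) : fm G :=
  measure2_le E (setD (I01 _) E) (R1 _).

Definition measurable_fun G (f : tm G (T1 ⇒ T1)) : fm G :=
  isFun (I01 _) f ∧
  ∀ t : T1, isReal t ⊃
    measurable_set ⦃ x | x ∈ I01 G ∧ Rlt ^^t (^^f · x) ⦄.

(* The exceptional null set is itself a set object Y : R -> R. *)
Definition almost_all G (A : rset G) : fm G :=
  ∃ Y : T1 ⇒ T1,
    isFun (Rline _) Y ∧ measure_le (set_of Y) (R0 _) ∧
    ∀ x : T1, x ∈ I01 G ⊃ ¬ (x ∈ set_of Y) ⊃ x ∈ A.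

Definition converges_at G (F : tm G (T0 ⇒ T1 ⇒ T1)) (f : tm G (T1 ⇒ T1))
    (x : tm G T1) : fm G :=
  ∀ e : T1, isReal e ⊃ Rlt (R0 _) e ⊃
    ∃ N : T0, ∀ n : T0, ^^N ≼ n ⊃
      Rlt (Rabs (Rsub (^^F · n · ^^x) (^^f · ^^x))) ^^e.

Definition converges_in_measure G (F : tm G (T0 ⇒ T1 ⇒ T1))
    (f : tm G (T1 ⇒ T1)) : fm G :=
  ∀ e : T1, ∀ k : T0, isReal ^^e ⊃ Rlt (R0 _) ^^e ⊃
    ∃ N : T0, ∀ n : T0, ^^N ≼ n ⊃
      measure_le
        ⦃ x | x ∈ I01 G ∧ Rle ^^e (Rabs (Rsub (^^F · ^^n · x) (^^f · x))) ⦄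
        (RofQ (Qexp ^^k)).

Definition WTE : fm [] :=
  ∀ F : T0 ⇒ T1 ⇒ T1, ∀ f : T1 ⇒ T1,
    (∀ n : T0, measurable_fun (^^F · n)) ⊃
    measurable_fun f ⊃
    almost_all ⦃ x | converges_at ^^F ^^f x ⦄ ⊃
    converges_in_measure ^^F f.

(* The finite sequence y_0, ..., y_n is a pair of n and a type 0 -> 1 object y.
   The union of the intervals is a subset of R, not cut down to [0,1]. *)
Definition WHBUm : fm [] :=
  ∀ Psi : T1 ⇒ T1, ∀ e : T1,
    measurable_fun ^^Psi ⊃
    (∀ x : T1, x ∈ I01 [] ⊃ Rlt (R0 _) (^^Psi · x)) ⊃
    isReal e ⊃ Rlt (R0 _) e ⊃
    ∃ n : T0, ∃ y : T0 ⇒ T1,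
      (∀ i : T0, i ≼ ^^n ⊃ ^^y · i ∈ I01 []) ∧
      measure_ge
        ⦃ x | ∃ i : T0, i ≼ ^^n ∧
                Rlt (Rsub (^^y · i) (^^Psi · (^^y · i))) ^^x ∧
                Rlt ^^x (Radd (^^y · i) (^^Psi · (^^y · i))) ⦄
        (Rsub (R1 _) ^^e).

(* Main.v *)
(* By the completeness theorem it suffices to argue in a model of ACA_0^omega,
   which may be taken extensional and with true equality in type 0.  Its type 0
   objects form a possibly nonstandard model N of arithmetic.  The fractions of N
   form an ordered field K, and the reals of the model take values in the Cauchy
   completion R of K, so that their arithmetic is that of an ordered field.

   Given Psi, the indicator functions of {Psi <= 2^-n} converge to 0 everywhere,
   so by WTE, for some n, the set {Psi <= 2^-n} is covered by intervals J_k of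
   total length at most epsilon.  Cut [0, 1] into cells of length 2^-n.  In a cell
   [p, q] let y be the supremum of the rationals r such that, for some m, the
   lengths of the J_k with k < m cut to [p, r] sum up to at least r - p; mu^2
   defines y uniformly in the cell.  If y is in some J_k, then r = q has this
   property: the J_k fill the cell.  Otherwise Psi(y) > 2^-n, so that the cell lies
   in (y - Psi(y), y + Psi(y)), and the same supremum argument shows that every
   cover of the union of these intervals fills the cell.  Hence such a cover and
   the J_k have total length at least 1. *)
From HB Require Import structures.
From mathcomp Require Import all_boot all_order all_algebra.
From mathcomp Require Import boolp classical_sets.
From Stdlib Require Import List Ring.
Require Import Defs.
Import ListNotations.
Set Implicit Arguments.
Unset Strict Implicit.
Unset Printing Implicit Defensive.

(** * Substitution *)

(** Two obstacles shape the proof. The points [y] of all cells have to form one object of type 0 ->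
    1. To pick in every cell a point outside the [J_k] would be a choice of reals, whereas the
    choice axiom only picks numbers. The supremum avoids this: it is a canonical point, computed
    from the [J_k] alone by an arithmetical definition, and it needs no decision whether the cell is
    filled. The other obstacle is that [N] may be nonstandard, so that induction and least elements
    are available only for predicates represented in the model. Every operation that enters such a
    predicate therefore comes with a proof that it is definable, and inequalities between values in
    [R] are proved by induction on the codes. For the same reason being covered is replaced by a
    condition on finite sums of lengths: it needs only number quantifiers over the cover, and it
    adds up along adjacent intervals. *)

Lemma var_case G t (P : forall s, var (t :: G) s -> Prop) :
  P t (vz G t) -> (forall s x, P s (vs t x)) -> forall s x, P s x.
Proof.
move=> Pz Ps s x.
move: P Pz Ps.
refine (match x in var G' s' return
  match G' as g return var g s' -> Prop with
  | [] => fun _ => True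
  | t' :: G0 => fun x => forall P : forall s, var (t' :: G0) s -> Prop,
      P t' (vz G0 t') -> (forall s x, P s (vs t' x)) -> P s' x
  end x with
  | vz _ _ => _ | vs _ _ _ _ => _ end); by move=> P.
Qed.

Lemma fun_ext2 (P : ty -> Type) G (f g : forall s, var G s -> P s) :
  (forall s x, f s x = g s x) -> f = g.
Proof.
by move=> E; apply: functional_extensionality_dep => s; apply: functional_extensionality_dep.
Qed.

Lemma scons_ext G D t (f g : sub (t :: G) D) :
  f t (vz G t) = g t (vz G t) ->
  (forall s x, f s (vs t x) = g s (vs t x)) -> f = g.
Proof. by move=> E1 E2; apply: fun_ext2; apply: var_case. Qed.

Section Subst.
Implicit Types G D E : ctx.

Lemma ren_ren_tm G D E (r : ren G D) (q : ren D E) s (a : tm G s) :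
  ren_tm q (ren_tm r a) = ren_tm (fun s x => q s (r s x)) a.
Proof. by elim: a => //= u v a -> b ->. Qed.

Lemma sub_ren_tm G D E (r : ren G D) (q : sub D E) s (a : tm G s) :
  sub_tm q (ren_tm r a) = sub_tm (fun s x => q s (r s x)) a.
Proof. by elim: a => //= u v a -> b ->. Qed.

Lemma ren_sub_tm G D E (r : sub G D) (q : ren D E) s (a : tm G s) :
  ren_tm q (sub_tm r a) = sub_tm (fun s x => ren_tm q (r s x)) a.
Proof. by elim: a => //= u v a -> b ->. Qed.

Lemma sub_sub_tm G D E (r : sub G D) (q : sub D E) s (a : tm G s) :
  sub_tm q (sub_tm r a) = sub_tm (fun s x => sub_tm q (r s x)) a.
Proof. by elim: a => //= u v a -> b ->. Qed.

Lemma ren_is_sub_tm G D (r : ren G D) s (a : tm G s) :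
  ren_tm r a = sub_tm (fun s x => Var (r s x)) a.
Proof. by elim: a => //= u v a -> b ->. Qed.

Lemma sub_Var_tm G s (a : tm G s) : sub_tm (fun s x => Var x) a = a.
Proof. by elim: a => //= u v a -> b ->. Qed.

Lemma ren_is_sub G D (r : ren G D) (A : fm G) :
  ren_fm A r = sub_fm A (fun s x => Var (r s x)).
Proof.
elim: A D r => //= {G}.
- by move=> G a b D r; rewrite !ren_is_sub_tm.
- by move=> G a b D r; rewrite !ren_is_sub_tm.
- by move=> G A IA B IB D r; rewrite IA IB.
- move=> G s A IA D r; rewrite IA; congr (All (sub_fm _ _)).
  by apply: scons_ext.
Qed.

Lemma sub_ren G D E (r : ren G D) (q : sub D E) (A : fm G) :
  sub_fm (ren_fm A r) q = sub_fm A (fun s x => q s (r s x)).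
Proof.
elim: A D E r q => //= {G}.
- by move=> G a b D E r q; rewrite !sub_ren_tm.
- by move=> G a b D E r q; rewrite !sub_ren_tm.
- by move=> G A IA B IB D E r q; rewrite IA IB.
- move=> G s A IA D E r q; rewrite IA; congr (All (sub_fm _ _)).
  by apply: scons_ext.
Qed.

Lemma sub_sub G D E (r : sub G D) (q : sub D E) (A : fm G) :
  sub_fm (sub_fm A r) q = sub_fm A (fun s x => sub_tm q (r s x)).
Proof.
elim: A D E r q => //= {G}.
- by move=> G a b D E r q; rewrite !sub_sub_tm.
- by move=> G a b D E r q; rewrite !sub_sub_tm.
- by move=> G A IA B IB D E r q; rewrite IA IB.
- move=> G s A IA D E r q; rewrite IA; congr (All (sub_fm _ _)).
  by apply: scons_ext => //= u x; rewrite /up_sub /= sub_ren_tm ren_sub_tm.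
Qed.

Lemma sub_inst1 G D G' (e : ext G D) s (A : fm (s :: G)) (a : tm D s) (r : sub D G') :
  sub_fm (inst1 e A a) r =
  sub_fm A (scons (sub_tm r a) (fun s x => r s (e s x))).
Proof. by rewrite /inst1 sub_sub; congr sub_fm; apply: scons_ext. Qed.

Lemma sub_inst2 G D G' (e : ext G D) s t (A : fm (t :: s :: G)) (a : tm D s)
    (b : tm D t) (r : sub D G') :
  sub_fm (inst2 e A a b) r =
  sub_fm A (scons (sub_tm r b) (scons (sub_tm r a) (fun s x => r s (e s x)))).
Proof.
rewrite /inst2 sub_sub; congr sub_fm; apply: scons_ext => //; apply: var_case => //.
Qed.

Lemma sub_eqt s G D (a b : tm G s) (r : sub G D) :
  sub_fm (eqt a b) r = eqt (sub_tm r a) (sub_tm r b).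
Proof.
elim: s G D a b r => //= s _ t IH G D a b r.
rewrite /f_all /= IH /= /wk !sub_ren_tm !ren_sub_tm.
by congr (All (eqt (App _ _) (App _ _))).
Qed.

Lemma qf_sub G D (A : fm G) (r : sub G D) : qf A -> qf (sub_fm A r).
Proof. by elim: A D r => //= {G} G A IA B IB D r [/IA{}IA /IB{}IB]. Qed.

Lemma basic_sub G D (A : fm G) (r : sub G D) : basic_ax A -> basic_ax (sub_fm A r).
Proof. by case; constructor. Qed.

(** The Henkin construction instantiates the free variables of axioms by terms. For induction and
    choice the substitution is pushed past the distinguished variables by [up_sub], and both sides
    become a single substitution into [A]. *)
Lemma RCA0w_sub G D (A : fm G) (r : sub G D) : RCA0w A -> RCA0w (sub_fm A r).
Proof.
move=> H; case: H r => {G A}.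
- by move=> G A /basic_sub H r; apply: rca_basic.
- by move=> G s t a b r; rewrite sub_eqt; apply: rca_Pi.
- by move=> G u s t a b c r; rewrite sub_eqt; apply: rca_Sigma.
- by move=> G f m r; apply: rca_Rec0.
- by move=> G f m n r; apply: rca_RecS.
- by move=> G s t f a b r /=; rewrite !sub_eqt; apply: rca_ext.
- move=> G A qA r.
  have := @rca_ind D (sub_fm A (up_sub r)) (qf_sub _ qA).
  rewrite /f_all /= !sub_inst1 /inst1 !sub_sub.
  set X1 := sub_fm A _; set X2 := sub_fm A _; set X3 := sub_fm A _.
  set Y1 := sub_fm A _; set Y2 := sub_fm A _; set Y3 := sub_fm A _.
  suff [E1 [E2 E3]] : X1 = Y1 /\ X2 = Y2 /\ X3 = Y3 by rewrite E1 E2 E3.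
  split; last split; congr sub_fm; apply: scons_ext => //= s x; rewrite /up_sub /= !sub_ren_tm.
  + exact: sub_Var_tm.
  + by rewrite ren_is_sub_tm.
  + by rewrite ren_is_sub_tm.
- move=> G A qA r.
  have := @rca_QFAC10 D (sub_fm A (up_sub (up_sub r))) (qf_sub _ qA).
  rewrite /f_all /f_ex /f_not /f_all /= !sub_inst2 /inst2 !sub_sub.
  set X1 := sub_fm A _; set X2 := sub_fm A _.
  set Y1 := sub_fm A _; set Y2 := sub_fm A _.
  suff [E1 E2] : X1 = Y1 /\ X2 = Y2 by rewrite E1 E2.
  split; congr sub_fm; apply: scons_ext => //=; apply: var_case => //= s x;
   rewrite /up_sub /= !sub_ren_tm /= ren_ren_tm ren_is_sub_tm; by [].
Qed.

Lemma ACA0w_sub G D (A : fm G) (r : sub G D) : ACA0w A -> ACA0w (sub_fm A r).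
Proof.
move=> H; case: H r => {G A} [G A HA|G] r; first exact/aca_rca/RCA0w_sub.
exact: aca_mu.
Qed.
End Subst.

(** * Completeness *)

Section Quotient.
Variables (T : Type) (R : T -> T -> Prop).
Hypotheses (Rrefl : forall x, R x x) (Rsym : forall x y, R x y -> R y x)
  (Rtrans : forall x y z, R x y -> R y z -> R x z).

(** Classes are predicates, and representatives are taken by choice. The term model, the fractions
    and the completion are all built this way. *)
Definition quot := {P : T -> Prop | exists x, P = R x}.
Definition qpi (x : T) : quot := exist _ (R x) (ex_intro _ x (erefl (R x))).
Definition qrepr (q : quot) : T := sval (cid (svalP q)).

Lemma qreprK q : qpi (qrepr q) = q.
Proof.
rewrite /qrepr; case: cid => x /= E; case: q E => P HP /= E; subst P.
by congr exist; exact: Prop_irrelevance.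
Qed.

Lemma qpi_eq x y : qpi x = qpi y <-> R x y.
Proof.
split=> [[E]|H]; first by rewrite E.
have E : R x = R y.
  by apply/funext=> z; apply/propext; split; apply: Rtrans => //; apply: Rsym.
rewrite /qpi; move: (ex_intro _ x _) (ex_intro _ y _); rewrite E => p q.
by congr exist; exact: Prop_irrelevance.
Qed.
End Quotient.

(** * Semantics of the language *)

Record model := Model {
  dom :> ty -> Type;
  ap : forall s t, dom (Arr s t) -> dom s -> dom t;
  co : forall s, const s -> dom s;
  lt0 : dom T0 -> dom T0 -> Prop }.
Arguments ap {m s t}.
Arguments co {m s}.
Arguments lt0 {m}.

Definition env (M : model) G := forall s, var G s -> M s.
Definition esc (M : model) G t (a : M t) (e : env M G) : env M (t :: G) :=
  @case_var M G t a e.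
Definition enil (M : model) : env M [] :=
  fun s x => match x in var G' s' return
      match G' with [] => M s' | _ => unit end with
    | vz _ _ => tt | vs _ _ _ _ => tt end.

Lemma var_nil s (x : var [] s) : False.
Proof.
exact: (match x in var G _ return match G with [] => False | _ => True end with
        | vz _ _ => I | vs _ _ _ _ => I end).
Qed.

Lemma env_nil (M : model) (e e' : env M []) : e = e'.
Proof. by apply: fun_ext2 => s x; case: (var_nil x). Qed.

Fixpoint eval (M : model) G (e : env M G) s (a : tm G s) : M s :=
  match a with
  | Var _ x => e _ x
  | Con _ c => co c
  | App _ _ a b => ap (eval e a) (eval e b)
  end.

Fixpoint sat (M : model) G (A : fm G) : env M G -> Prop :=
  match A with
  | Bot _ => fun _ => False
  | Eq0 _ a b => fun e => eval e a = eval e b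
  | Lt0 _ a b => fun e => lt0 (eval e a) (eval e b)
  | Imp _ A B => fun e => sat A e -> sat B e
  | All _ _ A => fun e => forall x, sat A (esc x e)
  end.

Definition extensional (M : model) :=
  forall s t (f g : M (Arr s t)), (forall x, ap f x = ap g x) -> f = g.

Definition is_model (T : theory) (M : model) :=
  forall G (A : fm G) (e : env M G), T G A -> sat A e.

(* Henkin's witnesses are the terms [HE A r], where [r] instantiates the
   parameters of [A]: a counterexample to [∀ x, A] if there is one. *)
Inductive ht : ty -> Type :=
| HC s : const s -> ht s
| HA s t : ht (Arr s t) -> ht s -> ht t
| HE G s (A : fm (s :: G)) (r : forall u, var G u -> ht u) : ht s.

Definition henv G := forall s, var G s -> ht s.
Definition hsc G t (a : ht t) (r : henv G) : henv (t :: G) := @case_var ht G t a r.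

Fixpoint vmax G : (forall s, var G s -> nat) -> nat :=
  match G with
  | [] => fun _ => 0
  | t :: G => fun f => maxn (f t (vz G t)) (vmax (fun s x => f s (vs t x)))
  end.

Lemma vmax_ge G (f : forall s, var G s -> nat) s x : f s x <= vmax f.
Proof.
elim: x f => {G s} [G s|G s t x IH] f /=; first exact: leq_maxl.
exact: leq_trans (IH (fun s x => f s (vs t x))) (leq_maxr _ _).
Qed.

(** Nesting depth of witnesses. Only the parameters [r] count: the formula of a witness is an
    ordinary one and contains no witnesses. *)
Fixpoint rank s (a : ht s) : nat :=
  match a with
  | HC _ _ => 0
  | HA _ _ f a => maxn (rank f) (rank a)
  | HE _ _ _ r => (vmax (fun s x => rank (r s x))).+1
  end.

Record name := Name {nG : ctx; ns : ty; nA : fm (ns :: nG); nr : henv nG}.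
Definition name_ht (e : name) : ht (ns e) := HE (nA e) (@nr e).

(** A sentence of the Henkin language, kept as a formula together with witness terms for its
    variables; this spares a second syntax of formulas over [ht]. *)
Record inst := Inst {iG : ctx; iA : fm iG; ir : henv iG}.

(** A translation of witness terms into terms of the original language. It is free on the witnesses
    [HE], which may become arbitrary terms, in particular fresh variables; derivability is thus
    always tested in the original calculus. *)
Record hom D (v : forall s, ht s -> tm D s) : Prop := Hom {
  homC : forall s (c : const s), v s (HC c) = Con c;
  homA : forall s t (f : ht (Arr s t)) a, v t (HA f a) = App (v _ f) (v s a) }.

Definition tr D (v : forall s, ht s -> tm D s) (i : inst) : fm D :=
  sub_fm (iA i) (fun s x => v s (@ir i s x)).

Definition henkin (e : name) : inst :=
  @Inst (ns e :: nG e) (Imp (nA e) (shift_fm _ (All (nA e)))) (hsc (name_ht e) (@nr e)).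

Lemma tr_henkin D (v : forall s, ht s -> tm D s) (e : name) :
  tr v (henkin e) =
  Imp (sub_fm (nA e) (scons (v _ (name_ht e)) (fun s x => v s (@nr e s x))))
      (All (sub_fm (nA e) (up_sub (fun s x => v s (@nr e s x))))).
Proof.
rewrite /tr /henkin /shift_fm [sub_fm _ _]/=; congr Imp.
  by congr sub_fm; apply: scons_ext.
rewrite sub_ren; congr (All (sub_fm _ _)); apply: scons_ext => //=.
Qed.

Section Update.
Variables (e0 : name) (D : ctx) (v : forall s, ht s -> tm D s).
Hypothesis hv : hom v.

(** The witness [e0] becomes the fresh variable. Another witness keeps its translation even if [e0]
    occurs among its parameters, since [hom] asks nothing about witnesses. *)
Fixpoint upd s (a : ht s) : tm (ns e0 :: D) s :=
  match a with
  | HC _ c => Con c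
  | HA _ _ f a => App (upd f) (upd a)
  | @HE G s A r =>
      match pselect (e0 = @Name G s A r) with
      | left E => Var (eq_rect _ (fun e => var (ns e0 :: D) (ns e)) (vz D (ns e0)) _ E)
      | right _ => ren_tm (fun s x => vs (ns e0) x) (v (HE A r))
      end
  end.

Lemma upd_hom : hom upd. Proof. by []. Qed.

Lemma upd_other (e : name) : e <> e0 ->
  upd (name_ht e) = ren_tm (fun s x => vs (ns e0) x) (v (name_ht e)).
Proof.
by move=> ne; rewrite /name_ht /=; case: pselect => // E; case: ne; rewrite E; case: {+}e.
Qed.

(** A term of smaller rank cannot contain [e0]. *)
Lemma upd_low s (a : ht s) : rank a < rank (name_ht e0) ->
  upd a = ren_tm (fun s x => vs (ns e0) x) (v a).
Proof.
elim: a => //= {s}.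
- by move=> s c _; rewrite (homC hv).
- by move=> s t f IHf a IHa; rewrite gtn_max => /andP[/IHf{}IHf /IHa{}IHa]; rewrite IHf IHa (homA hv).
- move=> G s A r _; case: pselect => // E lt; exfalso.
  by have := congr1 (fun e => rank (name_ht e)) E; move: lt; rewrite /= => + e; rewrite e ltnn.
Qed.
End Update.

Lemma upd_name (e : name) D (v : forall s, ht s -> tm D s) :
  upd e v (name_ht e) = Var (vz D (ns e)).
Proof.
case: e => G s A r /=; case: pselect => [E|]; last by [].
by rewrite (Prop_irrelevance E erefl).
Qed.

(** A default element of each type. *)
Fixpoint zero_tm G s : tm G s :=
  match s with
  | T0 => Con Zero
  | Arr s t => App (Con (Pi t s)) (zero_tm G t)
  end.

(** * Consistency of the Henkin axioms *)

Section Provability.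
Variable T : theory.
Hypothesis Tsub : forall G D (A : fm G) (r : sub G D), T A -> T (sub_fm A r).

Lemma prv_weak G (H H' : list (fm G)) A : prv T H A -> incl H H' -> prv T H' A.
Proof.
move=> P; elim: P H' => {G H A}.
- by move=> G H A TA H' _; apply: prv_ax.
- by move=> G H A HA H' s; apply: prv_hyp; apply: s.
- move=> G H A B _ IH H' s; apply: prv_impI; apply: IH => C [<-|/s]; [by left|by right].
- by move=> G H A B _ IA _ IB H' s; apply: prv_impE (IA _ s) (IB _ s).
- move=> G H A _ IH H' s; apply: prv_raa; apply: IH => C [<-|/s]; [by left|by right].
- by move=> G H s A _ IH H' i; apply: prv_allI; apply: IH; apply: incl_map.
- by move=> G H s A a _ IH H' i; apply: prv_allE; apply: IH.
Qed.

Lemma prv_cut G (H : list (fm G)) A B : prv T (A :: H) B -> prv T H A -> prv T H B.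
Proof. by move=> P; apply: prv_impE; apply: prv_impI. Qed.

Lemma prv_botE G (H : list (fm G)) A : prv T H Bot -> prv T H A.
Proof. by move=> P; apply: prv_raa; apply: prv_weak P _ => x; right. Qed.

(** The negation of [B] at the fresh variable implies the Henkin axiom. So a contradiction from the
    axiom proves [B] at that variable, which can then be generalized. *)
Lemma henkin_step G (H : list (fm G)) s (B : fm (s :: G)) :
  ~ prv T H (All B) ->
  ~ prv T (Imp B (shift_fm s (All B)) :: map (shift_fm s) H) Bot.
Proof.
move=> nB P; apply: nB; apply: prv_allI; apply: prv_raa.
apply: prv_cut.
  apply: prv_weak P _ => x [<-|i]; [by left|by right; right; exact: i].
apply: prv_impI; apply: prv_botE; apply: (@prv_impE _ _ _ B); apply: prv_hyp.
  by right; left.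
by left.
Qed.

(** Because all translations are quantified over, a single translation that keeps the list
    consistent shows that it is not inconsistent. *)
Definition incons (l : list inst) :=
  forall D (v : forall s, ht s -> tm D s), hom v -> prv T (map (tr v) l) Bot.

Variable g : fm [].
Hypothesis ng : ~ prv T [] g.

Definition no_henv : henv [] :=
  fun s x => match x in var G' s' return
      match G' with [] => ht s' | _ => unit end with
    | vz _ _ => tt | vs _ _ _ _ => tt end.
Definition goal : inst := Inst (f_not g) no_henv.

Lemma sub_Var G (A : fm G) : sub_fm A (fun s x => Var x) = A.
Proof.
elim: A => //= {G}.
- by move=> G a b; rewrite !sub_Var_tm.
- by move=> G a b; rewrite !sub_Var_tm.
- by move=> G A -> B ->.
- by move=> G s A {2}<-; congr (All (sub_fm _ _)); apply: scons_ext.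
Qed.

Lemma sub_closed D E (A : fm []) (r : sub [] D) (q : sub D E) (p : sub [] E) :
  sub_fm (sub_fm A r) q = sub_fm A p.
Proof. by rewrite sub_sub; congr sub_fm; apply: fun_ext2 => s x; case: (var_nil x). Qed.

Lemma max_rank (l : list name) : l <> [] ->
  exists2 e, In e l & forall e', In e' l -> rank (name_ht e') <= rank (name_ht e).
Proof.
elim: l => // a [|b l] IH _; first by exists a; [left|move=> e [->|[]]].
have [//|e ie me] := IH.
have [le|/ltnW le] := leqP (rank (name_ht a)) (rank (name_ht e)).
  by exists e; [right|move=> e' [<-//|/me]].
exists a; first by left.
by move=> e' [<-//|/me le']; exact: leq_trans le' le.
Qed.

(* Eliminate a witness of maximal rank first: it does not occur in the Henkin
   axioms of the others. *)
Lemma henkin_consistent n (l : list name) : length l <= n ->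
  exists D (v : forall s, ht s -> tm D s), hom v /\
    ~ prv T (map (tr v) (goal :: map henkin l)) Bot.
Proof.
elim: n l => [|n IH] l.
  (* With no Henkin axioms left any translation serves, and witnesses become default terms. *)
  case: l => // _; pose v := fix v s (a : ht s) : tm [] s :=
    match a with HC _ c => Con c | HA _ _ f a => App (v _ f) (v _ a) | HE _ s _ _ => zero_tm [] s end.
  exists [], v; split=> //=.
  rewrite /tr /= => P; apply: ng; apply: prv_raa.
  move: P; rewrite (_ : (fun s x => _) = (fun s x => Var x)); last first.
    by apply: fun_ext2 => s x; case: (var_nil x).
  by rewrite sub_Var.
have [->|ne] := EM (l = []); first by move=> _; apply: (IH []).
have [e ie me] := max_rank ne; move=> sl.
(* Every occurrence of [e] is removed, so that all remaining names differ from [e], as [upd_other]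
   requires. *)
pose l' := filter (fun x => `[< x <> e >]) l.
have sl' : length l' <= n.
  rewrite -ltnS; apply: leq_trans sl; rewrite /l'.
  elim: l ie {me ne l'} => //= a l IHl [->|ia].
    case: asboolP => // _; rewrite ltnS.
    by elim: l {IHl} => //= b l IHl; case: ifP => _ //=; exact: leqW.
  by case: ifP => _ /=; rewrite ltnS ?IHl //; exact/ltnW/IHl.
have {IH} [D [v [hv Pv]]] := IH l' sl'.
set B := sub_fm (nA e) (up_sub (fun s x => v s (@nr e s x))).
have incl_l D' (v' : forall s, ht s -> tm D' s) :
    incl (map (tr v') (goal :: map henkin l)) (tr v' (henkin e) :: map (tr v') (goal :: map henkin l')).
  move=> x /= [<-|]; first by right; left.
  rewrite map_map => /in_map_iff [a [<- ia]].
  have [->|ne'] := EM (a = e); first by left.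
  right; right; rewrite map_map; apply/in_map_iff; exists a; split=> //.
  by apply/filter_In; split=> //; apply/asboolP.
(* If the universal formula is derivable, so is the Henkin axiom, and [v] is kept. Otherwise the
   witness becomes a fresh variable and [henkin_step] applies. *)
have [PB|nPB] := EM (prv T (map (tr v) (goal :: map henkin l')) (All B)).
  exists D, v; split=> // P; apply: Pv; apply: prv_cut (prv_weak P (@incl_l D v)) _.
  by rewrite tr_henkin; apply: prv_impI; apply: prv_weak PB _ => x; right.
exists (ns e :: D), (upd e v); split; first exact: upd_hom.
move=> P; apply: (henkin_step nPB); apply: prv_weak P _.
apply: incl_tran (@incl_l _ _) _ => x [<-|].
  left; rewrite tr_henkin upd_name /shift_fm ren_is_sub [sub_fm (All B) _]/= /B sub_sub.
  have E s (y : var (nG e) s) : upd e v (@nr e s y) = ren_tm (fun s x => vs (ns e) x) (v s (@nr e s y)).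
    by apply: upd_low => //=; rewrite ltnS; exact: (vmax_ge (fun s x => rank (@nr e s x))).
  congr Imp; first by congr sub_fm; apply: scons_ext => //= s y; rewrite E ren_is_sub_tm.
  congr (All (sub_fm _ _)); apply: scons_ext => //= s y.
  by rewrite /up_sub /= E sub_ren_tm ren_ren_tm ren_is_sub_tm.
move=> ix; right; move: ix; rewrite !map_cons => -[<-|].
  left; rewrite /shift_fm ren_is_sub; exact: sub_closed.
move=> /in_map_iff [_ [<- /in_map_iff [a [<- ia]]]]; right; rewrite in_map_iff.
exists (tr v (henkin a)); split; last by apply: in_map; apply: in_map.
have /filter_In [il /asboolP ne'] := ia.
rewrite !tr_henkin /shift_fm /= !ren_is_sub !sub_sub.
have E s (y : var (nG a) s) : upd e v (@nr a s y) = ren_tm (fun s x => vs (ns e) x) (v s (@nr a s y)).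
  apply: upd_low => //; apply: leq_trans (me a il); rewrite ltnS.
  exact: (vmax_ge (fun s x => rank (@nr a s x))).
congr Imp.
  congr sub_fm; apply: scons_ext => [|s y].
    by rewrite -[RHS]/(upd e v (name_ht a)) upd_other // ren_is_sub_tm.
  by rewrite [RHS]/= E ren_is_sub_tm.
congr (All (sub_fm _ _)); apply: scons_ext => //= s y.
by rewrite /up_sub /= E !sub_ren_tm ren_ren_tm ren_is_sub_tm.
Qed.

Definition base : set inst := [set i | i = goal \/ exists e, i = henkin e]%classic.

Definition consistent (A : set inst) := forall l, (forall i, In i l -> A i) -> ~ incons l.

Lemma base_consistent : consistent base.
Proof.
move=> l Hl I.
have [ln Hn] : exists ln, incl l (goal :: map henkin ln).
  elim: l Hl {I} => [|i l IH] Hl; first by exists [].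
  have [j jl|ln Hn] := IH; first by apply: Hl; right.
  have [->|[e ->]] := Hl i (or_introl erefl).
    by exists ln => x [<-|/Hn]; [left|].
  exists (e :: ln) => x [<-|/Hn [<-|ix]]; [by right; left|by left|by right; right].
have [D [v [hv]]] := henkin_consistent (leqnn (length ln)); apply.
by apply: prv_weak (I D v hv) _; apply: incl_map.
Qed.

Lemma maximal_consistent : exists V : set inst, (base `<=` V)%classic /\ consistent V /\
  forall i, ~ V i -> exists2 l, (forall j, In j l -> V j) & incons (i :: l).
Proof.
(* With [base] joined to [A], the union of the empty chain satisfies [P] as well, by
   [base_consistent]. *)
pose P (A : set inst) := consistent (A `|` base)%classic.
have [F FP tF|A [PA mA]] := @Zorn_bigcup inst P.
  move=> l Hl.
  suff [H|[X FX H]] : (forall i, In i l -> base i) \/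
      exists2 X, F X & forall i, In i l -> (X `|` base)%classic i.
  - exact: base_consistent.
  - exact: (FP X FX).
  elim: l Hl => [|i l IH] Hl; first by left.
  have {}IH := IH (fun j jl => Hl j (or_intror jl)).
  have [[Y FY Yi]|bi] := Hl i (or_introl erefl).
    right; case: IH => [H|[X FX H]].
      by exists Y => // j [<-|/H]; [left|right].
    have [s|s] := tF _ _ FX FY.
      by exists Y => // j [<-|/H [/s|]]; [left|left|right].
    by exists X => // j [<-|/H //]; left; apply: s.
  case: IH => [H|[X FX H]]; [left|right].
    by move=> j [<-|/H].
  by exists X => // j [<-|/H //]; right.
exists (A `|` base)%classic; split; first by move=> i; right.
split=> // i nVi; apply: contrapT => H.
apply: (mA (A `|` [set i])%classic).
  split; first by move=> j; left.
  by move=> /(_ i (or_intror erefl)) Ai; apply: nVi; left.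
move=> l Hl I; apply: H; exists (filter (fun j => `[< j <> i >]) l).
  move=> j /filter_In [/Hl jl /asboolP ne]; case: jl => [[|]|] => [||b]; [by left|by move/ne|by right].
move=> D v hv; apply: prv_weak (I D v hv) _; apply: incl_map => j jl.
have [->|ne] := EM (j = i); first by left.
by right; apply/filter_In; split=> //; apply/asboolP.
Qed.

(** * The term model of a maximal consistent set *)

Section Truth.
Variable V : set inst.
Hypotheses (Vbase : (base `<=` V)%classic) (Vcons : consistent V)
  (Vmax : forall i, ~ V i -> exists2 l, (forall j, In j l -> V j) & incons (i :: l)).

(** Otherwise maximality refutes [i] together with members of [V], and a cut refutes members of [V]
    alone. *)
Lemma V_closed l (i : inst) : (forall j, In j l -> V j) ->
  (forall D (v : forall s, ht s -> tm D s), hom v -> prv T (map (tr v) l) (tr v i)) -> V i.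
Proof.
move=> Hl P; apply: contrapT => /Vmax [l' Hl' I].
apply: (@Vcons (l ++ l')) => [j ij|D v hv]; first by case: (in_app_or _ _ _ ij) => [/Hl|/Hl'].
rewrite map_app; apply: prv_cut (prv_weak (I D v hv) _) _ => [|].
  by move=> x [<-|ix]; [left|right; apply: in_or_app; right].
by apply: prv_weak (P D v hv) _ => x ix; apply: in_or_app; left.
Qed.

Lemma V_bot G (r : henv G) : ~ V (Inst Bot r).
Proof.
move=> H; apply: (@Vcons [Inst Bot r]) => [j [<-|[]] //|D v hv].
by apply: prv_hyp; left.
Qed.

Lemma V_imp G (A B : fm G) (r : henv G) :
  V (Inst (Imp A B) r) <-> (V (Inst A r) -> V (Inst B r)).
Proof.
split=> [HI HA|H].
  apply: (@V_closed [Inst (Imp A B) r; Inst A r]) => [j [<-|[<-|[]]] //|D v hv].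
  by apply: (@prv_impE _ _ _ (tr v (Inst A r))); apply: prv_hyp; [left|right; left].
have [/H HB|nA] := EM (V (Inst A r)).
  apply: (@V_closed [Inst B r]) => [j [<-|[]] //|D v hv].
  by apply: prv_impI; apply: prv_hyp; right; left.
have [l Hl I] := Vmax nA.
by apply: (V_closed Hl) => D v hv; apply: prv_impI; apply: prv_botE; exact: (I D v hv).
Qed.

Lemma V_ax G (A : fm G) (r : henv G) : T A -> V (Inst A r).
Proof. by move=> TA; apply: (@V_closed []) => // D v hv; apply/prv_ax/Tsub. Qed.

Lemma V_tr (i j : inst) :
  (forall D (v : forall s, ht s -> tm D s), hom v -> tr v i = tr v j) -> V i -> V j.
Proof.
move=> E Vi; apply: (@V_closed [i]) => [k [<-|[]] //|D v hv].
by rewrite -E //; apply: prv_hyp; left.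
Qed.

(** From right to left the instance at the witness [HE A r] is enough, by its Henkin axiom. *)
Lemma V_all G s (A : fm (s :: G)) (r : henv G) :
  V (Inst (All A) r) <-> forall a : ht s, V (Inst A (hsc a r)).
Proof.
split=> [H a|H].
  apply: (@V_closed [Inst (All A) r]) => [j [<-|[]] //|D v hv].
  have := @prv_allE T D [tr v (Inst (All A) r)] s (sub_fm A (up_sub (fun s x => v s (r s x)))) (v _ a).
  rewrite /inst1 sub_sub => P.
  rewrite (_ : tr v (Inst A _) = sub_fm A (fun u x =>
      sub_tm (scons (v s a) (fun s x => Var (@ext_refl D s x)))
        (up_sub (fun s x => v s (r s x)) x))).
    by apply: P; apply: prv_hyp; left.
  congr sub_fm; apply: scons_ext => //= u x.
  by rewrite /up_sub /= sub_ren_tm; rewrite -[LHS]sub_Var_tm.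
have Ve : V (henkin (@Name G s A r)) by apply: Vbase; right; exists (@Name G s A r).
have {}H := H (HE A r).
apply: (@V_closed [henkin (@Name G s A r); Inst A (hsc (HE A r) r)]).
  by move=> j [<-|[<-|[]]].
move=> D v hv.
apply: (@prv_impE _ _ _ (tr v (Inst A (hsc (HE A r) r)))); apply: prv_hyp; last by right; left.
left; rewrite tr_henkin; congr Imp.
by congr sub_fm; apply: scons_ext.
Qed.

Fixpoint hev G (r : henv G) s (a : tm G s) : ht s :=
  match a with
  | Var _ x => r _ x
  | Con _ c => HC c
  | App _ _ a b => HA (hev r a) (hev r b)
  end.

Lemma hom_hev D (v : forall s, ht s -> tm D s) G (r : henv G) s (a : tm G s) :
  hom v -> v s (hev r a) = sub_tm (fun s x => v s (r s x)) a.
Proof. by move=> [hC hA]; elim: a => //= {s} s t f IHf a IHa; rewrite hA IHf IHa. Qed.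

Definition two s t (a : ht s) (b : ht t) : henv [s; t] := hsc a (hsc b no_henv).
Definition x0 s t : tm [s; t] s := Var (vz [t] s).
Definition x1 s t : tm [s; t] t := Var (vs s (vz [] t)).

(** One fixed formula with two variables represents all equations; by [V_eq] any other presentation
    of the same equation agrees with it. *)
Definition Veq (a b : ht T0) := V (Inst (Eq0 (x0 T0 T0) (x1 T0 T0)) (two a b)).
Definition Vlt (a b : ht T0) := V (Inst (Lt0 (x0 T0 T0) (x1 T0 T0)) (two a b)).

Lemma V_eq G (a b : tm G T0) (r : henv G) : V (Inst (Eq0 a b) r) <-> Veq (hev r a) (hev r b).
Proof. by split; apply: V_tr => D v hv; rewrite /tr /= !hom_hev. Qed.

Lemma V_lt G (a b : tm G T0) (r : henv G) : V (Inst (Lt0 a b) r) <-> Vlt (hev r a) (hev r b).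
Proof. by split; apply: V_tr => D v hv; rewrite /tr /= !hom_hev. Qed.

Fixpoint Veqt s : ht s -> ht s -> Prop :=
  match s with
  | T0 => Veq
  | Arr s t => fun f g => forall z : ht s, Veqt (HA f z) (HA g z)
  end.

Lemma hev_wk G t (c : ht t) (r : henv G) s (a : tm G s) :
  hev (hsc c r) (wk (@ext_cons G G t (@ext_refl G)) a) = hev r a.
Proof. by rewrite /wk; elim: a => //= u w f -> x ->. Qed.

Lemma V_eqt s G (a b : tm G s) (r : henv G) :
  V (Inst (eqt a b) r) <-> Veqt (hev r a) (hev r b).
Proof.
elim: s G a b r => [|s _ t IH] G a b r; first exact: V_eq.
rewrite /= V_all; split=> H z; have := H z; rewrite IH /= !hev_wk; exact.
Qed.

Hypothesis TR : forall G (A : fm G), RCA0w A -> T A.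

Lemma V_basic G (A : fm G) (r : henv G) : basic_ax A -> V (Inst A r).
Proof. by move=> bA; apply: V_ax; apply: TR; apply: rca_basic. Qed.

Lemma Veq_refl a : Veq a a.
Proof. by have := V_basic (two a a) (ax_refl (x0 _ _)); rewrite V_eq. Qed.

Lemma Veq_sym a b : Veq a b -> Veq b a.
Proof. by have := V_basic (two a b) (ax_sym (x0 _ _) (x1 _ _)); rewrite V_imp !V_eq. Qed.

Lemma Veq_trans a b c : Veq a b -> Veq b c -> Veq a c.
Proof.
have := V_basic (hsc c (two a b))
  (ax_trans (Var (vs T0 (vz [T0] T0))) (Var (vs T0 (vs T0 (vz [] T0)))) (Var (vz [T0; T0] T0))).
by rewrite !V_imp !V_eq.
Qed.

Lemma Veqt_refl s (a : ht s) : Veqt a a.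
Proof. by elim: s a => [|s _ t IH] a //=; exact: Veq_refl. Qed.

Lemma Veqt_sym s (a b : ht s) : Veqt a b -> Veqt b a.
Proof.
by elim: s a b => [|s _ t IH] a b /=; [exact: Veq_sym|move=> H z; exact: IH].
Qed.

Lemma Veqt_trans s (a b c : ht s) : Veqt a b -> Veqt b c -> Veqt a c.
Proof.
elim: s a b c => [|s _ t IH] a b c /=; first exact: Veq_trans.
by move=> H K z; apply: IH (H z) (K z).
Qed.

(** This is where the extensionality axiom enters. Together with the definition of [Veqt] at arrow
    types it makes application well defined on classes. *)
Lemma Veqt_app s t (f : ht (Arr s t)) (a b : ht s) : Veqt a b -> Veqt (HA f a) (HA f b).
Proof.
have /TR/V_ax := @rca_ext _ _ _ (Var (vz [s; s] (Arr s t)))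
  (Var (vs (Arr s t) (vz [s] s))) (Var (vs (Arr s t) (vs s (vz [] s)))).
by move=> /(_ (hsc f (two a b))); rewrite V_imp !V_eqt.
Qed.

Definition qdom s := quot (@Veqt s).
Definition qp s (a : ht s) : qdom s := qpi (@Veqt s) a.

Lemma qp_eq s (a b : ht s) : qp a = qp b <-> Veqt a b.
Proof. by apply: qpi_eq; [exact: Veqt_refl|exact: Veqt_sym|exact: Veqt_trans]. Qed.

Lemma qp_repr s (q : qdom s) : qp (qrepr q) = q.
Proof. exact: qreprK. Qed.

Definition term_model : model := @Model qdom
  (fun s t f a => qp (HA (qrepr f) (qrepr a))) (fun s c => qp (HC c))
  (fun a b => Vlt (qrepr a) (qrepr b)).

Lemma qp_app s t (f : ht (Arr s t)) (a : ht s) :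
  @ap term_model s t (qp f) (qp a) = qp (HA f a).
Proof.
rewrite /=; apply/qp_eq; apply: (@Veqt_trans _ _ (HA f (qrepr (qp a)))).
  have : Veqt (qrepr (qp f)) f by apply/qp_eq; exact: qp_repr.
  by move=> /(_ (qrepr (qp a))).
by apply: Veqt_app; apply/qp_eq; exact: qp_repr.
Qed.

Lemma qp_eval G (r : henv G) s (a : tm G s) :
  @eval term_model G (fun s x => qp (r s x)) s a = qp (hev r a).
Proof. by elim: a => // {s} s t f IHf a IHa; rewrite -qp_app -IHf -IHa. Qed.

Lemma qp_lt a b : @lt0 term_model (qp a) (qp b) <-> Vlt a b.
Proof.
have H (u v u' v' : ht T0) : Veq u u' -> Veq v v' -> Vlt u v -> Vlt u' v'.
  have := V_basic (hsc u (hsc u' (two v v')))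
    (ax_ltcong (Var (vz [T0; T0; T0] T0)) (Var (vs T0 (vz [T0; T0] T0)))
      (Var (vs T0 (vs T0 (vz [T0] T0)))) (Var (vs T0 (vs T0 (vs T0 (vz [] T0)))))).
  by rewrite !V_imp !V_eq !V_lt.
have E u : Veq (qrepr (qp u)) u by apply/(@qp_eq T0); exact: qp_repr.
by split; apply: H; rewrite //; try exact: E; apply: Veq_sym; exact: E.
Qed.

(** Every element of the model is the class of a witness term, so quantifying over the model is
    quantifying over [ht], and [V_all] gives the universal case. *)
Lemma truth G (A : fm G) (r : henv G) :
  @sat term_model G A (fun s x => qp (r s x)) <-> V (Inst A r).
Proof.
elim: A r => {G}.
- by move=> G r; split=> // /V_bot.
- by move=> G a b r; rewrite V_eq /sat !qp_eval; exact: (@qp_eq T0).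
- by move=> G a b r; rewrite V_lt /sat !qp_eval; exact: qp_lt.
- by move=> G A IA B IB r; rewrite V_imp -IA -IB.
- move=> G s A IA r; rewrite V_all.
  have E a : (fun u x => qp (hsc a r x)) = @esc term_model G s (qp a) (fun s x => qp (r s x)).
    by apply: fun_ext2; apply: var_case.
  split=> [H a|H q]; first by apply/IA; rewrite E; apply: H.
  by have /IA := H (qrepr q); rewrite E qp_repr.
Qed.

Lemma term_model_ext : extensional term_model.
Proof.
move=> s t f h; rewrite -(qp_repr f) -(qp_repr h) => H; apply/qp_eq => z.
by have := H (qp z); rewrite !qp_app => /qp_eq.
Qed.

Lemma term_model_is_model : is_model T term_model.
Proof.
move=> G A e TA; have := V_ax (fun s x => qrepr (e s x)) TA; rewrite -truth.
by congr sat; apply: fun_ext2 => s x; rewrite qp_repr.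
Qed.

Lemma term_model_refutes : ~ sat g (@enil term_model).
Proof.
have -> : @enil term_model = (fun s x => qp (no_henv x)) by exact: env_nil.
rewrite truth => Vg; have : V goal by apply: Vbase; left.
by move=> /V_imp/(_ Vg); exact: V_bot.
Qed.
End Truth.
End Provability.

(** An unprovable [g] fails in the term model. Closure under substitution puts all instances of
    axioms into [V]; the axioms of [RCA0w] make [Veqt] a congruence for application and for the
    order. *)
Theorem completeness (T : theory) (g : fm []) :
  (forall G D (A : fm G) (r : sub G D), T G A -> T D (sub_fm A r)) ->
  (forall G (A : fm G), RCA0w A -> T G A) ->
  (forall M, extensional M -> is_model T M -> sat g (@enil M)) -> prv T [] g.
Proof.
move=> Tsub TR H; apply: contrapT => ng.
have [V [Vb [Vc Vm]]] := maximal_consistent ng.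
apply: (term_model_refutes Tsub Vb Vc Vm TR); apply: H.
  exact: (term_model_ext Tsub Vb Vc Vm TR).
exact: (term_model_is_model Tsub Vb Vc Vm TR).
Qed.

(** * Definability in a model *)

Record amodel := AModel {
  am :> model;
  am_ext : extensional am;
  am_ax : is_model ACA0w am }.

Lemma eval_ren (M : model) G D (r : ren G D) (e : env M D) s (a : tm G s) :
  eval e (ren_tm r a) = eval (fun s x => e s (r s x)) a.
Proof. by elim: a => //= u v f -> b ->. Qed.

Lemma eval_sub (M : model) G D (r : sub G D) (e : env M D) s (a : tm G s) :
  eval e (sub_tm r a) = eval (fun s x => eval e (r s x)) a.
Proof. by elim: a => //= u v f -> b ->. Qed.

Lemma env_eq (M : model) G t (f g : env M (t :: G)) :
  f t (vz G t) = g t (vz G t) ->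
  (forall s x, f s (vs t x) = g s (vs t x)) -> f = g.
Proof. by move=> E1 E2; apply: fun_ext2; apply: var_case. Qed.

Lemma sat_sub (M : model) G D (A : fm G) (r : sub G D) (e : env M D) :
  sat (sub_fm A r) e <-> sat A (fun s x => eval e (r s x)).
Proof.
elim: A D r e => //= {G}.
- by move=> G a b D r e; rewrite !eval_sub.
- by move=> G a b D r e; rewrite !eval_sub.
- by move=> G A IA B IB D r e; rewrite IA IB.
- move=> G s A IA D r e; split=> H x; have := H x; rewrite IA.
    by congr (sat A); apply: env_eq => //= u y; rewrite eval_ren.
  by congr (sat A); apply: env_eq => //= u y; rewrite eval_ren.
Qed.

Lemma sat_inst1 (M : model) G D (i : ext G D) s (A : fm (s :: G)) (a : tm D s) (e : env M D) :
  sat (inst1 i A a) e = sat A (esc (eval e a) (fun s x => e s (i s x))).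
Proof.
apply/propext.
by rewrite sat_sub (_ : (fun s x => _) = (esc (eval e a) (fun s x => e s (i s x)))) //; apply: env_eq. Qed.

Lemma sat_inst2 (M : model) G D (i : ext G D) s t (A : fm (t :: s :: G)) (a : tm D s)
    (b : tm D t) (e : env M D) :
  sat (inst2 i A a b) e =
  sat A (esc (eval e b) (esc (eval e a) (fun s x => e s (i s x)))).
Proof.
apply/propext.
rewrite sat_sub (_ : (fun s x => _) = (esc (eval e b) (esc (eval e a) (fun s x => e s (i s x))))) //.
by apply: env_eq => //; apply: var_case.
Qed.

Lemma eval_wk_cons (M : model) G D (i : ext G D) t (c : M t) (e : env M D) s (a : tm G s) :
  eval (esc c e) (wk (@ext_cons G D t i) a) = eval e (wk i a).
Proof. by rewrite /wk !eval_ren. Qed.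

Lemma eval_wk_refl (M : model) G (e : env M G) s (a : tm G s) :
  eval e (wk (@ext_refl G) a) = eval e a.
Proof. by rewrite /wk !eval_ren. Qed.

Lemma sat_not (M : model) G (A : fm G) (e : env M G) : sat (f_not A) e = (~ sat A e).
Proof.
apply/propext.
by []. Qed.

Lemma sat_imp (M : model) G (A B : fm G) (e : env M G) :
  sat (Imp A B) e = (sat A e -> sat B e).
Proof. by []. Qed.

Lemma sat_all (M : model) G s (F : tm (s :: G) s -> fm (s :: G)) (e : env M G) :
  sat (f_all F) e = (forall x, sat (F (Var (vz G s))) (esc x e)).
Proof. by []. Qed.

Lemma sat_and (M : model) G (A B : fm G) (e : env M G) :
  sat (f_and A B) e = (sat A e /\ sat B e).
Proof.
apply/propext.
split=> [H|[HA HB] H]; last exact: H.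
by split; apply: contrapT => n; apply: H.
Qed.

Lemma sat_or (M : model) G (A B : fm G) (e : env M G) :
  sat (f_or A B) e = (sat A e \/ sat B e).
Proof.
apply/propext.
split=> [H|[HA H|HB H //]]; last by case: (H HA).
by have [|/H] := EM (sat A e); [left|right].
Qed.

Lemma sat_ex (M : model) G s (F : tm (s :: G) s -> fm (s :: G)) (e : env M G) :
  sat (f_ex F) e = (exists x, sat (F (Var (vz G s))) (esc x e)).
Proof.
apply/propext.
split=> [H|[x Hx] H]; last exact: (H x).
by apply: contrapT => n; apply: H => x Hx; apply: n; exists x.
Qed.

Ltac sat_simp := repeat match goal with
  | |- context [sat (f_and ?A ?B) ?e] => rewrite (sat_and A B e)
  | |- context [sat (f_or ?A ?B) ?e] => rewrite (sat_or A B e)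
  | |- context [sat (f_not ?A) ?e] => rewrite (sat_not A e)
  | |- context [sat (f_all ?F) ?e] => rewrite (sat_all F e)
  | |- context [sat (f_ex ?F) ?e] => rewrite (sat_ex F e)
  | |- context [sat (Imp ?A ?B) ?e] => rewrite (sat_imp A B e)
  | |- context [sat (inst1 ?i ?A ?a) ?e] => rewrite (sat_inst1 i A a e)
  | |- context [sat (inst2 ?i ?A ?a ?b) ?e] => rewrite (sat_inst2 i A a b e)
  end.

Section Definability.
Variable M : amodel.
Local Notation N := (M T0).

(** Extensionality turns the pointwise equality of higher types into true equality. *)
Lemma sat_eqt s G (a b : tm G s) (e : env M G) : sat (eqt a b) e = (eval e a = eval e b).
Proof.
apply/propext.
elim: s G a b e => // s _ t IH G a b e.
pose w u (c : tm G (Arr s u)) := App (wk (@ext_cons G G s (@ext_refl G)) c) (Var (vz G s)).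
have -> : sat (eqt a b) e <-> forall x, sat (eqt (w t a) (w t b)) (esc x e) by [].
split=> H; first by apply: am_ext => x; have := H x; rewrite IH /= !eval_wk_cons !eval_wk_refl.
by move=> x; rewrite IH /= !eval_wk_cons !eval_wk_refl H.
Qed.

Lemma apK s t (a : M s) (b : M t) : ap (ap (co (Pi s t)) a) b = a.
Proof.
have := am_ax (esc a (esc b (@enil M)))
  (aca_rca (@rca_Pi _ s t (Var (vz [t] s)) (Var (vs s (vz [] t))))).
by rewrite sat_eqt.
Qed.

Lemma apS r s t (a : M (Arr r (Arr s t))) (b : M (Arr r s)) (c : M r) :
  ap (ap (ap (co (Sigma r s t)) a) b) c = ap (ap a c) (ap b c).
Proof.
have := am_ax (esc a (esc b (esc c (@enil M))))
  (aca_rca (@rca_Sigma _ r s t (Var (vz _ _)) (Var (vs _ (vz _ _))) (Var (vs _ (vs _ (vz _ _)))))).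
by rewrite sat_eqt.
Qed.

Lemma eval_lam G s t (F : tm (s :: G) s -> tm (s :: G) t) (e : env M G) (x : M s) :
  ap (eval e (lam F)) x = eval (esc x e) (F (Var (vz G s))).
Proof.
rewrite /lam; elim: (F _) => {F t} [u|u c|u v a IHa b IHb] /=.
- apply: (@var_case _ _ (fun u y => ap (eval e (case_var (Icomb G s) _ y)) x = esc x e y)).
    by rewrite /= !apS !apK.
  by move=> w y; rewrite /= apK.
- by rewrite apK.
- by rewrite apS IHa IHb.
Qed.

Definition zero : N := co Zero.
Definition one : N := co One.
Definition add (a b : N) : N := ap (ap (co Plus) a) b.
Definition mul (a b : N) : N := ap (ap (co Times) a) b.
Definition rec (f : M (Arr T0 (Arr T0 T0))) (m n : N) : N := ap (ap (ap (co Rec) f) m) n.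

Definition v0 : tm [T0; T0; T0] T0 := Var (vz _ _).
Definition v1 : tm [T0; T0; T0] T0 := Var (vs _ (vz _ _)).
Definition v2 : tm [T0; T0; T0] T0 := Var (vs _ (vs _ (vz _ _))).

Lemma basic_axiom A (a b c : N) : basic_ax A ->
  sat A (esc a (esc b (esc c (@enil M)))).
Proof. by move=> H; apply: am_ax; apply/aca_rca/rca_basic. Qed.

Lemma addA (a b c : N) : add a (add b c) = add (add a b) c.
Proof. by symmetry; exact: (basic_axiom a b c (ax_addA v0 v1 v2)). Qed.
Lemma addC (a b : N) : add a b = add b a.
Proof. exact: (basic_axiom a b a (ax_addC v0 v1)). Qed.
Lemma addn0 (a : N) : add a zero = a.
Proof. exact: (basic_axiom a a a (ax_add0 v0)). Qed.
Lemma mulA (a b c : N) : mul a (mul b c) = mul (mul a b) c.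
Proof. by symmetry; exact: (basic_axiom a b c (ax_mulA v0 v1 v2)). Qed.
Lemma mulC (a b : N) : mul a b = mul b a.
Proof. exact: (basic_axiom a b a (ax_mulC v0 v1)). Qed.
Lemma muln1 (a : N) : mul a one = a.
Proof. exact: (basic_axiom a a a (ax_mul1 v0)). Qed.
Lemma muln0 (a : N) : mul a zero = zero.
Proof. exact: (basic_axiom a a a (ax_mul0 v0)). Qed.
Lemma mulDr (a b c : N) : mul a (add b c) = add (mul a b) (mul a c).
Proof. exact: (basic_axiom a b c (ax_mulD v0 v1 v2)). Qed.
Lemma ltnn' (a : N) : ~ lt0 a a.
Proof. exact: (basic_axiom a a a (ax_ltirr v0)). Qed.
Lemma ltn_trans' (a b c : N) : lt0 a b -> lt0 b c -> lt0 a c.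
Proof. exact: (basic_axiom a b c (ax_lttrans v0 v1 v2)). Qed.
Lemma ltn_total (a b : N) : lt0 a b \/ a = b \/ lt0 b a.
Proof. by have := basic_axiom a b a (ax_lttot v0 v1); rewrite !sat_or. Qed.
Lemma ltnD (a b c : N) : lt0 a b -> lt0 (add a c) (add b c).
Proof. exact: (basic_axiom a b c (ax_ltadd v0 v1 v2)). Qed.
Lemma ltnM (a b c : N) : lt0 zero c -> lt0 a b -> lt0 (mul a c) (mul b c).
Proof. exact: (basic_axiom a b c (ax_ltmul v0 v1 v2)). Qed.
Lemma nge0 (a : N) : ~ lt0 a zero.
Proof. exact: (basic_axiom a a a (ax_ge0 v0)). Qed.
Lemma ltn01 : lt0 zero one.
Proof. exact: (basic_axiom zero zero zero (ax_lt01 _)). Qed.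

Lemma rec0 f m : rec f m zero = m.
Proof.
exact: (am_ax (esc f (esc m (@enil M)))
  (aca_rca (@rca_Rec0 _ (Var (vz _ _)) (Var (vs _ (vz _ _)))))).
Qed.

Lemma recS f m n : rec f m (add n one) = ap (ap f n) (rec f m n).
Proof.
exact: (am_ax (esc f (esc m (esc n (@enil M))))
  (aca_rca (@rca_RecS _ (Var (vz _ _)) (Var (vs _ (vz _ _))) (Var (vs _ (vs _ (vz _ _))))))).
Qed.

(** * Definable functions and relations *)

Fixpoint penv (G : ctx) : Type :=
  match G with [] => unit | s :: G => (M s * penv G)%type end.
Fixpoint arrs (G : ctx) (t : ty) : ty :=
  match G with [] => t | s :: G => arrs G (Arr s t) end.
Fixpoint apps G : forall t, M (arrs G t) -> penv G -> M t :=
  match G with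
  | [] => fun t f _ => f
  | s :: G => fun t f g => ap (@apps G (Arr s t) f g.2) g.1
  end.

(** Definability with parameters, without syntax: some element of the curried type represents [F].
    The head of the context is the last argument, so that abstraction over it is immediate. *)
Definition dfn G t (F : penv G -> M t) := exists f : M (arrs G t), forall g, apps f g = F g.

Lemma dfn_const G t (c : M t) : dfn (fun _ : penv G => c).
Proof.
elim: G t c => [|s G IH] t c; first by exists c.
have [f Hf] := IH _ (ap (co (Pi t s)) c).
by exists f => -[x g] /=; rewrite Hf apK.
Qed.

(** Induction on the context; [Sigma] hands the newest variable to the function and to the
    argument. *)
Lemma dfn_app G s t (F : penv G -> M (Arr s t)) (H : penv G -> M s) :
  dfn F -> dfn H -> dfn (fun g => ap (F g) (H g)).
Proof.
elim: G s t F H => [|u G IH] s t F H [f Hf] [h Hh].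
  by exists (ap f h) => -[]; rewrite /= -(Hf tt) -(Hh tt).
have [k Hk] := IH _ _ _ _ (IH _ _ _ _ (dfn_const G (co (Sigma u s t)))
  (ex_intro _ f (fun g => erefl))) (ex_intro _ h (fun g => erefl)).
exists k => -[x g] /=; rewrite Hk apS.
by rewrite -(Hf (x, g)) -(Hh (x, g)).
Qed.

Lemma dfn_v0 G s : dfn (fun g : penv (s :: G) => g.1).
Proof.
have [f Hf] := dfn_const G (ap (ap (co (Sigma s (Arr s s) s)) (co (Pi s (Arr s s)))) (co (Pi s s))).
by exists f => -[x g] /=; rewrite Hf apS apK.
Qed.

Lemma dfn_weak G s t (F : penv G -> M t) : dfn F -> dfn (fun g : penv (s :: G) => F g.2).
Proof.
move=> dF; have [f Hf] := dfn_app (dfn_const G (co (Pi t s))) dF.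
by exists f => -[x g] /=; rewrite Hf apK.
Qed.

Lemma dfn_v1 G s s1 : dfn (fun g : penv (s1 :: s :: G) => g.2.1).
Proof. exact: (dfn_weak _ (dfn_v0 _ _)). Qed.
Lemma dfn_v2 G s s1 s2 : dfn (fun g : penv (s1 :: s2 :: s :: G) => g.2.2.1).
Proof. exact: (dfn_weak _ (dfn_v1 _ _ _)). Qed.
Lemma dfn_v3 G s s1 s2 s3 : dfn (fun g : penv (s1 :: s2 :: s3 :: s :: G) => g.2.2.2.1).
Proof. exact: (dfn_weak _ (dfn_v2 _ _ _ _)). Qed.
Lemma dfn_v4 G s s1 s2 s3 s4 : dfn (fun g : penv (s1 :: s2 :: s3 :: s4 :: s :: G) => g.2.2.2.2.1).
Proof. exact: (dfn_weak _ (dfn_v3 _ _ _ _ _)). Qed.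
Lemma dfn_v5 G s s1 s2 s3 s4 s5 :
  dfn (fun g : penv (s1 :: s2 :: s3 :: s4 :: s5 :: s :: G) => g.2.2.2.2.2.1).
Proof. exact: (dfn_weak _ (dfn_v4 _ _ _ _ _ _)). Qed.

Lemma dfn_ext G t (F H : penv G -> M t) : F =1 H -> dfn F -> dfn H.
Proof. by move=> /funext ->. Qed.

Definition is_lam s t (F : M s -> M t) (f : M (Arr s t)) := forall x, ap f x = F x.

Lemma mlam_sig : {L : forall s t, (M s -> M t) -> M (Arr s t) |
  forall s t (F : M s -> M t) f, is_lam F f -> L s t F = f}.
Proof.
exists (fun s t F => match pselect (exists f, is_lam F f) with
  | left E => sval (cid E)
  | right _ => eval (@enil M) (zero_tm [] (Arr s t))
  end) => s t F f H; case: pselect => [E|]; last by case; exists f.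
by apply: am_ext => x; case: cid => h /= ->.
Qed.

(* The element represented by a definable function; junk otherwise.  Like other
   definitions below it is sealed, to keep conversion from unfolding it. *)
Definition mlam s t (F : M s -> M t) : M (Arr s t) := sval mlam_sig s t F.

Lemma mlamP s t (F : M s -> M t) (f : M (Arr s t)) : is_lam F f -> mlam F = f.
Proof. exact: (svalP mlam_sig). Qed.

Lemma dfn_lam G s t (F : M s -> penv G -> M t) :
  dfn (fun g : penv (s :: G) => F g.1 g.2) -> dfn (fun g => mlam (fun x => F x g)).
Proof.
move=> [f Hf]; exists f => g; symmetry; apply: mlamP => x.
exact: (Hf (x, g)).
Qed.

Lemma mlamE s t (F : M s -> M t) (x : M s) :
  dfn (fun g : penv [s] => F g.1) -> ap (mlam F) x = F x.
Proof. by move=> [f Hf]; rewrite (@mlamP _ _ F f) => [|y]; [have := Hf (x, tt)|have := Hf (y, tt)]. Qed.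

(** Relations with a definable characteristic function, zero standing for truth. These are the
    relations that admit induction and the minimum operator. *)
Definition drel G (P : penv G -> Prop) :=
  exists2 F : penv G -> N, dfn F & forall g, P g <-> F g = zero.

Lemma drel_ext G (P Q : penv G -> Prop) : (forall g, P g <-> Q g) -> drel P -> drel Q.
Proof. by move=> E [F dF H]; exists F => // g; rewrite -E H. Qed.

Lemma one_neq0 : one <> zero.
Proof. by move=> E; have := ltn01; rewrite E; exact: ltnn'. Qed.

(* The choice axiom, applied to [x |-> (if A x then 0 else 1)]. *)
Lemma characteristic (A : fm [T1]) : qf A ->
  exists Y : M T2, forall x, ap Y x = zero <-> sat A (esc x (@enil M)).
Proof.
move=> qA.
pose B : fm [T0; T1] := f_and (Imp (shift_fm T0 A) (Eq0 (Var (vz _ _)) (Con Zero)))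
  (Imp (f_not (shift_fm T0 A)) (Eq0 (Var (vz _ _)) (Con One))).
have qB : qf B.
  by rewrite /B /= /shift_fm !ren_is_sub; do !split=> //; apply: qf_sub.
have HB x y : sat B (esc y (esc x (@enil M))) <->
    (sat A (esc x (@enil M)) -> y = zero) /\ (~ sat A (esc x (@enil M)) -> y = one).
  rewrite sat_and /= /shift_fm !ren_is_sub sat_sub.
  by rewrite (_ : (fun s x => _) = esc x (@enil M)) //; apply: env_eq.
have := am_ax (@enil M) (aca_rca (@rca_QFAC10 [] B qB)).
rewrite sat_imp sat_all sat_ex => -[x|Y].
  rewrite sat_ex; exists (if pselect (sat A (esc x (@enil M))) then zero else one).
  rewrite sat_inst2 /= (_ : (fun s x => _) = (@enil M)); last exact: env_nil.
  by apply/HB; case: pselect.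
rewrite sat_all => HY; exists Y => x; have := HY x.
rewrite sat_inst2 /= (_ : (fun s x => _) = (@enil M)); last exact: env_nil.
move=> /HB [H1 H2]; split=> [E|/H1 //].
by apply: contrapT => /H2; rewrite /= in E; rewrite E => e; apply: one_neq0.
Qed.

(** The sequence [a], [b], [b], ...: two numbers are packed into one argument of type 1, the type of
    the variable in the choice axiom. *)
Definition pair1 (a b : N) : M T1 :=
  ap (ap (co Rec) (ap (co (Pi (Arr T0 T0) T0)) (ap (co (Pi T0 T0)) b))) a.

Lemma pair1_0 a b : ap (pair1 a b) zero = a. Proof. exact: rec0. Qed.
Lemma pair1_1 a b : ap (pair1 a b) one = b.
Proof.
have -> : one = add zero one by rewrite addC addn0.
by have := recS (ap (co (Pi (Arr T0 T0) T0)) (ap (co (Pi T0 T0)) b)) a zero; rewrite !apK.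
Qed.

Lemma drel2 G (A : fm [T1]) (Q : N -> N -> Prop) (F H : penv G -> N) : qf A ->
  (forall x, sat A (esc x (@enil M)) <-> Q (ap x zero) (ap x one)) ->
  dfn F -> dfn H -> drel (fun g => Q (F g) (H g)).
Proof.
move=> /characteristic [Y HY] HA dF dH.
exists (fun g => ap Y (pair1 (F g) (H g))).
  by do ![apply: dfn_app|exact: dfn_const].
by move=> g; rewrite HY HA pair1_0 pair1_1.
Qed.

Definition pv : tm [T1] T1 := Var (vz _ _).
Definition p0 : tm [T1] T0 := App pv (Con Zero).
Definition p1 : tm [T1] T0 := App pv (Con One).

Lemma drel_lt G (F H : penv G -> N) : dfn F -> dfn H -> drel (fun g => lt0 (F g) (H g)).
Proof. exact: (@drel2 _ (Lt0 p0 p1)). Qed.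

Lemma drel_eq G (F H : penv G -> N) : dfn F -> dfn H -> drel (fun g => F g = H g).
Proof. exact: (@drel2 _ (Eq0 p0 p1)). Qed.

Lemma drel_imp G (P Q : penv G -> Prop) : drel P -> drel Q -> drel (fun g => P g -> Q g).
Proof.
move=> [F dF HP] [H dH HQ].
have := @drel2 G (Imp (Eq0 p0 (Con Zero)) (Eq0 p1 (Con Zero))) (fun a b => a = zero -> b = zero) F H.
by move=> /(_ _ _ dF dH) [] // K dK HK; exists K => // g; rewrite HP HQ HK.
Qed.

Lemma drel_false G : drel (fun _ : penv G => False).
Proof. by exists (fun _ => one); [exact: dfn_const|move=> g; split=> // /one_neq0]. Qed.

Lemma drel_not G (P : penv G -> Prop) : drel P -> drel (fun g => ~ P g).
Proof. by move=> dP; apply: drel_imp => //; exact: drel_false. Qed.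

Lemma drel_or G (P Q : penv G -> Prop) : drel P -> drel Q -> drel (fun g => P g \/ Q g).
Proof.
move=> dP dQ; apply: drel_ext (drel_imp (drel_not dP) dQ) => g; split=> [H|[]//].
by have [|/H] := EM (P g); [left|right].
Qed.

Lemma drel_and G (P Q : penv G -> Prop) : drel P -> drel Q -> drel (fun g => P g /\ Q g).
Proof.
move=> dP dQ; apply: drel_ext (drel_not (drel_or (drel_not dP) (drel_not dQ))) => g.
by rewrite not_orE !notK.
Qed.

Lemma mu_exists : exists mu : M T2, forall f : M T1,
  ((exists n, ap f n = zero) ->
     ap f (ap mu f) = zero /\ forall i, lt0 i (ap mu f) -> ap f i <> zero) /\
  (~ (exists n, ap f n = zero) -> ap mu f = zero).
Proof.
have := am_ax (@enil M) (aca_mu []); rewrite sat_ex => -[mu]; rewrite sat_all => H; exists mu => f.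
by have {H} := H f; sat_simp.
Qed.

Definition least (P : N -> Prop) n := P n /\ forall i, lt0 i n -> ~ P i.

Lemma least_uniq P n m : least P n -> least P m -> n = m.
Proof.
move=> [Pn Ln] [Pm Lm]; have [/Lm|[//|/Ln]] := ltn_total n m; by move=> [].
Qed.

Lemma minN_sig : {L : (N -> Prop) -> N | (forall P n, least P n -> L P = n) /\
  (forall P, ~ (exists n, P n) -> L P = zero)}.
Proof.
exists (fun P => match pselect (exists n, least P n) with
  | left E => sval (cid E) | right _ => zero end); split=> [P n H|P H].
  case: pselect => [E|[]]; last by exists n.
  by case: cid => m /= Hm; apply: least_uniq Hm H.
by case: pselect => // ex; case: H; case: ex => n [Pn _]; exists n.
Qed.

(* the least element of [P], and 0 if [P] is empty *)
Definition minN (P : N -> Prop) : N := sval minN_sig P.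

Lemma minN_least P n : least P n -> minN P = n.
Proof. exact: (svalP minN_sig).1. Qed.

Lemma minN_empty P : ~ (exists n, P n) -> minN P = zero.
Proof. exact: (svalP minN_sig).2. Qed.

(** A characteristic function has a zero if and only if it vanishes at the number that [mu]
    returns. *)
Lemma drel_ex G (P : N -> penv G -> Prop) :
  drel (fun g : penv (T0 :: G) => P g.1 g.2) -> drel (fun g => exists n, P n g).
Proof.
move=> [F [f Hf] HP]; have [mu Hmu] := mu_exists.
have df : dfn (@apps G T1 f) by exists f.
exists (fun g => ap (@apps G T1 f g) (ap mu (@apps G T1 f g))).
  by do ![apply: dfn_app|exact: dfn_const|exact: df].
move=> g; split=> [[n Pn]|E]; last by exists (ap mu (@apps G T1 f g)); apply/(HP (_, g)); rewrite -Hf.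
by apply: ((Hmu _).1 _).1; exists n; have /(HP (_, g)) := Pn; rewrite -Hf.
Qed.

(** [minN] agrees with [mu], also in the default value zero. *)
Lemma dfn_min G (P : N -> penv G -> Prop) :
  drel (fun g : penv (T0 :: G) => P g.1 g.2) -> dfn (fun g => minN (fun n => P n g)).
Proof.
move=> [F [f Hf] HP]; have [mu Hmu] := mu_exists.
have df : dfn (@apps G T1 f) by exists f.
apply: dfn_ext (dfn_app (dfn_const G mu) df) => g.
have E n : P n g <-> ap (@apps G T1 f g) n = zero by rewrite (HP (n, g)) -Hf.
symmetry; have [H1 H2] := Hmu (@apps G T1 f g).
have [/H1 [Hz Hl]|nex] := EM (exists n, ap (@apps G T1 f g) n = zero).
  apply: minN_least; split=> [|i li]; first exact/E.
  by move=> /E; exact: Hl.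
rewrite H2 // minN_empty // => -[n Pn].
by apply: nex; exists n; apply/E.
Qed.

Lemma drel_all G (P : N -> penv G -> Prop) :
  drel (fun g : penv (T0 :: G) => P g.1 g.2) -> drel (fun g => forall n, P n g).
Proof.
move=> /drel_not/(@drel_ex _ (fun n g => ~ P n g))/drel_not.
by apply: drel_ext => g; split=> [H n|H [n]//]; apply: contrapT => nP; apply: H; exists n.
Qed.

Lemma minNP (P : N -> Prop) : drel (fun g : penv [T0] => P g.1) -> (exists n, P n) -> least P (minN P).
Proof.
move=> [F [f Hf] HP] [n Pn]; have [mu Hmu] := mu_exists.
have E k : P k <-> ap (f : M T1) k = zero by rewrite (HP (k, tt)) -Hf.
have [|Hz Hl] := (Hmu f).1; first by exists n; apply/E.
suff L : least P (ap mu f) by rewrite (minN_least L).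
split=> [|i li]; first exact/E.
by move=> /E; exact: Hl.
Qed.

(** The predicate is an equation [ap f n = zero] with [f] as a parameter, so quantifier-free
    induction is enough; number quantifiers have been absorbed into [f] by means of [mu]. *)
Lemma ind (P : N -> Prop) : drel (fun g : penv [T0] => P g.1) ->
  P zero -> (forall n, P n -> P (add n one)) -> forall n, P n.
Proof.
move=> [F [f Hf] HP] P0 PS.
have E k : P k <-> ap (f : M T1) k = zero by rewrite (HP (k, tt)) -Hf.
have := am_ax (esc (f : M T1) (@enil M)) (aca_rca (@rca_ind [T1]
   (Eq0 (App (Var (vs _ (vz _ _))) (Var (vz _ _))) (Con Zero)) I)).
sat_simp => H n; apply/E; have := H _ n; sat_simp; apply; sat_simp.
split=> [|k]; first exact/E.
by sat_simp; rewrite /= => /E Pk; apply/E; exact: PS.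
Qed.
End Definability.

Ltac dfn_step := first
  [ exact: dfn_const | exact: dfn_v0 | exact: dfn_v1 | exact: dfn_v2 | exact: dfn_v3
  | exact: dfn_v4 | exact: dfn_v5
  | apply: drel_lt | apply: drel_eq | apply: drel_false
  | apply: drel_and | apply: drel_or
  | apply: drel_ex | apply: drel_all | apply: drel_not | apply: drel_imp
  | apply: dfn_min | apply: dfn_lam | apply: dfn_app ].
Ltac dfn_tac := repeat dfn_step.

(** * The rational numbers of a model *)

Section Naturals.
Variable M : amodel.
Local Notation N := (M T0).
Local Notation zero := (zero M).
Local Notation one := (one M).
Implicit Types a b c : N.

Lemma N_srt : semi_ring_theory zero one (@add M) (@mul M) eq.
Proof.
split.
- by move=> n; rewrite addC addn0.
- exact: addC.
- exact: addA.
- by move=> n; rewrite mulC muln1.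
- by move=> n; rewrite mulC muln0.
- exact: mulC.
- exact: mulA.
- by move=> n m p; rewrite mulC mulDr !(mulC p).
Qed.
Add Ring N_ring : N_srt.

Lemma ltnD2r c a b : lt0 (add a c) (add b c) <-> lt0 a b.
Proof.
split; last exact: ltnD.
have [//|[->|/(ltnD c) H K]] := ltn_total a b; first by move/ltnn'.
by case: (@ltnn' M (add b c)); apply: ltn_trans' H K.
Qed.

Lemma addIn c a b : add a c = add b c -> a = b.
Proof.
by have [/(ltnD c) H|[//|/(ltnD c) H]] := ltn_total a b => E; move: H; rewrite E => /ltnn'.
Qed.

Lemma mulIn c a b : lt0 zero c -> mul a c = mul b c -> a = b.
Proof.
move=> c0; have [/(ltnM c0) H|[//|/(ltnM c0) H]] := ltn_total a b => E;
 by move: H; rewrite E => /ltnn'.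
Qed.

Lemma ltnM2r c a b : lt0 zero c -> lt0 (mul a c) (mul b c) -> lt0 a b.
Proof.
move=> c0; have [//|[->|/(ltnM c0) H K]] := ltn_total a b; first by move/ltnn'.
by case: (@ltnn' M (mul b c)); apply: ltn_trans' H K.
Qed.

Lemma ltnS' a : lt0 a (add a one).
Proof. by rewrite -[X in lt0 X _](addn0 a) !(addC a) ltnD2r; exact: ltn01. Qed.

Lemma ltn0S a : lt0 zero (add a one).
Proof.
have [H|[<-|/nge0 //]] := ltn_total zero a; last by exact: ltnS'.
exact: ltn_trans' H (ltnS' a).
Qed.

Lemma predn_ex a : a = zero \/ exists b, a = add b one.
Proof.
apply: (@ind M (fun a => a = zero \/ exists b, a = add b one)); first by rewrite /add; dfn_tac.
  by left.
by move=> n _; right; exists n.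
Qed.

(** Discreteness of the order is not among the axioms of an ordered semi-ring; induction provides
    it. *)
Lemma ltSn_le n a : lt0 a (add n one) -> a = n \/ lt0 a n.
Proof.
move: a; apply: (@ind M (fun n => forall a, lt0 a (add n one) -> a = n \/ lt0 a n)) => {n}.
- by rewrite /add; dfn_tac.
- move=> a; have [->|[b ->]] := predn_ex a; first by left.
  by rewrite ltnD2r => /nge0.
- move=> n IH a; have [->|[b ->]] := predn_ex a; first by right; exact: ltn0S.
  by rewrite !ltnD2r => /IH [->|]; [left|right].
Qed.

Lemma subn_ex a b : lt0 a b -> exists c, b = add a (add c one).
Proof.
move: a; apply: (@ind M (fun b => forall a, lt0 a b -> exists c, b = add a (add c one))) => {b}.
- by rewrite /add; dfn_tac.
- by move=> a /nge0.
- move=> n IH a /ltSn_le [->|/IH [c ->]].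
    by exists zero; ring.
  by exists (add c one); ring.
Qed.

Definition fracT : Type := (N * N * N)%type.
(* [(p, m, d)] stands for [(p - m) / (d + 1)] *)
Definition feq (x y : fracT) : Prop :=
  let: (p, m, d) := x in let: (p', m', d') := y in
  add (mul p (add d' one)) (mul m' (add d one)) = add (mul p' (add d one)) (mul m (add d' one)).
(** The last component is [(d + 1)(d' + 1) - 1], because denominators are stored with one
    subtracted. *)
Definition fadd (x y : fracT) : fracT :=
  let: (p, m, d) := x in let: (p', m', d') := y in
  (add (mul p (add d' one)) (mul p' (add d one)),
   add (mul m (add d' one)) (mul m' (add d one)), add (mul d d') (add d d')).
Definition fmul (x y : fracT) : fracT :=
  let: (p, m, d) := x in let: (p', m', d') := y in
  (add (mul p p') (mul m m'), add (mul p m') (mul m p'), add (mul d d') (add d d')).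
Definition fopp (x : fracT) : fracT := let: (p, m, d) := x in (m, p, d).
Definition fpos (x : fracT) : Prop := let: (p, m, d) := x in lt0 m p.

Lemma feq_refl x : feq x x. Proof. by case: x => -[p m] d; rewrite /feq. Qed.
Lemma feq_sym x y : feq x y -> feq y x.
Proof. by case: x => -[p m] d; case: y => -[p' m'] d'; rewrite /feq => ->. Qed.
(** In a semi-ring the two equations cannot be subtracted. They are scaled and added, and then the
    common summand and the factor [d' + 1] are cancelled. *)
Lemma feq_trans x y z : feq x y -> feq y z -> feq x z.
Proof.
case: x => -[p m] d; case: y => -[p' m'] d'; case: z => -[p'' m''] d''; rewrite /feq => E F.
apply: (mulIn (ltn0S d')).
apply: (@addIn (add (mul (mul m' (add d one)) (add d'' one)) (mul (mul p' (add d'' one)) (add d one)))).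
transitivity (add (mul (add (mul p (add d' one)) (mul m' (add d one))) (add d'' one))
  (mul (add (mul p' (add d'' one)) (mul m'' (add d' one))) (add d one))); first by ring.
by rewrite E F; ring.
Qed.

Lemma fadd_congr x x' y : feq x x' -> feq (fadd x y) (fadd x' y).
Proof.
case: x => -[p m] d; case: x' => -[p' m'] d'; case: y => -[q n] e; rewrite /feq /fadd => E.
transitivity (add (mul (add (mul p (add d' one)) (mul m' (add d one))) (mul (add e one) (add e one)))
  (mul (mul (add q n) (add e one)) (mul (add d one) (add d' one)))); first by ring.
by rewrite E; ring.
Qed.

Lemma fmul_congr x x' y : feq x x' -> feq (fmul x y) (fmul x' y).
Proof.
case: x => -[p m] d; case: x' => -[p' m'] d'; case: y => -[q n] e; rewrite /feq /fmul => E.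
transitivity (add (mul (add (mul p (add d' one)) (mul m' (add d one))) (mul q (add e one)))
  (mul (add (mul p' (add d one)) (mul m (add d' one))) (mul n (add e one)))); first by ring.
rewrite -E; transitivity (add (mul (add (mul p (add d' one)) (mul m' (add d one))) (mul n (add e one)))
  (mul (add (mul p (add d' one)) (mul m' (add d one))) (mul q (add e one)))); first by ring.
by rewrite {2}E; ring.
Qed.

Lemma fopp_congr x x' : feq x x' -> feq (fopp x) (fopp x').
Proof.
case: x => -[p m] d; case: x' => -[p' m'] d'; rewrite /feq /= => E.
by rewrite addC -E addC.
Qed.

Lemma fpos_congr x x' : feq x x' -> fpos x -> fpos x'.
Proof.
case: x => -[p m] d; case: x' => -[p' m'] d'; rewrite /feq /= => E H.
apply: (ltnM2r (ltn0S d)); apply/(@ltnD2r (mul p (add d' one))).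
rewrite addC E (addC (mul p' _)); rewrite [X in lt0 _ X]addC; apply/ltnD.
exact: ltnM (ltn0S d') H.
Qed.

Lemma fadd_congr2 x x' y y' : feq x x' -> feq y y' -> feq (fadd x y) (fadd x' y').
Proof.
have C u v : fadd u v = fadd v u.
  case: u => -[p m] d; case: v => -[p' m'] d'; rewrite /fadd; congr (_, _, _); ring.
move=> E F; apply: feq_trans (fadd_congr y E) _.
by rewrite !(C x'); apply: fadd_congr.
Qed.

Lemma fmulC u v : fmul u v = fmul v u.
Proof.
by case: u => -[p m] d; case: v => -[p' m'] d'; rewrite /fmul; congr (_, _, _); ring.
Qed.

Lemma fmul_congr2 x x' y y' : feq x x' -> feq y y' -> feq (fmul x y) (fmul x' y').
Proof.
move=> E F; apply: feq_trans (fmul_congr y E) _.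
by rewrite !(fmulC x'); apply: fmul_congr.
Qed.

Definition Kf : Type := quot feq.
Definition kpi (x : fracT) : Kf := qpi feq x.

Lemma kpi_eq x y : kpi x = kpi y <-> feq x y.
Proof. by apply: qpi_eq; [exact: feq_refl|exact: feq_sym|exact: feq_trans]. Qed.

Lemma kpi_repr (x : Kf) : kpi (qrepr x) = x. Proof. exact: qreprK. Qed.

Lemma repr_kpi x : feq (qrepr (kpi x)) x.
Proof. by apply/kpi_eq; rewrite kpi_repr. Qed.

Definition kadd (x y : Kf) := kpi (fadd (qrepr x) (qrepr y)).
Definition kmul (x y : Kf) := kpi (fmul (qrepr x) (qrepr y)).
Definition kopp (x : Kf) := kpi (fopp (qrepr x)).
Definition kzero := kpi (zero, zero, zero).
Definition kone := kpi (one, zero, zero).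
Definition kpos (x : Kf) := fpos (qrepr x).

Lemma kaddE x y : kadd (kpi x) (kpi y) = kpi (fadd x y).
Proof. by apply/kpi_eq; apply: fadd_congr2; exact: repr_kpi. Qed.
Lemma kmulE x y : kmul (kpi x) (kpi y) = kpi (fmul x y).
Proof. by apply/kpi_eq; apply: fmul_congr2; exact: repr_kpi. Qed.
Lemma koppE x : kopp (kpi x) = kpi (fopp x).
Proof. by apply/kpi_eq; apply: fopp_congr; exact: repr_kpi. Qed.
Lemma kposE x : kpos (kpi x) <-> fpos x.
Proof. by split; apply: fpos_congr; [|apply: feq_sym]; exact: repr_kpi. Qed.

Lemma Kf_ind (P : Kf -> Prop) : (forall p m d, P (kpi (p, m, d))) -> forall x, P x.
Proof. by move=> H x; rewrite -(kpi_repr x); case: (qrepr x) => -[p m] d. Qed.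

Definition kE := (kaddE, kmulE, koppE).

Lemma kaddA : associative kadd.
Proof.
elim/Kf_ind => p m d; elim/Kf_ind => p' m' d'; elim/Kf_ind => q n e.
by rewrite !kE; apply/kpi_eq; rewrite /feq /fadd; ring.
Qed.
Lemma kaddC : commutative kadd.
Proof.
elim/Kf_ind => p m d; elim/Kf_ind => p' m' d'.
by rewrite !kE; apply/kpi_eq; rewrite /feq /fadd; ring.
Qed.
Lemma kadd0 : left_id kzero kadd.
Proof.
by elim/Kf_ind => p m d; rewrite !kE; apply/kpi_eq; rewrite /feq /fadd; ring.
Qed.
Lemma kaddN : left_inverse kzero kopp kadd.
Proof.
by elim/Kf_ind => p m d; rewrite !kE; apply/kpi_eq; rewrite /feq /fadd /fopp; ring.
Qed.
Lemma kmulA : associative kmul.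
Proof.
elim/Kf_ind => p m d; elim/Kf_ind => p' m' d'; elim/Kf_ind => q n e.
by rewrite !kE; apply/kpi_eq; rewrite /feq /fmul; ring.
Qed.
Lemma kmulC : commutative kmul.
Proof. by elim/Kf_ind => p m d; elim/Kf_ind => p' m' d'; rewrite !kE fmulC. Qed.
Lemma kmul1 : left_id kone kmul.
Proof.
by elim/Kf_ind => p m d; rewrite !kE; apply/kpi_eq; rewrite /feq /fmul; ring.
Qed.
Lemma kmulDl : left_distributive kmul kadd.
Proof.
elim/Kf_ind => p m d; elim/Kf_ind => p' m' d'; elim/Kf_ind => q n e.
by rewrite !kE; apply/kpi_eq; rewrite /feq /fmul /fadd; ring.
Qed.
Lemma kone_neq0 : kone <> kzero.
Proof.
move=> /kpi_eq; rewrite /feq.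
have -> : add (mul one (add zero one)) (mul zero (add zero one)) = one by ring.
have -> : add (mul zero (add zero one)) (mul zero (add zero one)) = zero by ring.
exact: one_neq0.
Qed.

Lemma kinv_ex (x : Kf) : x <> kzero -> exists y, kmul y x = kone.
Proof.
elim/Kf_ind: x => p m d H.
have [lt|[E|lt]] := ltn_total p m.
(* The fraction equals [-(c + 1)/(d + 1)]; its inverse has numerator [-(d + 1)] and stored
   denominator [c]. *)
- have [c E] := subn_ex lt; exists (kpi (zero, add d one, c)).
  by rewrite kE; apply/kpi_eq; rewrite /feq /fmul E; ring.
- by case: H; apply/kpi_eq; rewrite /feq E; ring.
- have [c E] := subn_ex lt; exists (kpi (add d one, zero, c)).
  by rewrite kE; apply/kpi_eq; rewrite /feq /fmul E; ring.
Qed.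

Lemma kpos_add x y : kpos x -> kpos y -> kpos (kadd x y).
Proof.
elim/Kf_ind: x => p m d; elim/Kf_ind: y => q n e; rewrite kE !kposE /fadd /fpos => H K.
apply: ltn_trans' (ltnD _ (ltnM (ltn0S e) H)) _.
by rewrite !(addC (mul p _)); apply/ltnD/ltnM => //; exact: ltn0S.
Qed.

Lemma kpos_mul x y : kpos x -> kpos y -> kpos (kmul x y).
Proof.
elim/Kf_ind: x => p m d; elim/Kf_ind: y => q n e; rewrite kE !kposE /fmul /fpos.
move=> /subn_ex [a ->] /subn_ex [b ->].
set X := add (mul m (add n (add b one))) (mul (add m (add a one)) n).
have -> : add (mul (add m (add a one)) (add n (add b one))) (mul m n) =
  add X (mul (add a one) (add b one)) by rewrite /X; ring.
rewrite addC -/X -[X in lt0 X _]addn0 !(addC X) ltnD2r.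
have := ltnM (ltn0S b) (ltn0S a).
by rewrite (_ : mul zero _ = zero) //; ring.
Qed.

Lemma kpos_opp x : kpos x -> ~ kpos (kopp x).
Proof.
elim/Kf_ind: x => p m d; rewrite kE !kposE /= => H K.
exact: ltnn' (ltn_trans' H K).
Qed.

Lemma kpos_total x : x <> kzero -> kpos x \/ kpos (kopp x).
Proof.
elim/Kf_ind: x => p m d H; rewrite kE !kposE /=.
have [|[E|]] := ltn_total m p; [by left| |by right].
by case: H; apply/kpi_eq; rewrite /feq E; ring.
Qed.

Definition iK (a : N) : Kf := kpi (a, zero, zero).

Lemma iK_add a b : iK (add a b) = kadd (iK a) (iK b).
Proof. by rewrite /iK kaddE; apply/kpi_eq; rewrite /feq /fadd; ring. Qed.
Lemma iK_mul a b : iK (mul a b) = kmul (iK a) (iK b).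
Proof. by rewrite /iK kmulE; apply/kpi_eq; rewrite /feq /fmul; ring. Qed.
Lemma iK_frac p m d : kmul (kpi (p, m, d)) (iK (add d one)) = kadd (iK p) (kopp (iK m)).
Proof.
by rewrite /iK kmulE koppE kaddE; apply/kpi_eq; rewrite /feq /fmul /fadd /fopp; ring.
Qed.
Lemma iK_lt a b : kpos (kadd (iK b) (kopp (iK a))) <-> lt0 a b.
Proof.
rewrite /iK koppE kaddE kposE /fopp /fadd /fpos.
have -> : add (mul zero (add zero one)) (mul a (add zero one)) = a by ring.
by have -> : add (mul b (add zero one)) (mul zero (add zero one)) = b by ring.
Qed.
End Naturals.

(** * The ordered field of fractions *)

HB.instance Definition _ (M : amodel) := gen_eqMixin (Kf M).
HB.instance Definition _ (M : amodel) := gen_choiceMixin (Kf M).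
HB.instance Definition _ (M : amodel) :=
  GRing.isZmodule.Build (Kf M) (@kaddA M) (@kaddC M) (@kadd0 M) (@kaddN M).

Lemma kone_neq0b M : kone M != kzero M.
Proof. by apply/eqP; exact: kone_neq0. Qed.

HB.instance Definition _ (M : amodel) :=
  GRing.Zmodule_isComNzRing.Build (Kf M) (@kmulA M) (@kmulC M) (@kmul1 M)
    (@kmulDl M) (@kone_neq0b M).

Definition kinv (M : amodel) (x : Kf M) : Kf M :=
  match pselect (exists y, kmul y x = kone M) with
  | left E => sval (cid E) | right _ => kzero M end.

Import Order.TTheory GRing.Theory Num.Theory.
Local Open Scope ring_scope.

Lemma kmulV (M : amodel) (x : Kf M) : x != 0 -> kinv x * x = 1.
Proof.
move=> /eqP /kinv_ex E; rewrite /kinv; case: pselect => // E'.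
by case: cid.
Qed.

Lemma kinv0 (M : amodel) : kinv (0 : Kf M) = 0.
Proof.
rewrite /kinv; case: pselect => // -[y H]; exfalso.
apply: (@kone_neq0 M); rewrite -H; exact: (mulr0 (y : Kf M)).
Qed.

HB.instance Definition _ (M : amodel) := GRing.ComNzRing_isField.Build (Kf M) (@kmulV M) (@kinv0 M).

(** * Ordered fields from a cone of positive elements *)

Section PositiveCone.
Variables (F : fieldType) (pos : F -> Prop).
Hypotheses (posD : forall x y, pos x -> pos y -> pos (x + y))
  (posM : forall x y, pos x -> pos y -> pos (x * y))
  (posN : forall x, pos x -> ~ pos (- x))
  (pos_total : forall x, x <> 0 -> pos x \/ pos (- x)).
Implicit Types x y : F.

Definition cone_lt x y : bool := `[< pos (y - x) >].
Definition cone_le x y : bool := (x == y) || cone_lt x y.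
Definition cone_norm x : F := if cone_le 0 x then x else - x.

Lemma cone_lt0 x : cone_lt 0 x = `[< pos x >]. Proof. by rewrite /cone_lt subr0. Qed.

Lemma cone_lt0_add x y : cone_lt 0 x -> cone_lt 0 y -> cone_lt 0 (x + y).
Proof. by rewrite !cone_lt0 => /asboolP H /asboolP K; apply/asboolP; exact: posD. Qed.

Lemma cone_lt0_mul x y : cone_lt 0 x -> cone_lt 0 y -> cone_lt 0 (x * y).
Proof. by rewrite !cone_lt0 => /asboolP H /asboolP K; apply/asboolP; exact: posM. Qed.

Lemma cone_lt0_ngt0 x : cone_lt 0 x -> ~~ cone_lt x 0.
Proof. by rewrite cone_lt0 => /asboolP H; apply/asboolPn; rewrite sub0r; exact: posN. Qed.

Lemma cone_sub_gt0 x y : cone_lt 0 (y - x) = cone_lt x y.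
Proof. by rewrite cone_lt0. Qed.

Lemma cone_lt0_total x : x != 0 -> cone_lt 0 x || cone_lt x 0.
Proof.
move=> /eqP /pos_total [H|H]; apply/orP; [left|right]; apply/asboolP.
  by rewrite subr0.
by rewrite sub0r.
Qed.

Lemma cone_normN x : cone_norm (- x) = cone_norm x.
Proof.
have [->|n0] := eqVneq x 0; first by rewrite oppr0.
rewrite /cone_norm /cone_le !(eq_sym 0) oppr_eq0 (negPf n0) /=.
have E : cone_lt 0 (- x) = cone_lt x 0 by rewrite cone_lt0 /cone_lt sub0r.
rewrite E opprK; case h: (cone_lt 0 x); case h': (cone_lt x 0) => //.
  by have := cone_lt0_ngt0 h; rewrite h'.
by have := cone_lt0_total n0; rewrite h h'.
Qed.

Lemma cone_ge0_norm x : cone_le 0 x -> cone_norm x = x.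
Proof. by rewrite /cone_norm => ->. Qed.
Lemma cone_le_def x y : cone_le x y = (x == y) || cone_lt x y. Proof. by []. Qed.
End PositiveCone.

HB.instance Definition _ (M : amodel) := Num.IntegralDomain_isLtReal.Build (Kf M)
  (cone_lt0_add (@kpos_add M)) (cone_lt0_mul (@kpos_mul M)) (cone_lt0_ngt0 (@kpos_opp M))
  (@cone_sub_gt0 (Kf M) (@kpos M)) (cone_lt0_total (@kpos_total M))
  (cone_normN (@kpos_opp M) (@kpos_total M)) (@cone_ge0_norm (Kf M) (@kpos M))
  (@cone_le_def (Kf M) (@kpos M)).

Section KSeal.
Variable M : amodel.
Local Notation N := (M T0).

Record fractions := Fractions {
  fK : realFieldType;
  fN : N -> fK;
  fND : forall a b, fN (add a b) = fN a + fN b;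
  fNM : forall a b, fN (mul a b) = fN a * fN b;
  fN0 : fN (zero M) = 0;
  fN1 : fN (one M) = 1;
  fN_lt : forall a b, lt0 a b <-> fN a < fN b;
  fN_frac : forall c, exists p m d, c * fN (add d (one M)) = fN p - fN m }.

(* Opaque, because conversion problems in the concrete construction can blow up. *)
Lemma fractions_exist : fractions.
Proof.
apply: (@Fractions (Kf M) (@iK M)).
- exact: iK_add.
- exact: iK_mul.
- reflexivity.
- reflexivity.
- by move=> a b; rewrite -iK_lt; split=> [H|/asboolP]; first exact/asboolP.
- by elim/Kf_ind => p m d; exists p, m, d; exact: iK_frac.
Qed.
End KSeal.

Definition Kl (M : amodel) : realFieldType := fK (fractions_exist M).

From mathcomp Require Import ring lra.

#[global] Opaque lam wk.

Ltac evl := repeat progress (rewrite ?(eval_lam, eval_wk_cons, eval_wk_refl) /=).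


(** * Codes of pairs and rationals, and their values *)

Section Rationals.
Variable M : amodel.
Local Notation N := (M T0).
Local Notation K := (Kl M).
Local Notation zero := (zero M).
Local Notation one := (one M).
Implicit Types a b c n : N.

Definition iN (a : N) : K := fN (fractions_exist M) a.

Lemma iND a b : iN (add a b) = iN a + iN b. Proof. exact: fND. Qed.
Lemma iNM a b : iN (mul a b) = iN a * iN b. Proof. exact: fNM. Qed.
Lemma iN0 : iN zero = 0. Proof. exact: fN0. Qed.
Lemma iN1 : iN one = 1. Proof. exact: fN1. Qed.
Lemma iN_lt a b : lt0 a b <-> iN a < iN b. Proof. exact: fN_lt. Qed.
Lemma iN_inj a b : iN a = iN b -> a = b.
Proof.
by move=> E; have [/iN_lt|[//|/iN_lt]] := ltn_total a b; rewrite E ltxx.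
Qed.
Lemma iN_ge0 a : 0 <= iN a.
Proof. by rewrite leNgt -iN0; apply/negP => /iN_lt/nge0. Qed.
Lemma iN_le a b : ~ lt0 b a <-> iN a <= iN b.
Proof. by rewrite iN_lt leNgt; split=> /negP. Qed.
Lemma iN_ltS a b : iN a < iN b + 1 -> iN a <= iN b.
Proof. by rewrite -iN1 -iND => /iN_lt/ltSn_le [->//|/iN_lt/ltW]. Qed.

Lemma mlamE2 s t u (F : M s -> M t -> M u) x y :
  dfn (fun g : penv M [t; s] => F g.2.1 g.1) ->
  ap (ap (mlam (fun x => mlam (F x))) x) y = F x y.
Proof.
move=> dF; rewrite mlamE; last by apply: (@dfn_lam M [s] t u (fun y g => F g.1 y)).
rewrite mlamE //; case: dF => f Hf.
by exists (ap f x) => -[z []]; exact: (Hf (z, (x, tt))).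
Qed.

(* The prefix [s] marks the interpretation in [M] of the operation or notion of
   that name in the syntax. *)
Definition spred (a : N) : N := rec (mlam (fun k => mlam (fun r : N => k))) zero a.
Lemma spred0 : spred zero = zero. Proof. exact: rec0. Qed.
Lemma spredS a : spred (add a one) = a.
Proof. by rewrite /spred recS mlamE2 //; dfn_tac. Qed.
Lemma spredK a : a <> zero -> add (spred a) one = a.
Proof. by have [->|[b ->]] := predn_ex a => // _; rewrite spredS. Qed.

Definition smonus a b : N := rec (mlam (fun k : N => mlam spred)) a b.
Lemma smonusn0 a : smonus a zero = a. Proof. exact: rec0. Qed.
Lemma smonusS a b : smonus a (add b one) = spred (smonus a b).
Proof. by rewrite /smonus recS mlamE2 // /spred /rec; dfn_tac. Qed.

(** The induction runs on a statement about the numbers of the model; the formula in [K] is derived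
    from it afterwards. *)
Lemma smonusP a b : iN (smonus a b) = if iN b <= iN a then iN a - iN b else 0.
Proof.
have : (~ lt0 a b -> add b (smonus a b) = a) /\ (lt0 a b -> smonus a b = zero).
  apply: (@ind M (fun b => (~ lt0 a b -> add b (smonus a b) = a) /\
    (lt0 a b -> smonus a b = zero))).
  - by rewrite /smonus /rec /add; dfn_tac.
  - by rewrite smonusn0 addC addn0; split=> // /nge0.
  - move=> k [IH1 IH2]; rewrite smonusS; split.
      rewrite iN_le iND iN1 => le.
      have lt : iN k < iN a by lra.
      have {}IH1 : add k (smonus a k) = a by apply: IH1; rewrite iN_le; lra.
      rewrite -addA (addC one) spredK // => E.
      by move: IH1; rewrite E addn0 => e; move: lt; rewrite e ltxx.
    rewrite iN_lt iND iN1 => /iN_ltS le.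
    move: le; rewrite le_eqVlt => /orP [/eqP/iN_inj E|lt]; last by rewrite IH2 ?spred0 // iN_lt.
    have /IH1 : ~ lt0 a k by rewrite iN_le E.
    move=> e; rewrite (_ : smonus a k = zero) ?spred0 //; apply: (@addIn M k).
    by rewrite addC e (addC zero) addn0.
move=> [H1 H2]; case: ifP => le.
  have /H1 /(congr1 iN) : ~ lt0 a b by apply/iN_le.
  by rewrite iND; lra.
by rewrite H2 ?iN0 // iN_lt ltNge le.
Qed.

Definition sisqrt a : N :=
  rec (mlam (fun k => mlam (fun r =>
    add r (smonus one (smonus (mul (add r one) (add r one)) (add k one)))))) zero a.

Lemma sisqrt0 : sisqrt zero = zero. Proof. exact: rec0. Qed.
Lemma sisqrtS a : sisqrt (add a one) = add (sisqrt a)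
  (smonus one (smonus (mul (add (sisqrt a) one) (add (sisqrt a) one)) (add a one))).
Proof. by rewrite /sisqrt recS mlamE2 // /smonus /add /mul /rec; dfn_tac. Qed.

Lemma sisqrtP a : iN (sisqrt a) ^+ 2 <= iN a /\ iN a < (iN (sisqrt a) + 1) ^+ 2.
Proof.
have : ~ lt0 a (mul (sisqrt a) (sisqrt a)) /\
       lt0 a (mul (add (sisqrt a) one) (add (sisqrt a) one)).
  apply: (@ind M (fun a => ~ lt0 a (mul (sisqrt a) (sisqrt a)) /\
       lt0 a (mul (add (sisqrt a) one) (add (sisqrt a) one)))).
  - by rewrite /sisqrt /rec /add /mul; dfn_tac.
  - by rewrite sisqrt0 iN_le iN_lt !iNM iND iN0 iN1; split; lra.
  - move=> k; rewrite sisqrtS iN_le !iN_lt !iNM !iND !smonusP !iNM !iND iN1.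
    set r := iN _; have r0 : 0 <= r by exact: iN_ge0.
    have E1 : (r + 1) * (r + 1) = iN (mul (add (sisqrt k) one) (add (sisqrt k) one)).
      by rewrite iNM iND iN1.
    have E2 : iN k + 1 = iN (add k one) by rewrite iND iN1.
    move=> [H1 H2]; have le : iN k + 1 <= (r + 1) * (r + 1).
      by rewrite leNgt; apply/negP; rewrite E1 => /iN_ltS; rewrite -E1; lra.
    (* Either [k + 1] is the next square and the root grows, or by discreteness [(r + 1)^2] is at
       least [k + 2] and the root stays. *)
    rewrite le; have [E|ne] := eqVneq ((r + 1) * (r + 1)) (iN k + 1).
      by rewrite E subrr ler01 subr0; split; nra.
    have le2 : iN k + 1 + 1 <= (r + 1) * (r + 1).
      rewrite leNgt; apply/negP; rewrite E1 E2 => /iN_ltS; rewrite -E1 -E2 => le3.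
      by move/eqP: ne; apply; apply/le_anti; rewrite le le3.
    case: (leP ((r + 1) * (r + 1) - (iN k + 1)) 1) => le3; split; nra.
by rewrite iN_le iN_lt !iNM iND iN1 !expr2.
Qed.

Lemma scpair_sig : {f : N -> N -> N | forall a b, f a b =
  add (mul (add a b) (add a b)) a}.
Proof. by exists (fun a b => add (mul (add a b) (add a b)) a). Qed.
Definition scpair a b : N := sval scpair_sig a b.
Lemma scpairE a b : scpair a b =
  add (mul (add a b) (add a b)) a.
Proof. exact: (svalP scpair_sig). Qed.
Definition scfst c : N := smonus c (mul (sisqrt c) (sisqrt c)).
Definition scsnd c : N := smonus (sisqrt c) (scfst c).

(** [(a + b)^2 + a] lies between the squares of [a + b] and [a + b + 1]. *)
Lemma sisqrt_pair a b : sisqrt (scpair a b) = add a b.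
Proof.
have [H1 H2] := sisqrtP (scpair a b); apply: iN_inj.
move: H1 H2; rewrite scpairE !iND !iNM !iND; set s := iN (sisqrt _).
have s0 : 0 <= s by exact: iN_ge0.
have a0 := iN_ge0 a; have b0 := iN_ge0 b => H1 H2.
have L1 : s < iN a + iN b + 1 by nra.
have L2 : iN a + iN b < s + 1 by nra.
apply: le_anti; rewrite -iND; apply/andP; split; apply: iN_ltS; rewrite iND //.
Qed.

Lemma scfst_pair a b : scfst (scpair a b) = a.
Proof.
apply: iN_inj; rewrite /scfst sisqrt_pair smonusP scpairE !iNM !iND !iNM !iND.
by have a0 := iN_ge0 a; case: ifP => [_|/negP []]; lra.
Qed.

Lemma scsnd_pair a b : scsnd (scpair a b) = b.
Proof.
apply: iN_inj; rewrite /scsnd scfst_pair sisqrt_pair smonusP !iND.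
by have b0 := iN_ge0 b; case: ifP => [_|/negP []]; lra.
Qed.

Definition spow2 n : N := rec (mlam (fun k : N => mlam (fun r => add r r))) one n.
Lemma spow2_0 : spow2 zero = one. Proof. exact: rec0. Qed.
Lemma spow2S n : spow2 (add n one) = add (spow2 n) (spow2 n).
Proof. by rewrite /spow2 recS mlamE2 // /add; dfn_tac. Qed.

Definition sqmk p m d : N := scpair (scpair p m) d.
Definition spos q : N := scfst (scfst q).
Definition sneg q : N := scsnd (scfst q).
Definition sden q : N := add (scsnd q) one.
Lemma sqadd_sig : {f : N -> N -> N | forall q r, f q r =
  sqmk (add (mul (spos q) (sden r)) (mul (spos r) (sden q)))
       (add (mul (sneg q) (sden r)) (mul (sneg r) (sden q)))
       (spred (mul (sden q) (sden r)))}.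
Proof. by exists (fun q r => sqmk (add (mul (spos q) (sden r)) (mul (spos r) (sden q)))
       (add (mul (sneg q) (sden r)) (mul (sneg r) (sden q)))
       (spred (mul (sden q) (sden r)))). Qed.
Definition sqadd q r : N := sval sqadd_sig q r.
Lemma sqaddE q r : sqadd q r =
  sqmk (add (mul (spos q) (sden r)) (mul (spos r) (sden q)))
       (add (mul (sneg q) (sden r)) (mul (sneg r) (sden q)))
       (spred (mul (sden q) (sden r))).
Proof. exact: (svalP sqadd_sig). Qed.
Lemma sqopp_sig : {f : N -> N | forall q, f q =
  sqmk (sneg q) (spos q) (scsnd q)}.
Proof. by exists (fun q => sqmk (sneg q) (spos q) (scsnd q)). Qed.
Definition sqopp q : N := sval sqopp_sig q.
Lemma sqoppE q : sqopp q =
  sqmk (sneg q) (spos q) (scsnd q).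
Proof. exact: (svalP sqopp_sig). Qed.
Lemma sqabs_sig : {f : N -> N | forall q, f q =
  sqmk (add (smonus (spos q) (sneg q)) (smonus (sneg q) (spos q))) zero (scsnd q)}.
Proof.
by exists (fun q =>
  sqmk (add (smonus (spos q) (sneg q)) (smonus (sneg q) (spos q))) zero (scsnd q)).
Qed.
Definition sqabs q : N := sval sqabs_sig q.
Lemma sqabsE q : sqabs q =
  sqmk (add (smonus (spos q) (sneg q)) (smonus (sneg q) (spos q))) zero (scsnd q).
Proof. exact: (svalP sqabs_sig). Qed.
Lemma sqsub_sig : {f : N -> N -> N | forall q r, f q r =
  sqadd q (sqopp r)}.
Proof. by exists (fun q r => sqadd q (sqopp r)). Qed.
Definition sqsub q r : N := sval sqsub_sig q r.
Lemma sqsubE q r : sqsub q r =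
  sqadd q (sqopp r).
Proof. exact: (svalP sqsub_sig). Qed.
Definition sq0 : N := sqmk zero zero zero.
Definition sq1 : N := sqmk one zero zero.
Definition sqexp n : N := sqmk one zero (spred (spow2 n)).
Definition sqexp' n : N := sqadd (sqexp n) (sqexp n).

Lemma qval_sig : {f : N -> K | forall q, f q = (iN (spos q) - iN (sneg q)) / (iN (scsnd q) + 1)}.
Proof. by exists (fun q => (iN (spos q) - iN (sneg q)) / (iN (scsnd q) + 1)). Qed.
Definition qval (q : N) : K := sval qval_sig q.
Lemma qvalE q : qval q = (iN (spos q) - iN (sneg q)) / (iN (scsnd q) + 1).
Proof. exact: (svalP qval_sig). Qed.

Lemma iNS_gt0 a : 0 < iN a + 1. Proof. by rewrite ltr_wpDl // iN_ge0. Qed.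
Lemma iNS_neq0 a : iN a + 1 != 0. Proof. by rewrite gt_eqF // iNS_gt0. Qed.

Lemma qval_mk p m d : qval (sqmk p m d) = (iN p - iN m) / (iN d + 1).
Proof. by rewrite qvalE /spos /sneg /sqmk !(scfst_pair, scsnd_pair). Qed.

Lemma iN_sden q : iN (sden q) = iN (scsnd q) + 1. Proof. by rewrite iND iN1. Qed.
Lemma iN_predS a : 0 < iN a -> iN (spred a) + 1 = iN a.
Proof.
move=> H; rewrite -iN1 -iND spredK // => E.
by move: H; rewrite E iN0 ltxx.
Qed.

Lemma qval_add q r : qval (sqadd q r) = qval q + qval r.
Proof.
rewrite sqaddE qval_mk iN_predS; last by rewrite iNM !iN_sden mulr_gt0 // iNS_gt0.
rewrite !iND !iNM !iN_sden !qvalE; field.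
by rewrite !iNS_neq0.
Qed.

Lemma qval_opp q : qval (sqopp q) = - qval q.
Proof. by rewrite sqoppE qval_mk !qvalE -mulNr opprB. Qed.

Lemma qval_sub q r : qval (sqsub q r) = qval q - qval r.
Proof. by rewrite sqsubE qval_add qval_opp. Qed.

Lemma qval_abs q : qval (sqabs q) = `|qval q|.
Proof.
rewrite sqabsE qval_mk !qvalE normrM normfV (gtr0_norm (iNS_gt0 _)); congr (_ / _).
rewrite iND (smonusP (spos q)) (smonusP (sneg q)) iN0 subr0.
case: (ger0P (iN (spos q) - iN (sneg q))) => H0; case: (leP (iN (sneg q)) (iN (spos q))) => H1;
  case: (leP (iN (spos q)) (iN (sneg q))) => H2; lra.
Qed.

Lemma qval0 : qval sq0 = 0. Proof. by rewrite qval_mk subrr mul0r. Qed.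
Lemma qval1 : qval sq1 = 1. Proof. by rewrite qval_mk iN0 iN1 subr0 add0r divr1. Qed.

(* 2^-n for a possibly nonstandard n *)
Lemma eps_sig : {f : N -> K | forall n, f n = (iN (spow2 n))^-1}.
Proof. by exists (fun n => (iN (spow2 n))^-1). Qed.
Definition eps n : K := sval eps_sig n.
Lemma epsE n : eps n = (iN (spow2 n))^-1.
Proof. exact: (svalP eps_sig). Qed.

Lemma pow2_gt n : iN n < iN (spow2 n).
Proof.
apply/iN_lt; move: n; apply: (@ind M (fun n => lt0 n (spow2 n))).
- by rewrite /spow2 /rec; dfn_tac.
- by rewrite spow2_0; exact: ltn01.
- move=> n /iN_lt H; apply/iN_lt; rewrite spow2S !iND iN1.
  have H0 := iN_ge0 n.
  suff : 1 <= iN (spow2 n) by lra.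
  rewrite -iN1 -iN_le; move=> /iN_lt; rewrite iN1 => H1.
  have : iN (spow2 n) < iN zero + 1 by rewrite iN0 add0r.
  by move=> /iN_ltS; rewrite iN0; lra.
Qed.

Lemma pow2_gt0 n : 0 < iN (spow2 n). Proof. exact: le_lt_trans (iN_ge0 n) (pow2_gt n). Qed.
Lemma eps_gt0 n : 0 < eps n. Proof. by rewrite epsE invr_gt0 pow2_gt0. Qed.
Lemma eps0 : eps zero = 1. Proof. by rewrite !epsE spow2_0 iN1 invr1. Qed.
Lemma epsS n : eps (add n one) = eps n / 2.
Proof. by rewrite !epsE spow2S iND; have H := pow2_gt0 n; field; rewrite !gt_eqF //; lra. Qed.

Lemma qval_exp n : qval (sqexp n) = eps n.
Proof. by rewrite epsE qval_mk iN1 iN0 subr0 iN_predS ?pow2_gt0 // div1r. Qed.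
Lemma qval_exp' n : qval (sqexp' n) = eps n + eps n.
Proof. by rewrite qval_add qval_exp. Qed.

Definition sqlt q r : Prop :=
  lt0 (add (mul (spos q) (sden r)) (mul (sneg r) (sden q)))
      (add (mul (spos r) (sden q)) (mul (sneg q) (sden r))).

Lemma sqltP q r : sqlt q r <-> qval q < qval r.
Proof.
rewrite /sqlt iN_lt !iND !iNM !iN_sden !qvalE.
rewrite ltr_pdivrMr ?iNS_gt0 // mulrAC ltr_pdivlMr ?iNS_gt0 //.
by rewrite -subr_gt0 -[in X in _ <-> X]subr_gt0 (_ : _ - _ =
  (iN (spos r) - iN (sneg r)) * (iN (scsnd q) + 1) -
  (iN (spos q) - iN (sneg q)) * (iN (scsnd r) + 1)) //; ring.
Qed.

Lemma eps_le n m : iN n <= iN m -> eps m <= eps n.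
Proof.
move=> H; rewrite !epsE lef_pV2 ?posrE ?pow2_gt0 //; move: H; rewrite -!iN_le.
move: m; apply: (@ind M (fun m => ~ lt0 m n -> ~ lt0 (spow2 m) (spow2 n))).
- by rewrite /spow2 /rec; dfn_tac.
- rewrite !iN_le iN0 => H; rewrite (_ : n = zero) //; apply: iN_inj.
  by rewrite iN0; apply: le_anti; rewrite H iN_ge0.
- move=> m IH; rewrite !iN_le spow2S !iND iN1 le_eqVlt => /orP [/eqP E|/iN_ltS/iN_le/IH/iN_le H].
    by rewrite (_ : n = add m one) ?spow2S ?iND //; apply: iN_inj; rewrite iND iN1.
  by have := pow2_gt0 m; lra.
Qed.
End Rationals.

(** * Values of the defined terms *)

Lemma eval_cpred (M : amodel) G (e : env M G) (a : tm G T0) : eval e (cpred a) = spred (eval e a).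
Proof.
rewrite /cpred /cpred' /=; evl; rewrite /spred /rec; congr (ap (ap (ap _ _) _) _).
(* Extensionality identifies the element given by bracket abstraction with the one given by
   [mlam]. *)
apply: am_ext => k; apply: am_ext => r; evl.
by rewrite mlamE2 //; dfn_tac.
Qed.
#[global] Opaque cpred.

Lemma eval_monus (M : amodel) G (e : env M G) (a b : tm G T0) :
  eval e (monus a b) = smonus (eval e a) (eval e b).
Proof.
rewrite /monus /monus' /=; evl; rewrite /smonus /rec; congr (ap (ap (ap _ _) _) _).
apply: am_ext => k; apply: am_ext => r; evl.
by rewrite mlamE2 ?eval_cpred // /spred /rec; dfn_tac.
Qed.
#[global] Opaque monus.

Lemma eval_isqrt (M : amodel) G (e : env M G) (a : tm G T0) : eval e (isqrt a) = sisqrt (eval e a).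
Proof.
rewrite /isqrt /isqrt' /=; evl; rewrite /sisqrt /rec; congr (ap (ap (ap _ _) _) _).
apply: am_ext => k; apply: am_ext => r; evl.
by rewrite mlamE2 ?eval_monus //= ?eval_monus //= /smonus /add /mul /rec; evl; dfn_tac.
Qed.
#[global] Opaque isqrt.

Lemma eval_pow2 (M : amodel) G (e : env M G) (a : tm G T0) : eval e (pow2 a) = spow2 (eval e a).
Proof.
rewrite /pow2 /pow2' /=; evl; rewrite /spow2 /rec; congr (ap (ap (ap _ _) _) _).
apply: am_ext => k; apply: am_ext => r; evl.
by rewrite mlamE2 // /add; dfn_tac.
Qed.
#[global] Opaque pow2.

Lemma eval_cpair (M : amodel) G (e : env M G) (a b : tm G T0) :
  eval e (cpair a b) = scpair (eval e a) (eval e b).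
Proof. by rewrite /cpair /cpair' /=; evl; rewrite scpairE. Qed.
#[global] Opaque cpair.

Lemma eval_cfst (M : amodel) G (e : env M G) (a : tm G T0) : eval e (cfst a) = scfst (eval e a).
Proof. by rewrite /cfst /cfst' /=; evl; rewrite eval_monus /= !eval_isqrt. Qed.
#[global] Opaque cfst.

Lemma eval_csnd (M : amodel) G (e : env M G) (a : tm G T0) : eval e (csnd a) = scsnd (eval e a).
Proof. by rewrite /csnd /csnd' /=; evl; rewrite eval_monus /= eval_isqrt eval_cfst. Qed.
#[global] Opaque csnd.

Lemma eval_Qmk (M : amodel) G (e : env M G) (a b c : tm G T0) :
  eval e (Qmk a b c) = sqmk (eval e a) (eval e b) (eval e c).
Proof. by rewrite /Qmk !eval_cpair. Qed.
#[global] Opaque Qmk.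

Lemma eval_Qpos (M : amodel) G (e : env M G) (q : tm G T0) : eval e (Qpos q) = spos (eval e q).
Proof. by rewrite /Qpos !eval_cfst. Qed.
#[global] Opaque Qpos.

Lemma eval_Qneg (M : amodel) G (e : env M G) q : eval e (Qneg q) = sneg (eval e q).
Proof. by rewrite /Qneg eval_csnd eval_cfst. Qed.
#[global] Opaque Qneg.

Lemma eval_Qden (M : amodel) G (e : env M G) q : eval e (Qden q) = sden (eval e q).
Proof. by rewrite /Qden /= eval_csnd. Qed.
#[global] Opaque Qden.

Lemma eval_Qadd (M : amodel) G (e : env M G) (q r : tm G T0) :
  eval e (Qadd q r) = sqadd (eval e q) (eval e r).
Proof.
by rewrite /Qadd /Qadd' /=; evl; rewrite eval_Qmk /= !(eval_Qpos, eval_Qneg, eval_Qden, eval_cpred) /=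
  !(eval_Qpos, eval_Qneg, eval_Qden); evl; rewrite sqaddE.
Qed.
#[global] Opaque Qadd.

Lemma eval_Qopp (M : amodel) G (e : env M G) (q : tm G T0) : eval e (Qopp q) = sqopp (eval e q).
Proof. by rewrite /Qopp /Qopp' /=; evl; rewrite eval_Qmk !(eval_Qpos, eval_Qneg, eval_csnd) sqoppE. Qed.
#[global] Opaque Qopp.

Lemma eval_Qabs (M : amodel) G (e : env M G) (q : tm G T0) : eval e (Qabs q) = sqabs (eval e q).
Proof.
by rewrite /Qabs /Qabs' /=; evl; rewrite eval_Qmk /= !eval_monus !(eval_Qpos, eval_Qneg, eval_csnd) sqabsE.
Qed.
#[global] Opaque Qabs.

Lemma eval_Q0 (M : amodel) G (e : env M G) : eval e (Q0 G) = sq0 M. Proof. by rewrite /Q0 eval_Qmk. Qed.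
#[global] Opaque Q0.

Lemma eval_Q1 (M : amodel) G (e : env M G) : eval e (Q1 G) = sq1 M. Proof. by rewrite /Q1 eval_Qmk. Qed.
#[global] Opaque Q1.

Lemma eval_Qexp (M : amodel) G (e : env M G) (n : tm G T0) : eval e (Qexp n) = sqexp (eval e n).
Proof. by rewrite /Qexp eval_Qmk eval_cpred eval_pow2. Qed.
#[global] Opaque Qexp.

Lemma eval_Qsub (M : amodel) G (e : env M G) q r :
  eval e (Qsub q r) = sqsub (eval e q) (eval e r).
Proof. by rewrite /Qsub eval_Qadd eval_Qopp sqsubE. Qed.
#[global] Opaque Qsub.

Lemma eval_Qexp' (M : amodel) G (e : env M G) n : eval e (Qexp' n) = sqexp' (eval e n).
Proof. by rewrite /Qexp' eval_Qadd eval_Qexp. Qed.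
#[global] Opaque Qexp'.

Lemma sat_Qlt (M : amodel) G (e : env M G) q r :
  sat (Qlt q r) e = (qval (eval e q) < qval (eval e r)).
Proof.
apply/propext; rewrite -sqltP /Qlt /= !(eval_Qpos, eval_Qneg, eval_Qden).
by [].
Qed.
#[global] Opaque Qlt.

Lemma sat_Qle (M : amodel) G (e : env M G) q r :
  sat (Qle q r) e = (qval (eval e q) <= qval (eval e r)).
Proof. by apply/propext; rewrite /Qle sat_not sat_Qlt leNgt; split=> /negP. Qed.
#[global] Opaque Qle.

(** * The real numbers of a model *)

Section Completion.
Variable M : amodel.
Local Notation N := (M T0).
Local Notation K := (Kl M).

Definition evt (P : N -> Prop) := exists n0, forall n, iN n0 <= iN n -> P n.

Lemma evt_and P Q : evt P -> evt Q -> evt (fun n => P n /\ Q n).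
Proof.
move=> [n HP] [m HQ]; exists (add n m) => k; rewrite iND => H.
by have := iN_ge0 n; have := iN_ge0 m; split; [apply: HP|apply: HQ]; lra.
Qed.
Lemma evt_mono (P Q : N -> Prop) : (forall n, P n -> Q n) -> evt P -> evt Q.
Proof. by move=> H [n0 HP]; exists n0 => n /HP/H. Qed.
Lemma evt_all (P : N -> Prop) : (forall n, P n) -> evt P.
Proof. by move=> H; exists (zero M) => n _. Qed.
Lemma evt_ex P : evt P -> exists n, P n.
Proof. by move=> [n0 H]; exists n0; apply: H. Qed.

(** The Cauchy condition in terms of an approximating element instead of pairs of indices. The index
    runs over the numbers of the model, and the sequence itself may be any function, definable or
    not. *)
Definition cauchy (u : N -> K) := forall d, 0 < d -> exists c, evt (fun n => `|u n - c| < d).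
Definition near (u v : N -> K) := forall d, 0 < d -> evt (fun n => `|u n - v n| < d).

Lemma cauchy_cst c : cauchy (fun=> c).
Proof. by move=> d d0; exists c; apply: evt_all => n; rewrite subrr normr0. Qed.

Lemma cauchy_add u v : cauchy u -> cauchy v -> cauchy (fun n => u n + v n).
Proof.
move=> Cu Cv d d0; have d2 : 0 < d / 2 by lra.
have [c Hc] := Cu _ d2; have [e He] := Cv _ d2; exists (c + e).
apply: evt_mono (evt_and Hc He) => n []; rewrite !ltr_norml => /andP[? ?] /andP[? ?].
by apply/andP; split; lra.
Qed.

Lemma cauchy_opp u : cauchy u -> cauchy (fun n => - u n).
Proof.
move=> Cu d d0; have [c Hc] := Cu _ d0; exists (- c).
by apply: evt_mono Hc => n; rewrite -opprD normrN.
Qed.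

Lemma cauchy_bound u : cauchy u -> exists2 B, 0 < B & evt (fun n => `|u n| < B).
Proof.
move=> Cu; have [c Hc] := Cu 1 ltr01; exists (`|c| + 1); first by rewrite ltr_wpDl.
apply: evt_mono Hc => n; rewrite -{2}(subrK c (u n)) => H.
by apply: le_lt_trans (ler_normD _ _) _; rewrite addrC ltrD2l.
Qed.

Lemma cauchy_mul u v : cauchy u -> cauchy v -> cauchy (fun n => u n * v n).
Proof.
move=> Cu Cv d d0.
have [B B0 HB] := cauchy_bound Cu.
have dB : 0 < d / (2 * B) by rewrite divr_gt0 // mulr_gt0.
have [e He] := Cv _ dB.
have dE : 0 < d / (2 * (`|e| + 1)) by rewrite divr_gt0 // mulr_gt0 // ltr_wpDl.
have [c Hc] := Cu _ dE; exists (c * e).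
apply: evt_mono (evt_and HB (evt_and He Hc)) => n [b [h1 h2]].
rewrite (_ : _ - _ = u n * (v n - e) + (u n - c) * e); last by ring.
apply: le_lt_trans (ler_normD _ _) _; rewrite !normrM.
have H1 : `|u n| * `|v n - e| < d / 2.
  have -> : d / 2 = B * (d / (2 * B)) by field; rewrite gt_eqF.
  by apply: ltr_pM.
have H2 : `|u n - c| * `|e| <= d / 2.
  have -> : d / 2 = d / (2 * (`|e| + 1)) * (`|e| + 1).
    by field; rewrite gt_eqF // ltr_wpDl.
  by apply: ler_pM => //; [exact: ltW|rewrite lerDl].
lra.
Qed.

Record creal := CReal { cseq : N -> K; cseqP : cauchy cseq }.
Definition ceq (x y : creal) := near (cseq x) (cseq y).

Lemma ceq_refl x : ceq x x.
Proof. by move=> d d0; apply: evt_all => n; rewrite subrr normr0. Qed.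
Lemma ceq_sym x y : ceq x y -> ceq y x.
Proof. by move=> H d /H; apply: evt_mono => n; rewrite distrC. Qed.
Lemma ceq_trans x y z : ceq x y -> ceq y z -> ceq x z.
Proof.
move=> H1 H2 d d0; have d2 : 0 < d / 2 by lra.
apply: evt_mono (evt_and (H1 _ d2) (H2 _ d2)) => n [].
by rewrite !ltr_norml => /andP[? ?] /andP[? ?]; apply/andP; split; lra.
Qed.

Definition Rf : Type := quot ceq.
Definition rpi (x : creal) : Rf := qpi ceq x.
Lemma rpi_eq x y : rpi x = rpi y <-> ceq x y.
Proof. by apply: qpi_eq; [exact: ceq_refl|exact: ceq_sym|exact: ceq_trans]. Qed.
Lemma rpi_repr (x : Rf) : rpi (qrepr x) = x. Proof. exact: qreprK. Qed.
Lemma repr_rpi x : ceq (qrepr (rpi x)) x.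
Proof. by apply/rpi_eq; rewrite rpi_repr. Qed.
Lemma Rf_ind (P : Rf -> Prop) : (forall x, P (rpi x)) -> forall x, P x.
Proof. by move=> H x; rewrite -(rpi_repr x). Qed.

Definition cadd x y := CReal (cauchy_add (cseqP x) (cseqP y)).
Definition copp x := CReal (cauchy_opp (cseqP x)).
Definition cmul x y := CReal (cauchy_mul (cseqP x) (cseqP y)).
Definition ccst c := CReal (cauchy_cst c).

Definition radd (x y : Rf) := rpi (cadd (qrepr x) (qrepr y)).
Definition ropp (x : Rf) := rpi (copp (qrepr x)).
Definition rmul (x y : Rf) := rpi (cmul (qrepr x) (qrepr y)).
Definition rcst c := rpi (ccst c).

Lemma raddE x y : radd (rpi x) (rpi y) = rpi (cadd x y).
Proof.
apply/rpi_eq => d d0; have d2 : 0 < d / 2 by lra.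
apply: evt_mono (evt_and (repr_rpi x d2) (repr_rpi y d2)) => n [] /=.
by rewrite !ltr_norml => /andP[? ?] /andP[? ?]; apply/andP; split; lra.
Qed.

Lemma roppE x : ropp (rpi x) = rpi (copp x).
Proof.
apply/rpi_eq => d d0; apply: evt_mono (repr_rpi x d0) => n /=.
by rewrite -opprD normrN.
Qed.

Lemma rmulE x y : rmul (rpi x) (rpi y) = rpi (cmul x y).
Proof.
apply/rpi_eq => d d0.
have [B B0 HB] := cauchy_bound (cseqP y).
have [C C0 HC] := cauchy_bound (cseqP (qrepr (rpi x))).
have dB : 0 < d / (2 * B) by rewrite divr_gt0 // mulr_gt0.
have dC : 0 < d / (2 * C) by rewrite divr_gt0 // mulr_gt0.
apply: evt_mono (evt_and HB (evt_and HC (evt_and (repr_rpi x dB) (repr_rpi y dC)))).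
move=> n /= [b [c [h1 h2]]].
set u' := cseq (qrepr (rpi x)) n in c h1 *; set v' := cseq (qrepr (rpi y)) n in h2 *.
rewrite (_ : _ - _ = u' * (v' - cseq y n) + (u' - cseq x n) * cseq y n); last by ring.
apply: le_lt_trans (ler_normD _ _) _; rewrite !normrM.
have H1 : `|u'| * `|v' - cseq y n| < d / 2.
  have -> : d / 2 = C * (d / (2 * C)) by field; rewrite gt_eqF.
  by apply: ltr_pM.
have H2 : `|u' - cseq x n| * `|cseq y n| < d / 2.
  have -> : d / 2 = d / (2 * B) * B by field; rewrite gt_eqF.
  by apply: ltr_pM.
lra.
Qed.

Definition rE := (raddE, rmulE, roppE).

Lemma ceq_ext x y : (forall n, cseq x n = cseq y n) -> rpi x = rpi y.
Proof. by move=> H; apply/rpi_eq => d d0; apply: evt_all => n; rewrite H subrr normr0. Qed.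

Lemma raddA : associative radd.
Proof. by do 3!elim/Rf_ind => ?; rewrite !rE; apply: ceq_ext => n /=; rewrite addrA. Qed.
Lemma raddC : commutative radd.
Proof. by do 2!elim/Rf_ind => ?; rewrite !rE; apply: ceq_ext => n /=; rewrite addrC. Qed.
Lemma radd0 : left_id (rcst 0) radd.
Proof. by elim/Rf_ind => ?; rewrite !rE; apply: ceq_ext => n /=; rewrite add0r. Qed.
Lemma raddN : left_inverse (rcst 0) ropp radd.
Proof. by elim/Rf_ind => ?; rewrite !rE; apply: ceq_ext => n /=; rewrite addNr. Qed.
Lemma rmulA : associative rmul.
Proof. by do 3!elim/Rf_ind => ?; rewrite !rE; apply: ceq_ext => n /=; rewrite mulrA. Qed.
Lemma rmulC : commutative rmul.
Proof. by do 2!elim/Rf_ind => ?; rewrite !rE; apply: ceq_ext => n /=; rewrite mulrC. Qed.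
Lemma rmul1 : left_id (rcst 1) rmul.
Proof. by elim/Rf_ind => ?; rewrite !rE; apply: ceq_ext => n /=; rewrite mul1r. Qed.
Lemma rmulDl : left_distributive rmul radd.
Proof. by do 3!elim/Rf_ind => ?; rewrite !rE; apply: ceq_ext => n /=; rewrite mulrDl. Qed.
Lemma r1_neq0 : rcst 1 <> rcst 0.
Proof.
move/rpi_eq => /(_ 1 ltr01)/evt_ex [n] /=.
by rewrite subr0 normr1 ltxx.
Qed.

Definition cpos (x : creal) := exists2 d, 0 < d & evt (fun n => d < cseq x n).

Lemma cpos_congr x y : ceq x y -> cpos x -> cpos y.
Proof.
move=> E [d d0 H]; have d2 : 0 < d / 2 by lra.
exists (d / 2) => //; apply: evt_mono (evt_and (E _ d2) H) => n [].
by rewrite ltr_norml => /andP[? ?]; lra.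
Qed.

(** If the sequence does not tend to zero, some [d] is not an eventual bound of its absolute value.
    An element [c] approximating it within [d/4] then has absolute value at least [d/2], and its
    sign decides. *)
Lemma cpos_total x : ~ ceq x (ccst 0) -> cpos x \/ cpos (copp x).
Proof.
move=> nz.
have [d d0 Hd] : exists2 d, 0 < d & ~ evt (fun n => `|cseq x n| < d).
  apply: contrapT => H; apply: nz => d d0; apply: contrapT => He; apply: H.
  by exists d => // h; apply: He; apply: evt_mono h => n; rewrite subr0.
have d4 : 0 < d / 4 by lra.
have [c Hc] := cseqP x d4.
have [c1|c1] := lerP (d / 2) c.
  left; exists (d / 8); first by lra.
  by apply: evt_mono Hc => n; rewrite ltr_norml => /andP[? ?]; lra.
have [c2|c2] := lerP c (- (d / 2)).
  right; exists (d / 8); first by lra.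
  by apply: evt_mono Hc => n /=; rewrite ltr_norml => /andP[? ?]; lra.
case: Hd; apply: evt_mono Hc => n.
by rewrite !ltr_norml => /andP[? ?]; apply/andP; split; lra.
Qed.

Lemma cauchy_inv u d : 0 < d -> evt (fun n => d < `|u n|) -> cauchy u -> cauchy (fun n => (u n)^-1).
Proof.
move=> d0 Hd Cu e e0.
have h0 : 0 < e * d * d / 4 by rewrite divr_gt0 // !mulr_gt0.
have [c Hc] := Cu _ h0; have [n [ln hn]] := evt_ex (evt_and Hd Hc).
exists (u n)^-1; apply: evt_mono (evt_and Hd Hc) => m [lm h].
have un : u n != 0 by rewrite -normr_gt0; lra.
have um : u m != 0 by rewrite -normr_gt0; lra.
rewrite (_ : _ - _ = (u n - u m) / (u m * u n)); last by field; rewrite um un.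
rewrite normrM normfV normrM ltr_pdivrMr; last by rewrite mulr_gt0 // normr_gt0.
have H : `|u n - u m| < e * d * d / 2.
  by move: hn h; rewrite !ltr_norml => /andP[? ?] /andP[? ?]; apply/andP; split; lra.
have H2 : d * d < `|u m| * `|u n| by apply: ltr_pM => //; exact: ltW.
nra.
Qed.

Lemma rinv_ex (x : Rf) : x <> rcst 0 -> exists y, rmul y x = rcst 1.
Proof.
elim/Rf_ind: x => x nz.
have [d d0 Hd] : exists2 d, 0 < d & evt (fun n => d < `|cseq x n|).
  have nz' : ~ ceq x (ccst 0) by move=> /rpi_eq.
  have [[d d0 H]|[d d0 H]] := cpos_total nz'.
    by exists d => //; apply: evt_mono H => n h; apply: lt_le_trans h (ler_norm _).
  by exists d => //; apply: evt_mono H => n h; rewrite -normrN; apply: lt_le_trans h (ler_norm _).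
exists (rpi (CReal (cauchy_inv d0 Hd (cseqP x)))); rewrite rmulE; apply/rpi_eq => e e0.
apply: (evt_mono _ Hd) => n /= h; have nz' : cseq x n != 0 by rewrite -normr_gt0; lra.
by rewrite mulVf // subrr normr0.
Qed.

Definition rpos (x : Rf) := cpos (qrepr x).
Lemma rposE x : rpos (rpi x) <-> cpos x.
Proof. by split; apply: cpos_congr; [|apply: ceq_sym]; exact: repr_rpi. Qed.

Lemma rpos_add x y : rpos x -> rpos y -> rpos (radd x y).
Proof.
elim/Rf_ind: x => x; elim/Rf_ind: y => y; rewrite rE !rposE => -[d d0 Hd] [e e0 He].
exists d => //; apply: evt_mono (evt_and Hd He) => n [/=]; lra.
Qed.

Lemma rpos_mul x y : rpos x -> rpos y -> rpos (rmul x y).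
Proof.
elim/Rf_ind: x => x; elim/Rf_ind: y => y; rewrite rE !rposE => -[d d0 Hd] [e e0 He].
exists (d * e); first by rewrite mulr_gt0.
by apply: evt_mono (evt_and Hd He) => n [/= ? ?]; apply: ltr_pM => //; exact: ltW.
Qed.

Lemma rpos_opp x : rpos x -> ~ rpos (ropp x).
Proof.
elim/Rf_ind: x => x; rewrite rE !rposE => -[d d0 Hd] [e e0 He].
by have [n [/=]] := evt_ex (evt_and Hd He); lra.
Qed.

Lemma rpos_total x : x <> rcst 0 -> rpos x \/ rpos (ropp x).
Proof.
elim/Rf_ind: x => x H; rewrite rE !rposE; apply: cpos_total => E.
by apply: H; apply/rpi_eq.
Qed.

Lemma rcst_add c d : rcst (c + d) = radd (rcst c) (rcst d).
Proof. by rewrite rE; apply: ceq_ext. Qed.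
End Completion.

HB.instance Definition _ (M : amodel) := gen_eqMixin (Rf M).
HB.instance Definition _ (M : amodel) := gen_choiceMixin (Rf M).
HB.instance Definition _ (M : amodel) :=
  GRing.isZmodule.Build (Rf M) (@raddA M) (@raddC M) (@radd0 M) (@raddN M).

Lemma r1_neq0b (M : amodel) : rcst 1 != rcst 0 :> Rf M.
Proof. by apply/eqP; exact: r1_neq0. Qed.

HB.instance Definition _ (M : amodel) :=
  GRing.Zmodule_isComNzRing.Build (Rf M) (@rmulA M) (@rmulC M) (@rmul1 M)
    (@rmulDl M) (@r1_neq0b M).

Definition rinv (M : amodel) (x : Rf M) : Rf M :=
  match pselect (exists y, rmul y x = rcst 1) with
  | left E => sval (cid E) | right _ => 0 end.

Lemma rmulV (M : amodel) (x : Rf M) : x != 0 -> rinv x * x = 1.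
Proof.
move=> /eqP /rinv_ex E; rewrite /rinv; case: pselect => // E'.
by case: cid.
Qed.

Lemma rinv0 (M : amodel) : rinv (0 : Rf M) = 0.
Proof.
rewrite /rinv; case: pselect => // -[y H]; exfalso.
apply: (@r1_neq0 M); rewrite -H; exact: (mulr0 (y : Rf M)).
Qed.

HB.instance Definition _ (M : amodel) := GRing.ComNzRing_isField.Build (Rf M) (@rmulV M) (@rinv0 M).

HB.instance Definition _ (M : amodel) := Num.IntegralDomain_isLtReal.Build (Rf M)
  (cone_lt0_add (@rpos_add M)) (cone_lt0_mul (@rpos_mul M)) (cone_lt0_ngt0 (@rpos_opp M))
  (@cone_sub_gt0 (Rf M) (@rpos M)) (cone_lt0_total (@rpos_total M))
  (cone_normN (@rpos_opp M) (@rpos_total M)) (@cone_ge0_norm (Rf M) (@rpos M))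
  (@cone_le_def (Rf M) (@rpos M)).

Section RSeal.
Variable M : amodel.
Local Notation K := (Kl M).

Lemma rlt_pi (x y : creal M) :
  (rpi x < rpi y :> Rf M) <-> exists2 d, 0 < d & evt (fun n => d < cseq y n - cseq x n).
Proof.
rewrite -[_ < _]/(cone_lt (@rpos M) (rpi x) (rpi y)) /cone_lt -[- _]/(ropp _) -[_ + _]/(radd _ _) roppE raddE.
by split=> [/asboolP/rposE //|H]; apply/asboolP/rposE.
Qed.

Lemma rcst_lt (c d : K) : (rcst c < rcst d) = (c < d).
Proof.
apply/idP/idP=> [/rlt_pi [e e0 /evt_ex [n /=]]|cd]; first by lra.
by apply/rlt_pi; exists ((d - c) / 2); [lra|apply: evt_all => n /=; lra].
Qed.

Lemma rcst_between (a b : Rf M) : a < b -> exists c : K, a < rcst c < b.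
Proof.
elim/Rf_ind: a => x; elim/Rf_ind: b => y /rlt_pi [d d0 Hd].
have d4 : 0 < d / 4 by lra.
(* Eventually [c] is within [d/4] of the first sequence, so [c + d/2] keeps a distance of more than
   [d/8] from both. *)
have [c Hc] := cseqP x d4; exists (c + d / 2); apply/andP; split; apply/rlt_pi; exists (d / 8);
  try lra; apply: evt_mono (evt_and Hd Hc) => n [/=];
  by rewrite ltr_norml => ? /andP[? ?]; lra.
Qed.

Lemma rpi_le (u : creal M) c : evt (fun n => cseq u n < c) -> (rpi u <= rcst c :> Rf M).
Proof.
move=> Hu; rewrite leNgt; apply/negP => /rlt_pi [d d0 Hd].
by have [m [/=]] := evt_ex (evt_and Hu Hd); lra.
Qed.

Lemma rpi_ge (u : creal M) c : evt (fun n => c < cseq u n) -> (rcst c <= rpi u :> Rf M).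
Proof.
move=> Hu; rewrite leNgt; apply/negP => /rlt_pi [d d0 Hd].
by have [m [/=]] := evt_ex (evt_and Hu Hd); lra.
Qed.

(** The properties of the completion on which the rest relies: density of [K], and limits of Cauchy
    sequences of [K], described by their eventual bounds. Order completeness is not among them;
    suprema are constructed inside the model. *)
Record completion := Completion {
  cR : realFieldType;
  ckr : K -> cR;
  ckrD : forall c d, ckr (c + d) = ckr c + ckr d;
  ckr1 : ckr 1 = 1;
  ckr_lt : forall c d, (ckr c < ckr d) = (c < d);
  ckr_between : forall a b, a < b -> exists c, a < ckr c < b;
  ckr_lim : forall u : M T0 -> K, cauchy u -> {a |
    (forall c, evt (fun n => u n < c) -> a <= ckr c) /\
    (forall c, evt (fun n => c < u n) -> ckr c <= a)} }.

Lemma completion_exists : completion.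
Proof.
apply: (@Completion (Rf M) (@rcst M)).
- exact: rcst_add.
- reflexivity.
- exact: rcst_lt.
- exact: rcst_between.
- move=> u Hu; exists (rpi (CReal Hu)); split=> c.
    exact: (@rpi_le (CReal Hu)).
  exact: (@rpi_ge (CReal Hu)).
Qed.
End RSeal.

Definition Rl (M : amodel) : realFieldType := cR (completion_exists M).

(** * Definability of the arithmetic of codes *)

Section DefinableOperations.
Variable M : amodel.
Local Notation N := (M T0).

(** It suffices to treat the operation at a variable, so its body is unfolded only there and not in
    composite expressions. *)
Lemma dfn_comp1 G s t (op : M s -> M t) (F : penv M G -> M s) :
  dfn (fun g : penv M [s] => op g.1) -> dfn F -> dfn (fun g => op (F g)).
Proof.
move=> [f Hf] dF; apply: dfn_ext (dfn_app (dfn_const G (f : M (Arr s t))) dF) => g.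
exact: (Hf (F g, tt)).
Qed.

Lemma dfn_comp2 G s t u (op : M s -> M t -> M u) (F : penv M G -> M s) (H : penv M G -> M t) :
  dfn (fun g : penv M [t; s] => op g.2.1 g.1) -> dfn F -> dfn H ->
  dfn (fun g => op (F g) (H g)).
Proof.
move=> [f Hf] dF dH.
apply: dfn_ext (dfn_app (dfn_app (dfn_const G (f : M (Arr s (Arr t u)))) dF) dH) => g.
exact: (Hf (H g, (F g, tt))).
Qed.

Variable G : ctx.
Implicit Types F H : penv M G -> N.

Lemma dfn_add F H : dfn F -> dfn H -> dfn (fun g => add (F g) (H g)).
Proof. by move=> dF dH; rewrite /add; dfn_tac. Qed.
Lemma dfn_mul F H : dfn F -> dfn H -> dfn (fun g => mul (F g) (H g)).
Proof. by move=> dF dH; rewrite /mul; dfn_tac. Qed.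
Lemma dfn_rec (f : penv M G -> M (Arr T0 (Arr T0 T0))) F H :
  dfn f -> dfn F -> dfn H -> dfn (fun g => rec (f g) (F g) (H g)).
Proof. by move=> df dF dH; rewrite /rec; dfn_tac. Qed.
Lemma dfn_spred F : dfn F -> dfn (fun g => spred (F g)).
Proof. by apply: dfn_comp1; rewrite /spred /rec; dfn_tac. Qed.
Lemma dfn_smonus F H : dfn F -> dfn H -> dfn (fun g => smonus (F g) (H g)).
Proof. by apply: dfn_comp2; rewrite /smonus /rec; dfn_tac. Qed.
Lemma dfn_sisqrt F : dfn F -> dfn (fun g => sisqrt (F g)).
Proof. by apply: dfn_comp1; rewrite /sisqrt /rec; dfn_tac. Qed.
Lemma dfn_spow2 F : dfn F -> dfn (fun g => spow2 (F g)).
Proof. by apply: dfn_comp1; rewrite /spow2 /rec; dfn_tac. Qed.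
End DefinableOperations.

Ltac dfn_op1 := lazymatch goal with
  | |- dfn (fun g => add (@?A g) (@?B g)) => apply: dfn_add
  | |- dfn (fun g => mul (@?A g) (@?B g)) => apply: dfn_mul
  | |- dfn (fun g => rec (@?C g) (@?A g) (@?B g)) => apply: dfn_rec
  | |- dfn (fun g => spred (@?A g)) => apply: dfn_spred
  | |- dfn (fun g => smonus (@?A g) (@?B g)) => apply: dfn_smonus
  | |- dfn (fun g => sisqrt (@?A g)) => apply: dfn_sisqrt
  | |- dfn (fun g => spow2 (@?A g)) => apply: dfn_spow2
  end.
Ltac dfn_tac1 := repeat first [exact: dfn_const | dfn_op1 | dfn_step].

Section DefinableOperations2.
Variables (M : amodel) (G : ctx).
Implicit Types F H : penv M G -> M T0.
Lemma dfn_scpair F H : dfn F -> dfn H -> dfn (fun g => scpair (F g) (H g)).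
Proof.
by move=> dF dH; rewrite (funext (fun g => scpairE (F g) (H g))); dfn_tac1.
Qed.
Lemma dfn_scfst F : dfn F -> dfn (fun g => scfst (F g)).
Proof. by apply: dfn_comp1; rewrite /scfst; dfn_tac1. Qed.
Lemma dfn_scsnd F : dfn F -> dfn (fun g => scsnd (F g)).
Proof. by move=> dF; apply: dfn_smonus; [apply: dfn_sisqrt|apply: dfn_scfst]. Qed.
Lemma dfn_sqmk F H K : dfn F -> dfn H -> dfn K -> dfn (fun g => sqmk (F g) (H g) (K g)).
Proof. by move=> dF dH dK; do ![apply: dfn_scpair]. Qed.
Lemma dfn_spos F : dfn F -> dfn (fun g => spos (F g)).
Proof. by move=> dF; do ![apply: dfn_scfst]. Qed.
Lemma dfn_sneg F : dfn F -> dfn (fun g => sneg (F g)).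
Proof. by move=> dF; apply: dfn_scsnd; apply: dfn_scfst. Qed.
Lemma dfn_sden F : dfn F -> dfn (fun g => sden (F g)).
Proof. by move=> dF; apply: dfn_add; [apply: dfn_scsnd|exact: dfn_const]. Qed.
End DefinableOperations2.

Ltac dfn_op2 := lazymatch goal with
  | |- dfn (fun g => scpair (@?A g) (@?B g)) => apply: dfn_scpair
  | |- dfn (fun g => scfst (@?A g)) => apply: dfn_scfst
  | |- dfn (fun g => scsnd (@?A g)) => apply: dfn_scsnd
  | |- dfn (fun g => sqmk (@?A g) (@?B g) (@?C g)) => apply: dfn_sqmk
  | |- dfn (fun g => spos (@?A g)) => apply: dfn_spos
  | |- dfn (fun g => sneg (@?A g)) => apply: dfn_sneg
  | |- dfn (fun g => sden (@?A g)) => apply: dfn_sden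
  end.
Ltac dfn_tac2 := repeat first [exact: dfn_const | dfn_op1 | dfn_op2 | dfn_step].

Section DefinableOperations3.
Variables (M : amodel) (G : ctx).
Implicit Types F H : penv M G -> M T0.
Lemma dfn_sqadd F H : dfn F -> dfn H -> dfn (fun g => sqadd (F g) (H g)).
Proof.
by move=> dF dH; rewrite (funext (fun g => sqaddE (F g) (H g))); dfn_tac2.
Qed.
Lemma dfn_sqopp F : dfn F -> dfn (fun g => sqopp (F g)).
Proof.
by move=> dF; rewrite (funext (fun g => sqoppE (F g))); dfn_tac2.
Qed.
Lemma dfn_sqabs F : dfn F -> dfn (fun g => sqabs (F g)).
Proof.
by move=> dF; rewrite (funext (fun g => sqabsE (F g))); dfn_tac2.
Qed.
Lemma dfn_sqsub F H : dfn F -> dfn H -> dfn (fun g => sqsub (F g) (H g)).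
Proof.
move=> dF dH; rewrite (funext (fun g => sqsubE (F g) (H g))).
by apply: dfn_sqadd => //; apply: dfn_sqopp.
Qed.
Lemma dfn_sqexp F : dfn F -> dfn (fun g => sqexp (F g)).
Proof. by move=> dF; rewrite /sqexp; dfn_tac2. Qed.
Lemma dfn_sqexp' F : dfn F -> dfn (fun g => sqexp' (F g)).
Proof. by move=> dF; apply: dfn_sqadd; apply: dfn_sqexp. Qed.
Lemma drel_sqlt F H : dfn F -> dfn H -> drel (fun g => sqlt (F g) (H g)).
Proof. by move=> dF dH; rewrite /sqlt; apply: drel_lt; dfn_tac2. Qed.
Lemma drel_qlt F H : dfn F -> dfn H -> drel (fun g => is_true (qval (F g) < qval (H g))).
Proof. by move=> dF dH; apply: drel_ext (drel_sqlt dF dH) => g; exact: sqltP. Qed.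
Lemma drel_qle F H : dfn F -> dfn H -> drel (fun g => is_true (qval (F g) <= qval (H g))).
Proof.
move=> dF dH; apply: drel_ext (drel_not (drel_qlt dH dF)) => g.
by rewrite leNgt; split=> /negP.
Qed.
End DefinableOperations3.

Ltac dfn_op3 := lazymatch goal with
  | |- dfn (fun g => sqadd (@?A g) (@?B g)) => apply: dfn_sqadd
  | |- dfn (fun g => sqopp (@?A g)) => apply: dfn_sqopp
  | |- dfn (fun g => sqabs (@?A g)) => apply: dfn_sqabs
  | |- dfn (fun g => sqsub (@?A g) (@?B g)) => apply: dfn_sqsub
  | |- dfn (fun g => sqexp (@?A g)) => apply: dfn_sqexp
  | |- dfn (fun g => sqexp' (@?A g)) => apply: dfn_sqexp'
  | |- drel (fun g => is_true (qval (@?A g) < qval (@?B g))) => apply: drel_qlt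
  | |- drel (fun g => is_true (qval (@?A g) <= qval (@?B g))) => apply: drel_qle
  end.
Ltac dfn_tac3 := repeat first [exact: dfn_const | dfn_op1 | dfn_op2 | dfn_op3 | dfn_step].

(** * Codes of reals and their values *)

Section Reals.
Variable M : amodel.
Local Notation N := (M T0).
Local Notation K := (Kl M).
Local Notation R := (Rl M).
Local Notation zero := (zero M).
Local Notation one := (one M).
Implicit Types x y z : M T1.
Implicit Types n i k : N.

Definition kr (c : K) : R := ckr (completion_exists M) c.
Lemma krD c d : kr (c + d) = kr c + kr d. Proof. exact: ckrD. Qed.
Lemma kr0 : kr 0 = 0.
Proof. by apply: (addrI (kr 0)); rewrite -krD !addr0. Qed.
Lemma krN c : kr (- c) = - kr c.
Proof. by apply: (addrI (kr c)); rewrite -krD !subrr kr0. Qed.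
Lemma krB c d : kr (c - d) = kr c - kr d. Proof. by rewrite krD krN. Qed.
Lemma kr1 : kr 1 = 1. Proof. exact: ckr1. Qed.
Lemma kr_lt c d : (kr c < kr d) = (c < d). Proof. exact: ckr_lt. Qed.
Lemma kr_gt0 c : (0 < kr c) = (0 < c). Proof. by rewrite -kr0 kr_lt. Qed.
Lemma kr_le c d : (kr c <= kr d) = (c <= d). Proof. by rewrite !leNgt kr_lt. Qed.
Lemma kr_half c : kr (c / 2) = kr c / 2.
Proof.
have H : kr c = kr (c / 2) + kr (c / 2) by rewrite -krD; congr kr; lra.
by rewrite H; lra.
Qed.
Lemma kr_norm c : kr `|c| = `|kr c|.
Proof.
have [H|H] := ger0P c; first by rewrite ger0_norm // -kr0 kr_le.
by rewrite ltr0_norm ?krN // -kr0 kr_lt.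
Qed.

Lemma K_code (c : K) : exists q, qval q = c.
Proof.
have [p [m [d E]]] := fN_frac c; exists (sqmk p m d); rewrite qval_mk.
by apply: (mulIf (iNS_neq0 d)); rewrite mulfVK ?iNS_neq0 // -iN1 -iND.
Qed.

(** A positive fraction with denominator [d + 1] is at least [1/(d + 1)], and
    [d + 1 < 2^(d + 1)]. *)
Lemma eps_small_K (c : K) : 0 < c -> exists n, eps n < c.
Proof.
have [q <-] := K_code c; rewrite qvalE => H; exists (add (scsnd q) one).
have d0 := iNS_gt0 (scsnd q).
have H1 : 1 <= iN (spos q) - iN (sneg q).
  have : 0 < iN (spos q) - iN (sneg q) by move: H; rewrite pmulr_lgt0 // invr_gt0.
  rewrite subr_gt0 -iN_lt => /subn_ex [b ->]; rewrite !iND iN1.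
  by have := iN_ge0 b; lra.
have p2 := pow2_gt (add (scsnd q) one); rewrite iND iN1 in p2.
rewrite epsE; apply: (@lt_le_trans _ _ (iN (scsnd q) + 1)^-1); first by rewrite ltf_pV2 // posrE // pow2_gt0.
by rewrite ler_peMl // invr_ge0 ltW.
Qed.

Lemma R_between (a b : R) : a < b -> exists q, a < kr (qval q) < b.
Proof. by move=> /ckr_between [c H]; have [q E] := K_code c; exists q; rewrite E. Qed.

Lemma K_between_R (a : R) : 0 < a -> exists2 c, 0 < c & kr c < a.
Proof. by move=> /R_between [q /andP [H1 H2]]; exists (qval q); rewrite // -kr_gt0. Qed.

Lemma eps_small (a : R) : 0 < a -> exists n, kr (eps n) < a.
Proof.
move=> /K_between_R [c c0 ca]; have [n Hn] := eps_small_K c0; exists n.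
by apply: lt_trans ca; rewrite kr_lt.
Qed.

Lemma le_eps_mul (a b : R) C : 0 <= C -> (forall n, a <= b + C * kr (eps n)) -> a <= b.
Proof.
move=> C0 H; rewrite leNgt; apply/negP => ba.
have C1 : 0 < C + 1 by lra.
have : 0 < (a - b) / (C + 1) by rewrite divr_gt0 // subr_gt0.
move=> /eps_small [n]; rewrite ltr_pdivlMr // => Hn.
have e0 : 0 < kr (eps n) by rewrite kr_gt0 eps_gt0.
by have := H n; nra.
Qed.

Lemma eq_eps_mul (a b : R) C : 0 <= C -> (forall n, `|a - b| <= C * kr (eps n)) -> a = b.
Proof.
by move=> C0 H; apply: le_anti; apply/andP; split; apply: (le_eps_mul C0) => n;
  have := H n; rewrite ler_norml => /andP[? ?]; lra.
Qed.

Definition sreal x : Prop :=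
  forall n i, `|qval (ap x n) - qval (ap x (add n i))| < eps n.

Lemma sreal_le x n m : sreal x -> iN n <= iN m -> `|qval (ap x n) - qval (ap x m)| < eps n.
Proof.
move=> Hx; rewrite le_eqVlt => /orP [/eqP/iN_inj ->|/iN_lt/subn_ex [c ->]]; last exact: Hx.
by rewrite subrr normr0 eps_gt0.
Qed.

Lemma sreal_cauchy x : sreal x -> cauchy (fun n => qval (ap x n)).
Proof.
move=> Hx d d0; have [n Hn] := eps_small_K d0; exists (qval (ap x n)); exists n => m nm.
by rewrite distrC; apply: lt_trans Hn; exact: sreal_le.
Qed.

Lemma rv_sig :
  {f : M T1 -> R | forall x n, sreal x -> `|f x - kr (qval (ap x n))| <= kr (eps n)}.
Proof.
exists (fun x => match pselect (sreal x) with
  | left H => sval (ckr_lim (completion_exists M) (sreal_cauchy H))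
  | right _ => 0
  end) => x n; case: pselect => // H _; case: ckr_lim => a /= [E E'].
rewrite ler_distl -krB -krD; apply/andP; split; [apply: E'|apply: E]; exists n => m nm /=;
  have := sreal_le H nm; rewrite ltr_norml => /andP[? ?]; lra.
Qed.

(* the value of the code [x]; junk if [x] does not code a real *)
Definition rv x : R := sval rv_sig x.

Lemma rv_approx x n : sreal x -> `|rv x - kr (qval (ap x n))| <= kr (eps n).
Proof. exact: (svalP rv_sig). Qed.

Lemma rv_unique z (a : R) C : sreal z -> 0 <= C ->
  (forall n, `|a - kr (qval (ap z n))| <= C * kr (eps n)) -> rv z = a.
Proof.
move=> Hz C0 H; apply: (@eq_eps_mul _ _ (C + 1)); first by lra.
move=> n; have := H n; have := rv_approx n Hz.
rewrite !ler_norml => /andP[? ?] /andP[? ?]; apply/andP; split; lra.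
Qed.

Definition srlt x y : Prop := exists n, qval (sqadd (ap x n) (sqexp' n)) < qval (ap y n).
Definition srle x y : Prop := ~ srlt y x.
Definition sreq x y : Prop :=
  forall n, qval (sqabs (sqsub (ap x n) (ap y n))) <= qval (sqexp' n).

Lemma srltP x y : sreal x -> sreal y -> srlt x y <-> rv x < rv y.
Proof.
move=> Hx Hy; split.
  move=> [n]; rewrite qval_add qval_exp' -kr_lt !krD.
  have := rv_approx n Hx; have := rv_approx n Hy.
  by rewrite !ler_norml => /andP[? ?] /andP[? ?]; lra.
(* Both values are known up to [eps n], and [srlt] asks for a gap of [2 eps n]: four in all. *)
rewrite -subr_gt0 => H; have : 0 < (rv y - rv x) / 4 by lra.
move=> /eps_small [n Hn]; exists n; rewrite qval_add qval_exp' -kr_lt !krD.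
have := rv_approx n Hx; have := rv_approx n Hy.
by rewrite !ler_norml => /andP[? ?] /andP[? ?]; lra.
Qed.

Lemma srleP x y : sreal x -> sreal y -> srle x y <-> rv x <= rv y.
Proof. by move=> Hx Hy; rewrite /srle srltP // leNgt; split=> /negP. Qed.

Lemma sreqP x y : sreal x -> sreal y -> sreq x y <-> rv x = rv y.
Proof.
move=> Hx Hy; split=> [H|E n].
  apply: (@eq_eps_mul _ _ 4); first by lra.
  move=> n; have := H n; rewrite qval_abs qval_sub qval_exp' -kr_le kr_norm krB krD.
  have := rv_approx n Hx; have := rv_approx n Hy.
  rewrite !ler_norml => /andP[? ?] /andP[? ?] /andP[? ?]; apply/andP; split; lra.
rewrite qval_abs qval_sub qval_exp' -kr_le kr_norm krB krD.
have := rv_approx n Hx; have := rv_approx n Hy; rewrite E.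
rewrite !ler_norml => /andP[? ?] /andP[? ?]; apply/andP; split; lra.
Qed.

End Reals.

(** * Operations on codes of reals; finite sums *)

Section RealOperations.
Variable M : amodel.
Local Notation N := (M T0).
Local Notation K := (Kl M).
Local Notation R := (Rl M).
Local Notation zero := (zero M).
Local Notation one := (one M).
Implicit Types x y z : M T1.
Implicit Types n i k : N.

Definition srofq (q : N) : M T1 := mlam (fun _ : N => q).
Definition sr0 : M T1 := srofq (sq0 M).
Definition sr1 : M T1 := srofq (sq1 M).
Definition sradd x y : M T1 :=
  mlam (fun n => sqadd (ap x (add n one)) (ap y (add n one))).
Definition srsub x y : M T1 :=
  mlam (fun n => sqsub (ap x (add n one)) (ap y (add n one))).
Definition srabs x : M T1 := mlam (fun n => sqabs (ap x n)).

Lemma srofqE q n : ap (srofq q) n = q. Proof. by rewrite mlamE //; exact: dfn_const. Qed.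
Lemma sraddE x y n : ap (sradd x y) n = sqadd (ap x (add n one)) (ap y (add n one)).
Proof. by rewrite mlamE //; dfn_tac3. Qed.
Lemma srsubE x y n : ap (srsub x y) n = sqsub (ap x (add n one)) (ap y (add n one)).
Proof. by rewrite mlamE //; dfn_tac3. Qed.
Lemma srabsE x n : ap (srabs x) n = sqabs (ap x n).
Proof. by rewrite mlamE //; dfn_tac3. Qed.

Lemma sreal_rofq q : sreal (srofq q).
Proof. by move=> n i; rewrite !srofqE subrr normr0 eps_gt0. Qed.
Lemma rv_rofq q : rv (srofq q) = kr (qval q).
Proof.
apply: (@rv_unique _ _ _ 0) => // [|n]; first exact: sreal_rofq.
by rewrite srofqE subrr normr0 mul0r.
Qed.
Lemma sreal_0 : sreal sr0. Proof. exact: sreal_rofq. Qed.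
Lemma sreal_1 : sreal sr1. Proof. exact: sreal_rofq. Qed.
Lemma rv_0 : rv sr0 = 0. Proof. by rewrite rv_rofq qval0 kr0. Qed.
Lemma rv_1 : rv sr1 = 1. Proof. by rewrite rv_rofq qval1 kr1. Qed.

Lemma add1C n i : add (add n i) one = add (add n one) i.
Proof. by rewrite -!addA (addC i). Qed.

Lemma sreal_add x y : sreal x -> sreal y -> sreal (sradd x y).
Proof.
move=> Hx Hy n i; rewrite !sraddE !qval_add add1C.
have := Hx (add n one) i; have := Hy (add n one) i; rewrite epsS !ltr_norml.
by move=> /andP[? ?] /andP[? ?]; apply/andP; split; lra.
Qed.

Lemma sreal_sub x y : sreal x -> sreal y -> sreal (srsub x y).
Proof.
move=> Hx Hy n i; rewrite !srsubE !qval_sub add1C.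
have := Hx (add n one) i; have := Hy (add n one) i; rewrite epsS !ltr_norml.
by move=> /andP[? ?] /andP[? ?]; apply/andP; split; lra.
Qed.

Lemma sreal_abs x : sreal x -> sreal (srabs x).
Proof.
move=> Hx n i; rewrite !srabsE !qval_abs; apply: le_lt_trans (Hx n i).
exact: ler_dist_dist.
Qed.

Lemma rv_add x y : sreal x -> sreal y -> rv (sradd x y) = rv x + rv y.
Proof.
move=> Hx Hy; apply: (@rv_unique _ _ _ 1) => // [|n]; first exact: sreal_add.
rewrite sraddE qval_add krD mul1r.
have := rv_approx (add n one) Hx; have := rv_approx (add n one) Hy; rewrite epsS kr_half.
by rewrite !ler_norml => /andP[? ?] /andP[? ?]; apply/andP; split; lra.
Qed.

Lemma rv_sub x y : sreal x -> sreal y -> rv (srsub x y) = rv x - rv y.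
Proof.
move=> Hx Hy; apply: (@rv_unique _ _ _ 1) => // [|n]; first exact: sreal_sub.
rewrite srsubE qval_sub krB mul1r.
have := rv_approx (add n one) Hx; have := rv_approx (add n one) Hy; rewrite epsS kr_half.
by rewrite !ler_norml => /andP[? ?] /andP[? ?]; apply/andP; split; lra.
Qed.

Lemma rv_abs x : sreal x -> rv (srabs x) = `|rv x|.
Proof.
move=> Hx; apply: (@rv_unique _ _ _ 1) => // [|n]; first exact: sreal_abs.
rewrite srabsE qval_abs kr_norm mul1r.
by apply: le_trans (rv_approx n Hx); exact: ler_dist_dist.
Qed.

(** The first [j] terms, all read at the index [p]. Keeping [p] apart from [j] allows induction on
    the number of terms; [ssum] ties them together. *)
Definition ssumP (u : M (Arr T0 T1)) (p j : N) : N :=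
  rec (mlam (fun k => mlam (fun r => sqadd r (ap (ap u k) p)))) (sq0 M) j.
Definition ssum (u : M (Arr T0 T1)) (j : N) : M T1 := mlam (fun n => ssumP u (add n j) j).

Lemma dfn_ssumP G (U : penv M G -> M (Arr T0 T1)) (P J : penv M G -> N) :
  dfn U -> dfn P -> dfn J -> dfn (fun g => ssumP (U g) (P g) (J g)).
Proof.
move=> dU dP dJ.
have H : exists f : M (Arr (Arr T0 T1) (Arr T0 (Arr T0 T0))),
    forall u p j, ap (ap (ap f u) p) j = ssumP u p j.
  have : dfn (fun g : penv M [T0; T0; Arr T0 T1] => ssumP g.2.2.1 g.2.1 g.1).
    rewrite /ssumP; apply: dfn_rec; [|exact: dfn_const|exact: dfn_v0].
    by dfn_tac3.
  by move=> [f Hf]; exists f => u p j; exact: (Hf (j, (p, (u, tt)))).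
case: H => f Hf.
apply: dfn_ext (dfn_app (dfn_app (dfn_app (dfn_const G f) dU) dP) dJ) => g.
exact: Hf.
Qed.

Lemma ssumP0 u p : ssumP u p zero = sq0 M. Proof. exact: rec0. Qed.
Lemma ssumPS u p j : ssumP u p (add j one) = sqadd (ssumP u p j) (ap (ap u j) p).
Proof. by rewrite /ssumP recS mlamE2 //; dfn_tac3. Qed.
Lemma ssumE u j n : ap (ssum u j) n = ssumP u (add n j) j.
Proof.
rewrite mlamE //; apply: dfn_ssumP; [exact: dfn_const| |exact: dfn_const].
by dfn_tac3.
Qed.

Definition sreals (u : M (Arr T0 T1)) := forall k, sreal (ap u k).

Lemma ssumP_dist u p i j : sreals u ->
  `|qval (ssumP u p j) - qval (ssumP u (add p i) j)| <= iN j * eps p.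
Proof.
move=> Hu.
(* Both sides are written as values of codes, which makes the inequality a definable predicate of
   [j]. *)
have E k : iN k * eps p = qval (sqmk k zero (spred (spow2 p))).
  by rewrite qval_mk iN0 subr0 iN_predS ?pow2_gt0 // epsE.
have A (a b : N) : `|qval a - qval b| = qval (sqabs (sqsub a b)) by rewrite qval_abs qval_sub.
rewrite E A; move: j.
apply: (@ind M (fun j => qval (sqabs (sqsub (ssumP u p j) (ssumP u (add p i) j))) <=
   qval (sqmk j zero (spred (spow2 p))))).
- apply: drel_qle; last by dfn_tac3.
  by apply: dfn_sqabs; apply: dfn_sqsub; apply: dfn_ssumP; dfn_tac3.
- by rewrite -A -E !ssumP0 subrr normr0 iN0 mul0r.
- move=> j; rewrite -(A (ssumP u p j) (ssumP u (add p i) j)) -(E j).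
  rewrite -(A (ssumP u p (add j one)) (ssumP u (add p i) (add j one))) -(E (add j one)).
  rewrite !ssumPS !qval_add iND iN1.
  have := Hu j p i; rewrite ltr_norml !ler_norml => /andP[? ?] /andP[? ?].
  by apply/andP; split; lra.
Qed.

Lemma epsD n m : eps (add n m) = eps n * eps m.
Proof.
have E : spow2 (add n m) = mul (spow2 n) (spow2 m).
  move: m; apply: (@ind M (fun m => spow2 (add n m) = mul (spow2 n) (spow2 m))).
  - by apply: drel_eq; dfn_tac3.
  - by rewrite addn0 spow2_0 muln1.
  - by move=> m IH; rewrite addA !spow2S IH mulDr.
by rewrite !epsE E iNM invfM.
Qed.

Lemma iN_eps_lt1 n : iN n * eps n < 1.
Proof. by rewrite epsE ltr_pdivrMr ?pow2_gt0 // mul1r pow2_gt. Qed.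

(** Reading the terms at index [n + j] reduces the accumulated error [j 2^-(n+j)] below [2^-n], as
    [j < 2^j]. *)
Lemma sreal_sum u j : sreals u -> sreal (ssum u j).
Proof.
move=> Hu n i; rewrite !ssumE.
have -> : add (add n i) j = add (add n j) i by rewrite -!addA (addC i).
apply: le_lt_trans (ssumP_dist _ _ _ Hu) _.
rewrite epsD mulrCA -[X in _ < X]mulr1 ltr_pM2l ?eps_gt0 //.
exact: iN_eps_lt1.
Qed.

Lemma rv_sum0 u : sreals u -> rv (ssum u zero) = 0.
Proof.
move=> Hu; apply: (@rv_unique _ _ _ 0) => // [|n]; first exact: sreal_sum.
by rewrite ssumE ssumP0 qval0 kr0 subrr normr0 mul0r.
Qed.

Lemma rv_sumS u j : sreals u -> rv (ssum u (add j one)) = rv (ssum u j) + rv (ap u j).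
Proof.
move=> Hu; apply: (@rv_unique _ _ _ 1) => // [|n]; first exact: sreal_sum.
rewrite ssumE ssumPS qval_add krD mul1r.
(* The sum of [j + 1] terms at [n] reads its terms at the same index as the sum of [j] terms at
   [n + 1]. *)
have -> : add n (add j one) = add (add n one) j by rewrite -addA (addC j).
rewrite -ssumE.
have := rv_approx (add n one) (sreal_sum j Hu).
have := rv_approx (add (add n one) j) (Hu j).
have : kr (eps (add (add n one) j)) <= kr (eps (add n one)).
  by rewrite kr_le; apply: eps_le; rewrite [X in _ <= X]iND lerDl iN_ge0.
have -> : kr (eps (add n one)) = kr (eps n) / 2 by rewrite epsS kr_half.
by rewrite !ler_norml => ? /andP[? ?] /andP[? ?]; apply/andP; split; lra.
Qed.

Definition stotal (a b : M (Arr T0 T1)) (j : N) : M T1 :=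
  ssum (mlam (fun k => srsub (ap b k) (ap a k))) j.

Lemma sdiffE (a b : M (Arr T0 T1)) k :
  ap (mlam (fun k => srsub (ap b k) (ap a k))) k = srsub (ap b k) (ap a k).
Proof.
by rewrite mlamE // /srsub; dfn_tac3.
Qed.

Lemma sreals_diff a b : sreals a -> sreals b -> sreals (mlam (fun k => srsub (ap b k) (ap a k))).
Proof. by move=> Ha Hb k; rewrite sdiffE; apply: sreal_sub. Qed.
Lemma sreal_total a b j : sreals a -> sreals b -> sreal (stotal a b j).
Proof. by move=> Ha Hb; apply/sreal_sum/sreals_diff. Qed.
Lemma rv_total0 a b : sreals a -> sreals b -> rv (stotal a b zero) = 0.
Proof. by move=> Ha Hb; apply/rv_sum0/sreals_diff. Qed.
Lemma rv_totalS a b j : sreals a -> sreals b ->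
  rv (stotal a b (add j one)) = rv (stotal a b j) + (rv (ap b j) - rv (ap a j)).
Proof.
by move=> Ha Hb; rewrite rv_sumS ?sdiffE ?rv_sub //; exact: sreals_diff.
Qed.
End RealOperations.

(** * Semantics of the formulas *)

#[global] Opaque f_and f_or f_not f_ex f_all inst1 inst2.

Ltac imp_simp := repeat match goal with
  | |- context [sat (Imp ?A ?B) ?e] => rewrite (sat_imp A B e)
  end.
Ltac and_simp := repeat match goal with
  | |- context [sat (f_and ?A ?B) ?e] => rewrite (sat_and A B e)
  end.

Lemma eval_RofQ (M : amodel) G (e : env M G) q : eval e (RofQ q) = srofq (eval e q).
Proof. by apply: am_ext => n; rewrite /RofQ; evl; rewrite srofqE. Qed.
#[global] Opaque RofQ.

Lemma eval_R0 (M : amodel) G (e : env M G) : eval e (R0 G) = sr0 M.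
Proof. by rewrite /R0 eval_RofQ eval_Q0. Qed.
#[global] Opaque R0.

Lemma eval_R1 (M : amodel) G (e : env M G) : eval e (R1 G) = sr1 M.
Proof. by rewrite /R1 eval_RofQ eval_Q1. Qed.
#[global] Opaque R1.

Lemma eval_Radd (M : amodel) G (e : env M G) x y :
  eval e (Radd x y) = sradd (eval e x) (eval e y).
Proof. by apply: am_ext => n; rewrite /Radd; evl; rewrite eval_Qadd sraddE; evl. Qed.
#[global] Opaque Radd.

Lemma eval_Rsub (M : amodel) G (e : env M G) x y :
  eval e (Rsub x y) = srsub (eval e x) (eval e y).
Proof. by apply: am_ext => n; rewrite /Rsub; evl; rewrite eval_Qsub srsubE; evl. Qed.
#[global] Opaque Rsub.

Lemma eval_Rabs (M : amodel) G (e : env M G) x : eval e (Rabs x) = srabs (eval e x).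
Proof. by apply: am_ext => n; rewrite /Rabs; evl; rewrite eval_Qabs srabsE; evl. Qed.
#[global] Opaque Rabs.

Lemma eval_Rsum (M : amodel) G (e : env M G) u j :
  eval e (Rsum u j) = ssum (eval e u) (eval e j).
Proof.
apply: am_ext => n; rewrite /Rsum; evl; rewrite eval_Q0 ssumE /ssumP /rec.
congr (ap (ap (ap _ _) _) _); apply: am_ext => k; apply: am_ext => r; evl.
rewrite eval_Qadd mlamE2; first by evl.
by dfn_tac3.
Qed.
#[global] Opaque Rsum.

Lemma eval_total (M : amodel) G (e : env M G) a b j :
  eval e (total a b j) = stotal (eval e a) (eval e b) (eval e j).
Proof.
rewrite /total eval_Rsum /stotal.
apply: (f_equal (fun u => ssum u (eval e j))); apply: am_ext => k; evl.
by rewrite eval_Rsub sdiffE; evl.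
Qed.
#[global] Opaque total.

Lemma sat_isReal (M : amodel) G (e : env M G) x : sat (isReal x) e = sreal (eval e x).
Proof.
rewrite /isReal sat_all; apply: eq_forall => n; rewrite sat_all; apply: eq_forall => i.
by rewrite sat_Qlt eval_Qabs eval_Qsub eval_Qexp; evl; rewrite qval_abs qval_sub qval_exp.
Qed.
#[global] Opaque isReal.

Lemma sat_Req (M : amodel) G (e : env M G) x y : sat (Req x y) e = sreq (eval e x) (eval e y).
Proof.
rewrite /Req sat_all; apply: eq_forall => n.
by rewrite sat_Qle eval_Qabs eval_Qsub eval_Qexp'; evl.
Qed.
#[global] Opaque Req.

Lemma sat_Rlt (M : amodel) G (e : env M G) x y : sat (Rlt x y) e = srlt (eval e x) (eval e y).
Proof.
rewrite /Rlt sat_ex; apply: eq_exists => n.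
by rewrite sat_Qlt eval_Qadd eval_Qexp'; evl.
Qed.
#[global] Opaque Rlt.

Lemma sat_Rle (M : amodel) G (e : env M G) x y : sat (Rle x y) e = srle (eval e x) (eval e y).
Proof. by rewrite /Rle sat_not sat_Rlt. Qed.
#[global] Opaque Rle.

(** * The notions of measure, read in a model *)

Section Sets.
Variable M : amodel.
Implicit Types (S : M T1 -> Prop) (x : M T1) (a b : M (Arr T0 T1)).

Definition sI01 x := sreal x /\ srle (sr0 M) x /\ srle x (sr1 M).
Definition sisFun S (f : M (Arr T1 T1)) :=
  (forall x, S x -> sreal (ap f x)) /\
  (forall x y, S x -> S y -> sreq x y -> sreq (ap f x) (ap f y)).
Definition sset_of (Y : M (Arr T1 T1)) x := sreal x /\ srlt (sr0 M) (ap Y x).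
Definition sintervals a b :=
  forall k, sreal (ap a k) /\ sreal (ap b k) /\ srle (ap a k) (ap b k).
Definition scovers a b S := sintervals a b /\
  forall x, sreal x -> S x -> exists k, srlt (ap a k) x /\ srlt x (ap b k).
Definition smeasure_le S c := forall d, sreal d -> srlt (sr0 M) d ->
  exists a b, scovers a b S /\ forall j, srle (stotal a b j) (sradd c d).
Definition smeasure_ge S c := forall a b, scovers a b S ->
  forall d, sreal d -> srlt (sr0 M) d -> exists j, srle c (sradd (stotal a b j) d).
Definition smeasure2_le S (S' : M T1 -> Prop) c := forall d, sreal d -> srlt (sr0 M) d ->
  exists a b a' b', scovers a b S /\ scovers a' b' S' /\
    forall j, srle (sradd (stotal a b j) (stotal a' b' j)) (sradd c d).
Definition smeasurable S := smeasure2_le S (fun x => sI01 x /\ ~ S x) (sr1 M).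
Definition smeasurable_fun f := sisFun sI01 f /\
  forall t, sreal t -> smeasurable (fun x => sI01 x /\ srlt t (ap f x)).
Definition salmost_all S := exists Y : M (Arr T1 T1),
  sisFun (@sreal M) Y /\ smeasure_le (sset_of Y) (sr0 M) /\
  forall x, sI01 x -> ~ sset_of Y x -> S x.
Definition sconverges_at (F : M (Arr T0 (Arr T1 T1))) (f : M (Arr T1 T1)) x :=
  forall e, sreal e -> srlt (sr0 M) e -> exists n0, forall n, ~ lt0 n n0 ->
    srlt (srabs (srsub (ap (ap F n) x) (ap f x))) e.
Definition sconverges_in_measure (F : M (Arr T0 (Arr T1 T1))) (f : M (Arr T1 T1)) :=
  forall e k, sreal e -> srlt (sr0 M) e -> exists n0, forall n, ~ lt0 n n0 ->
    smeasure_le (fun x => sI01 x /\ srle e (srabs (srsub (ap (ap F n) x) (ap f x))))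
      (srofq (sqexp k)).
Definition sWTE := forall (F : M (Arr T0 (Arr T1 T1))) (f : M (Arr T1 T1)),
  (forall n, smeasurable_fun (ap F n)) -> smeasurable_fun f ->
  salmost_all (sconverges_at F f) -> sconverges_in_measure F f.
Definition sWHBU := forall (Psi : M (Arr T1 T1)) (e : M T1),
  smeasurable_fun Psi -> (forall x, sI01 x -> srlt (sr0 M) (ap Psi x)) ->
  sreal e -> srlt (sr0 M) e ->
  exists (n : M T0) (y : M (Arr T0 T1)), (forall i, ~ lt0 n i -> sI01 (ap y i)) /\
    smeasure_ge (fun x => exists i, ~ lt0 n i /\
        srlt (srsub (ap y i) (ap Psi (ap y i))) x /\
        srlt x (sradd (ap y i) (ap Psi (ap y i)))) (srsub (sr1 M) e).

Section Sat.
Variables (G : ctx) (e : env M G).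

Lemma sat_I01 x : sat (I01 G) (esc x e) = sI01 x.
Proof.
by rewrite /I01 /mkset; and_simp; rewrite sat_isReal !sat_Rle eval_R0 eval_R1.
Qed.

Lemma sat_wkset D (i : ext G D) (E : rset G) (e' : env M D) x :
  sat (wkset i E) (esc x e') = sat E (esc x (fun s y => e' s (i s y))).
Proof. by rewrite /wkset /mkset sat_inst1. Qed.

Lemma sat_setD (D E : rset G) x :
  sat (setD D E) (esc x e) = (sat D (esc x e) /\ ~ sat E (esc x e)).
Proof. by rewrite /setD /mkset sat_and sat_not !sat_inst1. Qed.

Lemma sat_isFun (D : rset G) (f : tm G (Arr T1 T1)) :
  sat (isFun D f) e = sisFun (fun x => sat D (esc x e)) (eval e f).
Proof.
rewrite /isFun sat_and !sat_all /sisFun; congr and.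
  apply: eq_forall => x; rewrite sat_imp sat_inst1 sat_isReal; evl.
  reflexivity.
apply: eq_forall => x; rewrite sat_all; apply: eq_forall => y.
imp_simp; rewrite !sat_inst1 !sat_Req; evl; reflexivity.
Qed.

Lemma sat_set_of (Y : tm G (Arr T1 T1)) x : sat (set_of Y) (esc x e) = sset_of (eval e Y) x.
Proof. by rewrite /set_of /mkset sat_and sat_isReal sat_Rlt eval_R0; evl. Qed.

Lemma sat_covers (a b : tm G (Arr T0 T1)) (E : rset G) :
  sat (covers a b E) e = scovers (eval e a) (eval e b) (fun x => sat E (esc x e)).
Proof.
rewrite /covers sat_and /scovers; congr and.
  rewrite /intervals sat_all; apply: eq_forall => k.
  by and_simp; rewrite !sat_isReal sat_Rle; evl.
rewrite sat_all; apply: eq_forall => x; imp_simp; rewrite sat_isReal sat_inst1 sat_ex.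
evl; congr (_ -> _ -> _); apply: eq_exists => k.
by rewrite sat_and !sat_Rlt; evl.
Qed.

Lemma sat_total_le (a b : tm G (Arr T0 T1)) c :
  sat (total_le a b c) e = (forall j, srle (stotal (eval e a) (eval e b) j) (eval e c)).
Proof.
by rewrite /total_le sat_all; apply: eq_forall => j; rewrite sat_Rle eval_total; evl.
Qed.

Lemma sat_total_ge (a b : tm G (Arr T0 T1)) c :
  sat (total_ge a b c) e = (forall d, sreal d -> srlt (sr0 M) d ->
    exists j, srle (eval e c) (sradd (stotal (eval e a) (eval e b) j) d)).
Proof.
rewrite /total_ge sat_all; apply: eq_forall => d.
imp_simp; rewrite sat_isReal sat_Rlt eval_R0 sat_ex; congr (_ -> _ -> _).
by apply: eq_exists => j; rewrite sat_Rle eval_Radd eval_total; evl.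
Qed.
End Sat.

Lemma sat_covers_wk G D (i : ext G D) (e : env M D) (a b : tm D (Arr T0 T1)) (E : rset G) :
  sat (covers a b (wkset i E)) e =
  scovers (eval e a) (eval e b) (fun x => sat E (esc x (fun s y => e s (i s y)))).
Proof.
rewrite sat_covers (_ : (fun x => sat (wkset i E) (esc x e)) =
  (fun x => sat E (esc x (fun s y => e s (i s y))))) //.
by apply/funext => x; rewrite sat_wkset.
Qed.

Section Sat2.
Variables (G : ctx) (e : env M G).

Lemma sat_measure_le (E : rset G) c :
  sat (measure_le E c) e = smeasure_le (fun x => sat E (esc x e)) (eval e c).
Proof.
rewrite /measure_le sat_all; apply: eq_forall => d.
imp_simp; rewrite sat_isReal sat_Rlt eval_R0 sat_ex; congr (_ -> _ -> _).
apply: eq_exists => a; rewrite sat_ex; apply: eq_exists => b.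
by rewrite sat_and sat_covers_wk sat_total_le eval_Radd; evl.
Qed.

Lemma sat_measure_ge (E : rset G) c :
  sat (measure_ge E c) e = smeasure_ge (fun x => sat E (esc x e)) (eval e c).
Proof.
rewrite /measure_ge sat_all; apply: eq_forall => a; rewrite sat_all; apply: eq_forall => b.
by rewrite sat_imp sat_covers_wk sat_total_ge; evl.
Qed.

Lemma sat_measure2_le (E E' : rset G) c :
  sat (measure2_le E E' c) e =
  smeasure2_le (fun x => sat E (esc x e)) (fun x => sat E' (esc x e)) (eval e c).
Proof.
rewrite /measure2_le sat_all; apply: eq_forall => d.
imp_simp; rewrite sat_isReal sat_Rlt eval_R0 sat_ex; congr (_ -> _ -> _).
apply: eq_exists => a; rewrite sat_ex; apply: eq_exists => b.
rewrite sat_ex; apply: eq_exists => a'; rewrite sat_ex; apply: eq_exists => b'.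
and_simp; rewrite !sat_covers_wk sat_all; evl; congr (_ /\ _ /\ _).
by apply: eq_forall => j; rewrite sat_Rle !eval_Radd !eval_total; evl.
Qed.

Lemma sat_measurable_set (E : rset G) :
  sat (measurable_set E) e = smeasurable (fun x => sat E (esc x e)).
Proof.
rewrite /measurable_set sat_measure2_le eval_R1 /smeasurable; congr smeasure2_le.
by apply/funext => x; rewrite sat_setD sat_I01.
Qed.
End Sat2.

Lemma sat_measurable_fun G (e : env M G) (f : tm G (Arr T1 T1)) :
  sat (measurable_fun f) e = smeasurable_fun (eval e f).
Proof.
rewrite /measurable_fun sat_and sat_isFun /smeasurable_fun; congr (sisFun _ _ /\ _).
  by apply/funext => x; rewrite sat_I01.
rewrite sat_all; apply: eq_forall => t; rewrite sat_imp sat_isReal sat_measurable_set; evl.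
congr (_ -> smeasurable _); apply/funext => x.
by rewrite /mkset sat_and sat_inst1 sat_I01 sat_Rlt; evl.
Qed.

Lemma sat_almost_all G (e : env M G) (E : rset G) :
  sat (almost_all E) e = salmost_all (fun x => sat E (esc x e)).
Proof.
rewrite /almost_all sat_ex; apply: eq_exists => Y.
and_simp; rewrite sat_isFun sat_measure_le eval_R0 sat_all; evl; congr (_ /\ _ /\ _).
- by congr sisFun; apply/funext => x; rewrite /Rline /mkset sat_isReal.
- by congr smeasure_le; apply/funext => x; rewrite sat_set_of.
- apply: eq_forall => x; imp_simp; rewrite sat_not !sat_inst1 sat_I01 sat_set_of; evl.
  reflexivity.
Qed.

Lemma sat_converges_at G (e : env M G) F f (x : tm G T1) :
  sat (converges_at F f x) e = sconverges_at (eval e F) (eval e f) (eval e x).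
Proof.
rewrite /converges_at sat_all; apply: eq_forall => d.
imp_simp; rewrite sat_isReal sat_Rlt eval_R0 sat_ex; congr (_ -> _ -> _).
apply: eq_exists => n0; rewrite sat_all; apply: eq_forall => n.
by rewrite sat_imp sat_not sat_Rlt eval_Rabs eval_Rsub; evl.
Qed.

Lemma sat_converges_in_measure G (e : env M G) F f :
  sat (converges_in_measure F f) e = sconverges_in_measure (eval e F) (eval e f).
Proof.
rewrite /converges_in_measure sat_all; apply: eq_forall => d.
rewrite sat_all; apply: eq_forall => k.
imp_simp; rewrite sat_isReal sat_Rlt eval_R0 sat_ex; evl; congr (_ -> _ -> _).
apply: eq_exists => n0; rewrite sat_all; apply: eq_forall => n.
rewrite sat_imp sat_not sat_measure_le eval_RofQ eval_Qexp; evl; congr (_ -> smeasure_le _ _).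
apply/funext => x; rewrite /mkset sat_and sat_inst1 sat_I01 sat_Rle eval_Rabs eval_Rsub; evl.
reflexivity.
Qed.

Lemma sat_WTE (e : env M []) : sat WTE e = sWTE.
Proof.
rewrite /WTE sat_all; apply: eq_forall => F; rewrite sat_all; apply: eq_forall => f.
imp_simp; rewrite sat_measurable_fun sat_almost_all sat_converges_in_measure sat_all; evl.
congr (_ -> _ -> salmost_all _ -> _).
  by apply: eq_forall => n; rewrite sat_measurable_fun; evl.
by apply/funext => x; rewrite /mkset sat_converges_at; evl.
Qed.

Lemma sat_WHBUm (e : env M []) : sat WHBUm e = sWHBU.
Proof.
rewrite /WHBUm sat_all; apply: eq_forall => Psi; rewrite sat_all; apply: eq_forall => d.
imp_simp; rewrite sat_measurable_fun sat_isReal sat_Rlt eval_R0 sat_ex sat_all; evl.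
congr (_ -> _ -> _ -> _ -> _).
  apply: eq_forall => x; imp_simp; rewrite sat_inst1 sat_I01 sat_Rlt eval_R0; evl.
  reflexivity.
apply: eq_exists => n; rewrite sat_ex; apply: eq_exists => y.
rewrite sat_and sat_all sat_measure_ge eval_Rsub eval_R1; evl; congr (_ /\ smeasure_ge _ _).
  by apply: eq_forall => i; imp_simp; rewrite sat_not sat_inst1 sat_I01; evl.
apply/funext => x; rewrite /mkset sat_ex; apply: eq_exists => i.
by and_simp; rewrite sat_not !sat_Rlt eval_Rsub eval_Radd; evl.
Qed.
End Sets.

(** * Covers by intervals *)

Section DefinableReals.
Variables (M : amodel) (G : ctx).
Implicit Types X Y : penv M G -> M T1.

Lemma dfn_srofq (F : penv M G -> M T0) : dfn F -> dfn (fun g => srofq (F g)).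
Proof. by apply: dfn_comp1; rewrite /srofq; dfn_tac3. Qed.
Lemma dfn_sradd X Y : dfn X -> dfn Y -> dfn (fun g => sradd (X g) (Y g)).
Proof. by apply: dfn_comp2; rewrite /sradd; dfn_tac3. Qed.
Lemma dfn_srsub X Y : dfn X -> dfn Y -> dfn (fun g => srsub (X g) (Y g)).
Proof. by apply: dfn_comp2; rewrite /srsub; dfn_tac3. Qed.
Lemma drel_srlt X Y : dfn X -> dfn Y -> drel (fun g => srlt (X g) (Y g)).
Proof.
move=> dX dY; apply: drel_ex; apply: drel_qlt; last first.
  by apply: dfn_app; [exact: (dfn_weak _ dY)|exact: dfn_v0].
apply: dfn_sqadd; first by apply: dfn_app; [exact: (dfn_weak _ dX)|exact: dfn_v0].
by apply: dfn_sqexp'; exact: dfn_v0.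
Qed.
Lemma drel_srle X Y : dfn X -> dfn Y -> drel (fun g => srle (X g) (Y g)).
Proof. by move=> dX dY; apply: drel_not; apply: drel_srlt. Qed.
End DefinableReals.

Lemma dfn_ssum (M : amodel) G (U : penv M G -> M (Arr T0 T1)) (J : penv M G -> M T0) :
  dfn U -> dfn J -> dfn (fun g => ssum (U g) (J g)).
Proof.
apply: dfn_comp2.
apply: (@dfn_lam M [T0; Arr T0 T1] T0 T0 (fun n g => ssumP g.2.1 (add n g.1) g.1)).
by apply: dfn_ssumP; dfn_tac3.
Qed.

Lemma dfn_stotal (M : amodel) G (A B : penv M G -> M (Arr T0 T1)) (J : penv M G -> M T0) :
  dfn A -> dfn B -> dfn J -> dfn (fun g => stotal (A g) (B g) (J g)).
Proof.
move=> dA dB dJ; apply: dfn_ssum => //.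
apply: (@dfn_comp2 M G _ _ _ (fun a b => mlam (fun k => srsub (ap b k) (ap a k)))) => //.
apply: (@dfn_lam M [Arr T0 T1; Arr T0 T1] T0 T1 (fun k g => srsub (ap g.1 k) (ap g.2.1 k))).
by apply: dfn_srsub; dfn_tac3.
Qed.

(** * Intervals cut at a rational point *)

Section Caps.
Variable M : amodel.
Local Notation N := (M T0).
Local Notation R := (Rl M).

Definition sqhalf (q : N) : N := sqmk (spos q) (sneg q) (add (scsnd q) (sden q)).
Lemma qval_half q : qval (sqhalf q) = qval q / 2.
Proof.
rewrite qval_mk qvalE iND iN_sden; have H := iNS_gt0 (scsnd q).
by field; rewrite !gt_eqF //; lra.
Qed.

Definition sqmin (x q : N) : N := sqhalf (sqsub (sqadd x q) (sqabs (sqsub x q))).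
Lemma qval_min x q : qval (sqmin x q) = Num.min (qval x) (qval q).
Proof.
rewrite qval_half qval_sub qval_add qval_abs qval_sub.
have [H|H] := leP (qval x) (qval q).
  by rewrite ler0_norm ?subr_le0 //; lra.
by rewrite ger0_norm ?subr_ge0 ?ltW //; lra.
Qed.

Lemma dfn_sqhalf G (X : penv M G -> N) : dfn X -> dfn (fun g => sqhalf (X g)).
Proof. by apply: dfn_comp1; rewrite /sqhalf; dfn_tac3. Qed.

Lemma dfn_sqmin G (X Y : penv M G -> N) : dfn X -> dfn Y -> dfn (fun g => sqmin (X g) (Y g)).
Proof.
move=> dX dY; apply: dfn_sqhalf; apply: dfn_sqsub; first exact: dfn_sqadd.
by apply: dfn_sqabs; apply: dfn_sqsub.
Qed.

(** Applied to both sequences of endpoints, this leaves of each interval the part to the left of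
    [q]. *)
Definition scap (q : N) (u : M (Arr T0 T1)) : M (Arr T0 T1) :=
  mlam (fun k => mlam (fun n => sqmin (ap (ap u k) n) q)).

Lemma dfn_scap G (Q : penv M G -> N) (U : penv M G -> M (Arr T0 T1)) :
  dfn Q -> dfn U -> dfn (fun g => scap (Q g) (U g)).
Proof.
apply: dfn_comp2.
apply: (@dfn_lam M [Arr T0 T1; T0] T0 T1 (fun k g => mlam (fun n => sqmin (ap (ap g.1 k) n) g.2.1))).
apply: (@dfn_lam M [T0; Arr T0 T1; T0] T0 T0 (fun n g => sqmin (ap (ap g.2.1 g.1) n) g.2.2.1)).
by apply: dfn_sqmin; dfn_tac3.
Qed.

Lemma scapE q u k n : ap (ap (scap q u) k) n = sqmin (ap (ap u k) n) q.
Proof. by rewrite mlamE2 //; apply: dfn_sqmin; dfn_tac3. Qed.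

Lemma sreals_cap q u : sreals u -> sreals (scap q u).
Proof.
move=> Hu k n i; have := Hu k n i; rewrite !scapE !qval_min !ltr_norml => /andP[? ?].
case: (leP (qval (ap (ap u k) n)) (qval q)); case: (leP (qval (ap (ap u k) (add n i))) (qval q));
  by move=> ? ?; apply/andP; split; lra.
Qed.

Lemma rv_cap q u k : sreals u -> rv (ap (scap q u) k) = Num.min (rv (ap u k)) (kr (qval q)).
Proof.
move=> Hu; apply: (@rv_unique _ _ _ 1); [exact: sreals_cap|by []|move=> n].
have := rv_approx n (Hu k); rewrite scapE qval_min mul1r.
have -> : kr (Num.min (qval (ap (ap u k) n)) (qval q)) =
    Num.min (kr (qval (ap (ap u k) n))) (kr (qval q)).
  case: (leP (qval (ap (ap u k) n)) (qval q)) => H; first by rewrite min_l // kr_le.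
  by rewrite min_r // kr_le ltW.
have e0 : 0 < kr (eps n) by rewrite kr_gt0 eps_gt0.
rewrite !ler_norml => /andP[? ?].
case: (leP (rv (ap u k)) (kr (qval q))); case: (leP (kr (qval (ap (ap u k) n))) (kr (qval q)));
  by move=> ? ?; apply/andP; split; lra.
Qed.

(** Values in [R] are not objects of the model, but the order of their codes is definable, so
    induction applies to it. *)
Lemma rind (X Y : N -> M T1) :
  dfn (fun g : penv M [T0] => X g.1) -> dfn (fun g : penv M [T0] => Y g.1) ->
  (forall n, sreal (X n)) -> (forall n, sreal (Y n)) ->
  rv (X (zero M)) <= rv (Y (zero M)) ->
  (forall n, rv (X n) <= rv (Y n) -> rv (X (add n (one M))) <= rv (Y (add n (one M)))) ->
  forall n, rv (X n) <= rv (Y n).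
Proof.
move=> dX dY rX rY H0 HS n; apply/srleP => //; move: n.
apply: (@ind M (fun n => srle (X n) (Y n))); first exact: drel_srle.
  exact/srleP.
by move=> n /srleP H; apply/srleP => //; apply: HS; apply: H.
Qed.
End Caps.

(** The difference of the two lengths is the length of the part of [[x, y]] between [p] and [q]. *)
Lemma min_diff_bound (F : realFieldType) (x y p q : F) : x <= y -> p <= q ->
  Num.min y p - Num.min x p <= Num.min y q - Num.min x q <=
    Num.min y p - Num.min x p + (y - x).
Proof.
move=> xy pq; case: (leP y q); case: (leP x q); case: (leP y p); case: (leP x p) => *;
  by apply/andP; split; lra.
Qed.

(** * Length of a cover between two rational points *)

Section Cover.
Variables (M : amodel) (a b : M (Arr T0 T1)).
Local Notation N := (M T0).
Local Notation R := (Rl M).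
Local Notation zero := (zero M).
Local Notation one := (one M).
Hypotheses (ra : sreals a) (rb : sreals b) (ab : forall k, rv (ap a k) <= rv (ap b k)).
Implicit Types p q r : N.

(* [h q n] is the total length of the parts of the first [n] intervals left of [q]. *)
Definition sh q n : M T1 := stotal (scap q a) (scap q b) n.
Lemma h_sig : {f : N -> N -> R | forall q n, f q n = rv (sh q n)}.
Proof. by exists (fun q n => rv (sh q n)). Qed.
Definition h q n : R := sval h_sig q n.
Lemma hE q n : h q n = rv (sh q n). Proof. exact: (svalP h_sig). Qed.
Definition v q : R := kr (qval q).
(** For [p <= q] this is the total length of the parts of the first [n] intervals between [p] and
    [q], as a code for use in definable predicates. *)
Definition sD p q n : M T1 := srsub (sh q n) (sh p n).

Lemma sreal_h q n : sreal (sh q n).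
Proof. by apply: sreal_total; apply: sreals_cap. Qed.
Lemma sreal_D p q n : sreal (sD p q n).
Proof. by apply: sreal_sub; exact: sreal_h. Qed.
Lemma rv_D p q n : rv (sD p q n) = h q n - h p n.
Proof. by rewrite !hE rv_sub //; exact: sreal_h. Qed.
Lemma h0 q : h q zero = 0.
Proof. by rewrite hE; apply: rv_total0; apply: sreals_cap. Qed.
Lemma hS q n : h q (add n one) =
  h q n + (Num.min (rv (ap b n)) (v q) - Num.min (rv (ap a n)) (v q)).
Proof. by rewrite !hE /sh rv_totalS ?rv_cap //; exact: sreals_cap. Qed.

Lemma dfn_h G (Q F : penv M G -> N) : dfn Q -> dfn F -> dfn (fun g => sh (Q g) (F g)).
Proof.
by move=> dQ dF; apply: dfn_stotal => //; apply: dfn_scap => //; exact: dfn_const.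
Qed.

Lemma dfn_D G (P Q F : penv M G -> N) :
  dfn P -> dfn Q -> dfn F -> dfn (fun g => sD (P g) (Q g) (F g)).
Proof. by move=> dP dQ dF; apply: dfn_srsub; exact: dfn_h. Qed.

(** Each further interval adds a nonnegative length between [p] and [q]. *)
Lemma h_mono p q n i : v p <= v q -> h q n - h p n <= h q (add n i) - h p (add n i).
Proof.
move=> pq; rewrite -!rv_D; move: i.
apply: (@rind M (fun=> sD p q n) (fun i => sD p q (add n i))).
- exact: dfn_const.
- by apply: dfn_D; dfn_tac3.
- by move=> _; exact: sreal_D.
- by move=> i; exact: sreal_D.
- by rewrite addn0.
- move=> i; rewrite addA !rv_D !hS=> H.
  have /andP [H1 _] := min_diff_bound (ab (add n i)) pq; lra.
Qed.

Lemma h_ge0 p q n : v p <= v q -> 0 <= h q n - h p n.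
Proof.
by move=> pq; have := h_mono zero n pq; rewrite !h0 (addC zero) addn0 subrr.
Qed.

Lemma h_le_total p q n : v p <= v q -> h q n - h p n <= rv (stotal a b n).
Proof.
move=> pq; rewrite -rv_D; move: n.
apply: (@rind M (fun n => sD p q n) (fun n => stotal a b n)).
- by apply: dfn_D; dfn_tac3.
- by apply: dfn_stotal; dfn_tac3.
- by move=> n; exact: sreal_D.
- by move=> n; exact: sreal_total.
- by rewrite rv_D !h0 rv_total0 // subrr.
- move=> i; rewrite !rv_D !hS rv_totalS // => H.
  have /andP [_ H2] := min_diff_bound (ab i) pq; lra.
Qed.

(** The interval with index [m] contains [[p, q]] and contributes its whole length. *)
Lemma h_step m p q : v p <= v q -> rv (ap a m) <= v p -> v q <= rv (ap b m) ->
  v q - v p <= h q (add m one) - h p (add m one).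
Proof.
move=> pq am bm; rewrite !hS; have := h_ge0 m pq=> H.
rewrite (min_r bm) (min_r (le_trans pq bm)) (min_l am) (min_l (le_trans am pq)); lra.
Qed.

(* For some [n] the first [n] intervals, counted with multiplicity, meet [p, q] in
   total length at least [q - p]; this stands in for their covering [p, q]. *)
Definition filled p q : Prop := exists n, srle (srofq (sqsub q p)) (sD p q n).

Lemma filledP p q : filled p q <-> exists n, v q - v p <= h q n - h p n.
Proof.
have E n : srle (srofq (sqsub q p)) (sD p q n) <-> v q - v p <= h q n - h p n.
  rewrite srleP; [|exact: sreal_rofq|exact: sreal_D].
  by rewrite rv_rofq qval_sub krB rv_D.
by split=> -[n H]; exists n; apply/E.
Qed.

Lemma drel_filled G (P Q : penv M G -> N) :
  dfn P -> dfn Q -> drel (fun g => filled (P g) (Q g)).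
Proof.
move=> dP dQ; have dP' := dfn_weak T0 dP; have dQ' := dfn_weak T0 dQ.
apply: drel_ex; apply: drel_srle; first by apply: dfn_srofq; exact: dfn_sqsub.
by apply: dfn_D => //; exact: dfn_v0.
Qed.

(** The interval around the supremum [y] prolongs a filled [[p, r]], with [r] close to [y], as far
    as it reaches itself. Should it end before [q], rationals beyond [y] would be reached, against
    the choice of [y]; so it reaches [q]. *)
Lemma filled_sup p q (y : R) m :
  v p <= y -> y <= v q ->
  (forall r, v p <= v r -> v r <= v q -> filled p r -> v r <= y) ->
  (forall d, 0 < d -> exists r, [/\ v p <= v r, v r <= v q, filled p r & y - d < v r]) ->
  rv (ap a m) < y -> y < rv (ap b m) -> filled p q.
Proof.
move=> py yq ub lub am bm.
have ext r r' : v p <= v r -> v r <= v r' -> filled p r -> rv (ap a m) <= v r ->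
    v r' <= rv (ap b m) -> filled p r'.
  (* This many intervals include the first [n], which fill [[p, r]], and the one with index [m],
     which contains [[r, r']]. Lengths over the two adjacent pieces add up, so nothing is counted
     twice. *)
  move=> pr rr' /filledP [n Hn] ar br'; apply/filledP; exists (add n (add m one)).
  have H1 := h_mono n (add m one) pr; have H2 := h_mono (add m one) n rr'.
  have H3 := h_step rr' ar br'; rewrite (addC (add m one)) in H2.
  lra.
have [|r [pr rq Fr yr]] := lub (y - rv (ap a m)); first by rewrite subr_gt0.
have ar : rv (ap a m) <= v r by lra.
have ry : v r <= y by apply: ub.
have [qb|bq] := leP (v q) (rv (ap b m)); first exact: (ext r).
have [r' /andP [yr' rb']] := R_between bm.
have Fr' : filled p r'.
  by apply: (ext r) => //; [exact: le_trans ry (ltW yr')|exact: ltW].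
have H : v r' <= y.
  apply: ub => //; first by apply: le_trans py (ltW yr').
  by apply: ltW; apply: lt_trans bq.
by exfalso; have := lt_le_trans yr' H; rewrite ltxx.
Qed.
End Cover.

(** * Suprema by means of the minimum operator *)

Section Supremum.
Variable M : amodel.
Local Notation N := (M T0).
Local Notation R := (Rl M).
Local Notation zero := (zero M).
Local Notation one := (one M).

Definition dyadic i n : N := sqmk i zero (spred (spow2 n)).
Lemma qval_dyadic i n : qval (dyadic i n) = iN i * eps n.
Proof. by rewrite qval_mk iN0 subr0 iN_predS ?pow2_gt0 // epsE. Qed.

Lemma dfn_dyadic G (X Y : penv M G -> N) : dfn X -> dfn Y -> dfn (fun g => dyadic (X g) (Y g)).
Proof. by move=> dX dY; apply: dfn_sqmk => //; [exact: dfn_const|apply: dfn_spred; exact: dfn_spow2]. Qed.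

(** To be an upper bound is a definable property, so the least [i] for which [p j + i 2^-n] is one
    can be found by [minN], uniformly in [j] and [n]. These least bounds, for growing [n], form the
    code of the supremum. *)
Lemma sup_exists (Q : N -> N -> Prop) (p : N -> N) :
  drel (fun g : penv M [T0; T0] => Q g.1 g.2.1) -> dfn (fun g : penv M [T0] => p g.1) ->
  (forall j, Q (p j) j) -> (forall j r, Q r j -> qval (p j) <= qval r <= qval (p j) + 1) ->
  exists Y : M (Arr T0 T1), forall j, [/\ sreal (ap Y j),
    (forall r, Q r j -> v r <= rv (ap Y j)) &
    (forall d, 0 < d -> exists2 r, Q r j & rv (ap Y j) - d < v r)].
Proof.
move=> dQ dp Qp Qb.
pose ub i n j := forall r, Q r j -> qval r <= qval (sqadd (p j) (dyadic i n)).
pose s j n := sqadd (p j) (dyadic (minN (fun i => ub i n j)) n).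
have dub G (I n j : penv M G -> N) : dfn I -> dfn n -> dfn j -> drel (fun g => ub (I g) (n g) (j g)).
  move=> dI dn dj; have dI' := dfn_weak T0 dI; have dn' := dfn_weak T0 dn; have dj' := dfn_weak T0 dj.
  apply: drel_all; apply: drel_imp.
    have [f Hf] := dQ=> Hf'.
    exists (fun g : penv M (T0 :: G) => f (g.1, (j g.2, tt))); last by move=> g; rewrite -Hf'.
    apply: (@dfn_comp2 M _ T0 T0 T0 (fun x y => f (y, (x, tt)))) => //; last exact: dfn_v0.
    by apply: dfn_ext Hf => -[x [y []]].
  apply: drel_qle; first exact: dfn_v0.
  apply: dfn_sqadd; last exact: dfn_dyadic.
  exact: (@dfn_comp1 M _ T0 T0 p).
have ds : dfn (fun g : penv M [T0; T0] => s g.2.1 g.1).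
  apply: dfn_sqadd; first by apply: (@dfn_comp1 M _ T0 T0 p) => //; exact: dfn_v1.
  apply: dfn_dyadic; last exact: dfn_v0.
  by apply: (@dfn_min M [T0; T0] (fun i g => ub i g.1 g.2.1)); apply: dub; dfn_tac3.
exists (mlam (fun j => mlam (s j))) => j.
have sE n : ap (ap (mlam (fun j => mlam (s j))) j) n = s j n by rewrite mlamE2.
have Hs n : (forall r, Q r j -> qval r <= qval (s j n)) /\
    exists2 r, Q r j & qval (s j n) - eps n < qval r.
  have : least (fun i => ub i n j) (minN (fun i => ub i n j)).
    apply: minNP; first by apply: dub; dfn_tac3.
    (* The search succeeds: [2^n] steps of length [2^-n] reach [p j + 1]. *)
    exists (spow2 n) => r /Qb /andP [_ H]; rewrite qval_add qval_dyadic epsE mulfV //.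
    by rewrite gt_eqF // pow2_gt0.
  rewrite /s; set i := minN _ => -[Hi Li]; split=> //.
  (* If [i] is zero, [p j] itself is close to the bound. Otherwise the bound one step lower fails,
     and the element of [Q] violating it is close enough. *)
  have [i0|[i' Ei]] := predn_ex i.
    exists (p j) => //; rewrite qval_add qval_dyadic i0 iN0 mul0r addr0.
    by have := eps_gt0 n; lra.
  have : ~ ub i' n j by apply: Li; rewrite Ei; exact: ltnS'.
  move=> /existsNP [r /not_implyP [Qr /negP]]; rewrite -ltNge => H; exists r => //.
  by move: H; rewrite !qval_add !qval_dyadic Ei iND iN1 mulrDl mul1r addrA addrK.
have rY : sreal (ap (mlam (fun j => mlam (s j))) j).
  move=> n i; rewrite !sE.
  (* Each bound lies above all of [Q] and exceeds some element of it by less than its own precision;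
     comparing the two bounds through these elements gives the rate. *)
  have [U1 [r1 Q1 H1]] := Hs n; have [U2 [r2 Q2 H2]] := Hs (add n i).
  have H3 := U1 _ Q2; have H4 := U2 _ Q1.
  have H5 : eps (add n i) <= eps n by apply: eps_le; rewrite iND lerDl iN_ge0.
  by rewrite ltr_norml; apply/andP; split; lra.
split=> // [r Qr|d d0].
  apply: (@le_eps_mul M _ _ 1) => // n; rewrite mul1r.
  have [/(_ _ Qr) U _] := Hs n; have := rv_approx n rY; rewrite sE ler_norml => /andP[? ?].
  by move: U; rewrite -kr_le -/(v r); lra.
have d2 : 0 < d / 2 by lra.
have [n Hn] := eps_small d2; have [_ [r Qr H]] := Hs n; exists r => //.
have := rv_approx n rY; rewrite sE ler_norml => /andP[? ?].
by move: H; rewrite -kr_lt krB -/(v r); lra.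
Qed.
End Supremum.

(** * Convergence in measure *)

Section SimpleCovers.
Variable M : amodel.
Local Notation N := (M T0).
Local Notation R := (Rl M).
Local Notation zero := (zero M).
Local Notation one := (one M).
Implicit Types (S : M T1 -> Prop) (x d : M T1).

Lemma sI01P x : sI01 x <-> sreal x /\ 0 <= rv x <= 1.
Proof.
rewrite /sI01; split=> [[rx [x0 x1]]|[rx /andP [x0 x1]]]; split=> //.
  move: x0 x1; rewrite (srleP (@sreal_0 M) rx) (srleP rx (@sreal_1 M)) rv_0 rv_1.
  by move=> -> ->.
by rewrite (srleP (@sreal_0 M) rx) (srleP rx (@sreal_1 M)) rv_0 rv_1.
Qed.

(* the sequence of rationals [p], [q], [q], ... *)
Definition rat_seq (p q : N) : M (Arr T0 T1) := mlam (fun k => srofq (ap (pair1 p q) k)).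

Lemma rat_seqE p q k : ap (rat_seq p q) k = srofq (ap (pair1 p q) k).
Proof. by rewrite mlamE //; apply: dfn_srofq; dfn_tac3. Qed.

Lemma pair1_S (p q : N) k : ap (pair1 p q) (add k one) = q.
Proof.
have := recS (ap (co (Pi (Arr T0 T0) T0)) (ap (co (Pi T0 T0)) q)) p k.
by rewrite !apK.
Qed.

Lemma sreals_rat p q : sreals (rat_seq p q).
Proof. by move=> k; rewrite rat_seqE; exact: sreal_rofq. Qed.
Lemma rv_rat0 p q : rv (ap (rat_seq p q) zero) = kr (qval p).
Proof. by rewrite rat_seqE rv_rofq pair1_0. Qed.
Lemma rv_ratS p q k : rv (ap (rat_seq p q) (add k one)) = kr (qval q).
Proof. by rewrite rat_seqE rv_rofq pair1_S. Qed.

(** The first interval is [(p, q)] and all later ones are the empty [(r, r)]. *)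
Lemma total_rat p q r n : kr (qval p) <= kr (qval q) ->
  rv (stotal (rat_seq p r) (rat_seq q r) n) <= kr (qval q) - kr (qval p).
Proof.
move=> pq; have ra := sreals_rat p r; have rb := sreals_rat q r.
have [->|[k ->]] := predn_ex n; first by rewrite rv_total0 // subr_ge0.
rewrite -krB -qval_sub -rv_rofq; move: k.
apply: (@rind M (fun k => stotal (rat_seq p r) (rat_seq q r) (add k one)) (fun=> srofq (sqsub q p))).
- by apply: dfn_stotal; dfn_tac3.
- exact: dfn_const.
- by move=> k; exact: sreal_total.
- by move=> _; exact: sreal_rofq.
- by rewrite rv_totalS // rv_total0 // !rv_rat0 add0r rv_rofq qval_sub krB.
- by move=> k H; rewrite rv_totalS // !rv_ratS subrr addr0.
Qed.

Lemma rat_intervals p q r : kr (qval p) <= kr (qval q) ->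
  sintervals (rat_seq p r) (rat_seq q r).
Proof.
move=> pq k; have ra := sreals_rat p r k; have rb := sreals_rat q r k; split=> //; split=> //.
apply/srleP => //; have [->|[i ->]] := predn_ex k; first by rewrite !rv_rat0.
by rewrite !rv_ratS.
Qed.

Lemma cover_empty S : (forall x, ~ S x) ->
  exists a b, scovers a b S /\ sreals a /\ sreals b /\
    forall n, rv (stotal a b n) <= 0 :> R.
Proof.
move=> S0; exists (rat_seq (sq0 M) (sq0 M)), (rat_seq (sq0 M) (sq0 M)); split.
  by split=> [|x _ /S0 //]; exact: rat_intervals.
split; first exact: sreals_rat.
split; first exact: sreals_rat.
by move=> n; have := total_rat (sq0 M) n (lexx (kr (qval (sq0 M)))); rewrite subrr.
Qed.

Lemma cover_I01 S (d : R) : (forall x, S x -> sI01 x) -> 0 < d ->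
  exists a b, scovers a b S /\ sreals a /\ sreals b /\
    forall n, rv (stotal a b n) <= 1 + d.
Proof.
move=> SI d0; have d2 : 0 < d / 2 by lra.
(* The single interval [(-q, 1 + q)] has length [1 + 2q], less than [1 + d]. *)
have [q /andP [q0 qd]] := R_between d2.
pose p' := sqopp q; pose q' := sqadd (sq1 M) q.
have Ep : kr (qval p') = - kr (qval q) by rewrite qval_opp krN.
have Eq : kr (qval q') = 1 + kr (qval q) by rewrite qval_add krD qval1 kr1.
have pq : kr (qval p') <= kr (qval q') by rewrite Ep Eq; lra.
exists (rat_seq p' (sq0 M)), (rat_seq q' (sq0 M)); split.
  split=> [|x rx /SI /sI01P [_ /andP [x0 x1]]]; first exact: rat_intervals.
  exists zero; rewrite !srltP //; try exact: sreals_rat.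
  by rewrite !rv_rat0 Ep Eq; split; lra.
split; first exact: sreals_rat.
split; first exact: sreals_rat.
by move=> n; apply: le_trans (total_rat (sq0 M) n pq) _; rewrite Ep Eq; lra.
Qed.

Lemma srle_addP (x x' y y' : M T1) : sreal x -> sreal x' -> sreal y -> sreal y' ->
  srle (sradd x x') (sradd y y') <-> rv x + rv x' <= rv y + rv y'.
Proof.
move=> rx rx' ry ry'; rewrite -(rv_add rx rx') -(rv_add ry ry').
exact: srleP (sreal_add rx rx') (sreal_add ry ry').
Qed.

Lemma scovers_ext S S' a b : (forall x, sreal x -> S' x -> S x) -> scovers a b S -> scovers a b S'.
Proof. by move=> H [I C]; split=> // x rx /(H x rx); exact: C. Qed.

Lemma scovers_reals S a b : scovers a b S ->
  [/\ sreals a, sreals b, forall k, rv (ap a k) <= rv (ap b k) &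
    forall x, sreal x -> S x -> exists k, rv (ap a k) < rv x < rv (ap b k)].
Proof.
move=> [I C]; have ra k : sreal (ap a k) by have [] := I k.
have rb k : sreal (ap b k) by have [_ []] := I k.
split=> // [k|x rx /(C x rx) [k [H1 H2]]].
  by have [_ [_ /srleP]] := I k; apply.
by exists k; move: H1 H2; rewrite !srltP // => -> ->.
Qed.

Lemma smeasure2_sym S S' c : smeasure2_le S S' c -> sreal c -> smeasure2_le S' S c.
Proof.
move=> H rc d rd d0; have [a [b [a' [b' [C1 [C2 T]]]]]] := H d rd d0.
exists a', b', a, b; split; [exact: C2|split; [exact: C1|move=> j]].
have [r1 r2 _ _] := scovers_reals C1; have [r3 r4 _ _] := scovers_reals C2.
have t1 := sreal_total j r1 r2; have t2 := sreal_total j r3 r4.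
by apply/(srle_addP t2 t1 rc rd); move/(srle_addP t1 t2 rc rd): (T j); rewrite addrC.
Qed.

Lemma smeasure2_I01_empty S S' : (forall x, S x -> sI01 x) -> (forall x, ~ S' x) ->
  smeasure2_le S S' (sr1 M).
Proof.
move=> SI S0 d rd; rewrite (srltP (@sreal_0 M) rd) rv_0 => d0.
have [a [b [C [ra [rb T]]]]] := cover_I01 SI d0.
have [a' [b' [C' [ra' [rb' T']]]]] := cover_empty S0.
exists a, b, a', b'; split; [exact: C|split; [exact: C'|move=> j]].
have t1 := sreal_total j ra rb; have t2 := sreal_total j ra' rb'.
apply/(srle_addP t1 t2 (@sreal_1 M) rd); rewrite rv_1.
by have := T j; have := T' j; lra.
Qed.

Lemma smeasurable_full S : (forall x, S x <-> sI01 x) -> smeasurable S.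
Proof. by move=> E; apply: smeasure2_I01_empty => [x /E //|x [/E Sx]]; apply. Qed.

Lemma smeasurable_empty S : (forall x, ~ S x) -> smeasurable S.
Proof.
move=> E; apply: smeasure2_sym; last exact: sreal_1.
by apply: smeasure2_I01_empty => [x []|].
Qed.

(** The definition of measurability treats a set and its complement in [[0, 1]] alike. *)
Lemma smeasurable_compl S S' : (forall x, S x -> sI01 x) ->
  (forall x, S' x <-> sI01 x /\ ~ S x) -> smeasurable S -> smeasurable S'.
Proof.
move=> SI E H d rd d0.
have [a [b [a' [b' [C1 [C2 T]]]]]] := smeasure2_sym H (@sreal_1 M) rd d0.
exists a, b, a', b'; split; first by apply: scovers_ext C1 => x rx /E.
split; [|exact: T]; apply: scovers_ext C2 => x rx [Ix nS].
by apply: contrapT => n; apply: nS; apply/E.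
Qed.

Lemma smeasurable_const : smeasurable_fun (mlam (fun _ : M T1 => sr0 M)).
Proof.
have E x : ap (mlam (fun _ : M T1 => sr0 M)) x = sr0 M by rewrite mlamE //; exact: dfn_const.
split; first by split=> [x _|x y _ _ _]; rewrite !E; [exact: sreal_0|apply/sreqP; try exact: sreal_0].
move=> t rt; have [t0|t0] := ltP (rv t) 0.
  apply: smeasurable_full => x; split=> [[]//|Ix]; split=> //.
  by rewrite E srltP ?rv_0 //; exact: sreal_0.
apply: smeasurable_empty => x [_]; rewrite E srltP ?rv_0 //; last exact: sreal_0.
by rewrite ltNge t0.
Qed.
End SimpleCovers.

(** * Indicator functions of the sets where [Psi] is small *)

Section Indicator.
Variables (M : amodel) (Psi : M (Arr T1 T1)).
Local Notation N := (M T0).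
Local Notation R := (Rl M).
Local Notation zero := (zero M).
Local Notation one := (one M).
Hypotheses (mPsi : smeasurable_fun Psi) (Psi_gt0 : forall x, sI01 x -> srlt (sr0 M) (ap Psi x)).

Definition small (n : N) (x : M T1) := srle (ap Psi x) (srofq (sqexp n)).
(** The case distinction is made by a search for the right value, which keeps it definable, as
    [small] is. *)
Definition ind_code (n : N) (x : M T1) : N :=
  minN (fun c => (small n x -> c = one) /\ (~ small n x -> c = zero)).
(* the sequence of indicator functions of [{x | Psi x <= 2^-n}] *)
Definition indicators : M (Arr T0 (Arr T1 T1)) :=
  mlam (fun n => mlam (fun x => srofq (sqmk (ind_code n x) zero zero))).

Lemma ind_codeE n x : ind_code n x = if pselect (small n x) then one else zero.
Proof.
apply: minN_least; split; first by case: pselect.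
move=> i Hi [H1 H2]; move: Hi; case: pselect => [s|s]; last by move/nge0.
by rewrite (H1 s); exact: ltnn'.
Qed.

Lemma indicatorsE n x : ap (ap indicators n) x = if pselect (small n x) then sr1 M else sr0 M.
Proof.
rewrite mlamE2; last first.
  apply: dfn_srofq; apply: dfn_sqmk; [|exact: dfn_const|exact: dfn_const].
  apply: (@dfn_min M [T1; T0] (fun c g => (small g.2.1 g.1 -> c = one) /\ (~ small g.2.1 g.1 -> c = zero))).
  have ds : drel (fun g : penv M [T0; T1; T0] => small g.2.2.1 g.2.1).
    by apply: drel_srle; [|apply: dfn_srofq; apply: dfn_sqexp]; dfn_tac3.
  apply: drel_and; apply: drel_imp => //; [|exact: drel_not|]; apply: drel_eq; dfn_tac3.
by rewrite ind_codeE; case: pselect.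
Qed.

Lemma sreal_ind n x : sreal (ap (ap indicators n) x).
Proof. by rewrite indicatorsE; case: pselect => s; [exact: sreal_1|exact: sreal_0]. Qed.

Lemma sreal_Psi x : sI01 x -> sreal (ap Psi x).
Proof. by have [[H _] _] := mPsi; apply: H. Qed.

Lemma smallP n x : sI01 x -> small n x <-> rv (ap Psi x) <= kr (eps n).
Proof.
move=> Ix; rewrite /small srleP ?rv_rofq ?qval_exp //; [exact: sreal_Psi|exact: sreal_rofq].
Qed.

Lemma rv_ind1 n x : small n x -> rv (ap (ap indicators n) x) = 1.
Proof. by rewrite indicatorsE; case: pselect => // s _; rewrite rv_1. Qed.
Lemma rv_ind0 n x : ~ small n x -> rv (ap (ap indicators n) x) = 0.
Proof. by rewrite indicatorsE; case: pselect => // s _; rewrite rv_0. Qed.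

(** Depending on [t], the indicator exceeds [t] everywhere, nowhere, or on the complement of the set
    where [Psi] exceeds [2^-n]; only the last case needs the measurability of [Psi]. *)
Lemma measurable_ind n : smeasurable_fun (ap indicators n).
Proof.
split.
  split=> [x _|x y Ix Iy xy]; first exact: sreal_ind.
  have [[_ ePsi] _] := mPsi.
  have /sreqP E := ePsi x y Ix Iy xy.
  have {}E := E (sreal_Psi Ix) (sreal_Psi Iy).
  apply/sreqP; try exact: sreal_ind.
  have [s|s] := EM (small n x).
    have s' : small n y by apply/(smallP _ Iy); rewrite -E; apply/(smallP _ Ix).
    by rewrite (rv_ind1 s) (rv_ind1 s').
  have s' : ~ small n y by move=> /(smallP _ Iy); rewrite -E => /(smallP _ Ix).
  by rewrite (rv_ind0 s) (rv_ind0 s').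
move=> t rt.
have E x : srlt t (ap (ap indicators n) x) <-> rv t < rv (ap (ap indicators n) x).
  by apply: srltP => //; exact: sreal_ind.
have V x : rv (ap (ap indicators n) x) = 1 /\ small n x \/
           rv (ap (ap indicators n) x) = 0 /\ ~ small n x.
  by have [s|s] := EM (small n x); [left; rewrite rv_ind1|right; rewrite rv_ind0].
have [t0|t0] := ltP (rv t) 0.
  apply: smeasurable_full => x; split=> [[]//|Ix]; split=> //.
  by rewrite E; have [[-> _]|[-> _]] := V x; lra.
have [t1|t1] := leP 1 (rv t).
  by apply: smeasurable_empty => x [_]; rewrite E; have [[-> _]|[-> _]] := V x; lra.
have [_ /(_ (srofq (sqexp n)) (@sreal_rofq M _)) mS] := mPsi.
apply: smeasurable_compl mS => [x []//|x].
have Ex : sI01 x -> (srlt (srofq (sqexp n)) (ap Psi x) <-> ~ small n x).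
  by move=> Ix; rewrite /small /srle notK.
split=> [[Ix /E H]|[Ix nS]]; split; try exact: Ix.
  by move=> [_ /(Ex Ix) ns]; move: H; rewrite (rv_ind0 ns); lra.
apply/E; suff s : small n x by rewrite (rv_ind1 s).
by apply: contrapT => ns; apply: nS; split; [exact: Ix|exact/(Ex Ix)].
Qed.

(** At each [x] the indicator is zero as soon as [2^-n] is below [Psi x]. The exceptional set is
    empty and is given by the zero function. *)
Lemma indicators_converge :
  salmost_all (sconverges_at indicators (mlam (fun _ : M T1 => sr0 M))).
Proof.
have E x : ap (mlam (fun _ : M T1 => sr0 M)) x = sr0 M by rewrite mlamE //; exact: dfn_const.
exists (mlam (fun _ : M T1 => sr0 M)).
have nS x : ~ sset_of (mlam (fun _ : M T1 => sr0 M)) x.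
  by move=> [_]; rewrite E srltP ?ltxx //; exact: sreal_0.
split; first by split=> [x _|x y _ _ _]; rewrite !E; [exact: sreal_0|apply/sreqP; try exact: sreal_0].
split.
  move=> d rd; rewrite (srltP (@sreal_0 M) rd) rv_0 => d0.
  have [a [b [C [ra [rb T]]]]] := cover_empty nS; exists a, b; split; [exact: C|move=> j].
  rewrite srleP; [|exact: sreal_total|by apply: sreal_add => //; exact: sreal_0].
  by rewrite rv_add ?rv_0 //; [have := T j; lra|exact: sreal_0].
move=> x Ix _ e re; rewrite (srltP (@sreal_0 M) re) rv_0 => e0.
have := Psi_gt0 Ix; rewrite (srltP (@sreal_0 M) (sreal_Psi Ix)) rv_0 => /eps_small [n0 Hn0].
exists n0 => n /iN_le nn; have rI := sreal_ind n x.
have rS : sreal (srsub (ap (ap indicators n) x) (sr0 M)) by apply: sreal_sub => //; exact: sreal_0.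
rewrite E srltP //; last exact: sreal_abs.
rewrite rv_abs // rv_sub //; last exact: sreal_0.
rewrite rv_ind0 ?rv_0 ?subrr ?normr0 // => /smallP => /(_ Ix).
by apply/negP; rewrite -ltNge; apply: le_lt_trans Hn0; rewrite kr_le; exact: eps_le.
Qed.
End Indicator.

(** * The covering argument *)

Section Cells.
Variables (M : amodel) (N0 : M T0).
Local Notation N := (M T0).
Local Notation R := (Rl M).
Local Notation zero := (zero M).
Local Notation one := (one M).

(** The left end of the cell with number [j]; its right end is [cell (add j one)]. *)
Definition cell (j : N) : N := dyadic j N0.
Lemma v_cell j : v (cell j) = kr (iN j * eps N0).
Proof. by rewrite /v qval_dyadic. Qed.
Lemma v_cellS j : v (cell (add j one)) = v (cell j) + kr (eps N0).
Proof. by rewrite !v_cell -krD iND iN1 mulrDl mul1r. Qed.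
Lemma dfn_cell G (F : penv M G -> N) : dfn F -> dfn (fun g => cell (F g)).
Proof. by move=> dF; apply: dfn_dyadic => //; exact: dfn_const. Qed.

(** For all cells at once, [Y j] is the supremum of the points up to which cell [j] is filled from
    its left end. It lies in the cell whether or not the cell is filled, and [filled_sup] gives the
    last clause. *)
Lemma cell_sup (a b : M (Arr T0 T1)) : sreals a -> sreals b ->
  (forall k, rv (ap a k) <= rv (ap b k)) ->
  exists Y : M (Arr T0 T1), forall j, [/\ sreal (ap Y j),
    v (cell j) <= rv (ap Y j) <= v (cell (add j one)) &
    forall m, rv (ap a m) < rv (ap Y j) < rv (ap b m) ->
      filled a b (cell j) (cell (add j one))].
Proof.
move=> ra rb ab.
pose Q r j := qval (cell j) <= qval r /\ qval r <= qval (cell (add j one)) /\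
  filled a b (cell j) r.
(* Cells have length at most 1, the range in which [sup_exists] searches. *)
have le1 j : qval (cell (add j one)) <= qval (cell j) + 1.
  have : eps N0 <= eps zero by apply: eps_le; rewrite iN0 iN_ge0.
  by rewrite eps0 !qval_dyadic iND iN1 mulrDl mul1r lerD2l.
have leS j : qval (cell j) <= qval (cell (add j one)).
  by rewrite !qval_dyadic iND iN1 mulrDl mul1r lerDl ltW // eps_gt0.
have Q0 j : Q (cell j) j.
  split; [exact: lexx|split; [exact: leS|]].
  by apply/(filledP ra rb); exists zero; rewrite !subrr.
have dQ : drel (fun g : penv M [T0; T0] => Q g.1 g.2.1).
  apply: drel_and; first by apply: drel_qle; [apply: dfn_cell|]; dfn_tac3.
  apply: drel_and; first by apply: drel_qle; [|apply: dfn_cell]; dfn_tac3.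
  by apply: drel_filled; [apply: dfn_cell|]; dfn_tac3.
have dC : dfn (fun g : penv M [T0] => cell g.1) by apply: dfn_cell; exact: dfn_v0.
have Qb j r : Q r j -> qval (cell j) <= qval r <= qval (cell j) + 1.
  by move=> [H1 [H2 _]]; rewrite H1 (le_trans H2 (le1 j)).
have [Y HY] := sup_exists dQ dC Q0 Qb.
exists Y => j; have [rY U L] := HY j.
have b1 : v (cell j) <= rv (ap Y j).
  exact: U.
have b2 : rv (ap Y j) <= v (cell (add j one)).
  rewrite leNgt; apply/negP; rewrite -subr_gt0 => /L [r [_ [H _]] lt].
  by move: lt; rewrite subKr ltNge /v kr_le H.
split; [exact: rY|by rewrite b1 b2|move=> m /andP [am bm]].
apply: (filled_sup ra rb ab b1 b2 _ _ am bm) => [r|d /L [r [H1 [H2 H3]] lt]].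
  by rewrite /v !kr_le => H1 H2 H3; apply: U; split; [exact: H1|split; [exact: H2|exact: H3]].
by exists r; split; rewrite /v ?kr_le.
Qed.
End Cells.

Section Main.
Variable M : amodel.
Local Notation N := (M T0).
Local Notation R := (Rl M).
Local Notation zero := (zero M).
Local Notation one := (one M).

(* Walking through the cells, two families of intervals that together fill
   each cell have total length at least 1. *)
Lemma cells_total (N0 : N) (a b a' b' : M (Arr T0 T1)) :
  sreals a -> sreals b -> (forall k, rv (ap a k) <= rv (ap b k)) ->
  sreals a' -> sreals b' -> (forall k, rv (ap a' k) <= rv (ap b' k)) ->
  (forall i, lt0 i (spow2 N0) ->
    filled a b (cell N0 i) (cell N0 (add i one)) \/
    filled a' b' (cell N0 i) (cell N0 (add i one))) ->
  exists n, 1 <= rv (stotal a b n) + rv (stotal a' b' n).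
Proof.
move=> ra rb ab ra' rb' ab' F; set p := cell N0.
pose D n i := sradd (sD a b (p zero) (p i) n) (sD a' b' (p zero) (p i) n).
have rD n i : sreal (D n i) by apply: sreal_add; exact: sreal_D.
have E n i : srle (srofq (sqsub (p i) (p zero))) (D n i) <->
    v (p i) - v (p zero) <= (h a b (p i) n - h a b (p zero) n) +
                            (h a' b' (p i) n - h a' b' (p zero) n).
  rewrite -(rv_D ra rb) -(rv_D ra' rb') -(rv_add (sreal_D ra rb _ _ _) (sreal_D ra' rb' _ _ _)).
  by rewrite -krB -qval_sub -rv_rofq; exact: srleP (@sreal_rofq M _) (rD n i).
have v0 : v (p zero) = 0 by rewrite v_cell iN0 mul0r kr0.
have e0 : 0 < kr (eps N0) by rewrite kr_gt0 eps_gt0.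
have pi0 i : v (p zero) <= v (p i).
  by rewrite v0 v_cell -kr0 kr_le mulr_ge0 ?iN_ge0 // ltW // eps_gt0.
have piS i : v (p i) <= v (p (add i one)) by rewrite v_cellS lerDl ltW.
have walk i : ~ lt0 (spow2 N0) i -> exists n, srle (srofq (sqsub (p i) (p zero))) (D n i).
  move: i; apply: (@ind M (fun i => ~ lt0 (spow2 N0) i ->
    exists n, srle (srofq (sqsub (p i) (p zero))) (D n i))).
  - apply: drel_imp; first by apply: drel_not; apply: drel_lt; dfn_tac3.
    apply: drel_ex; apply: drel_srle.
      by apply: dfn_srofq; apply: dfn_sqsub; [apply: dfn_cell|]; dfn_tac3.
    by apply: dfn_sradd; apply: dfn_D; try (apply: dfn_cell); dfn_tac3.
  - by move=> _; exists zero; apply/E; rewrite !subrr addr0.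
  move=> i IH lt1.
  have lt : lt0 i (spow2 N0).
    by apply/iN_lt; move/iN_le: lt1; rewrite iND iN1; apply: lt_le_trans; rewrite ltrDl.
  have [|n /E Hn] := IH; first by move=> /(ltn_trans' lt)/ltnn'.
  (* With the first [n + m] intervals of each family, the length up to cell [i] is kept, one family
     fills the cell, and the other contributes a nonnegative amount. *)
  have [/(filledP ra rb) [m Hm]|/(filledP ra' rb') [m Hm]] := F i lt;
    exists (add n m); apply/E;
    have H1 := h_mono ra rb ab n m (pi0 i); have H2 := h_mono ra' rb' ab' n m (pi0 i);
    have H3 := h_mono ra rb ab m n (piS i); have H4 := h_mono ra' rb' ab' m n (piS i);
    have H5 := h_ge0 ra rb ab m (piS i); have H6 := h_ge0 ra' rb' ab' m (piS i);
    rewrite (addC m) in H3 H4; move: Hn Hm H1 H2 H3 H4 H5 H6; rewrite -/p; lra.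
have [|n /E Hn] := walk (spow2 N0); first exact: ltnn'.
exists n; have H1 := h_le_total ra rb ab n (pi0 (spow2 N0)).
have H2 := h_le_total ra' rb' ab' n (pi0 (spow2 N0)).
have v1 : v (p (spow2 N0)) = 1.
  by rewrite v_cell epsE mulfV ?kr1 // gt_eqF // pow2_gt0.
by move: Hn H1 H2; rewrite v1 v0; lra.
Qed.

Theorem WTE_WHBU : sWTE M -> sWHBU M.
Proof.
move=> W Psi e mPsi Psi0 re; rewrite (srltP (@sreal_0 M) re) rv_0 => e0.
have conv := W _ _ (measurable_ind mPsi) (smeasurable_const M) (indicators_converge mPsi Psi0).
have e2 : 0 < rv e / 2 by lra.
(* The bound [2^-K0] on the measure and an equal slack for the cover add up to less than [e]. *)
have [K0 HK] := eps_small e2.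
have lt01 : srlt (sr0 M) (sr1 M).
  by apply/(srltP (@sreal_0 M) (@sreal_1 M)); rewrite rv_0 rv_1 ltr01.
(* Threshold 1: the indicator reaches it exactly where [Psi] is at most [2^-N0]. The index at which
   convergence in measure starts also serves as the exponent [N0]. *)
have [N0 /(_ N0 (@ltnn' M N0)) HN] := conv (sr1 M) K0 (@sreal_1 M) lt01.
have rK := @sreal_rofq M (sqexp K0).
have [|a [b [C T]]] := HN _ rK.
  by apply/(srltP (@sreal_0 M) rK); rewrite rv_0 rv_rofq qval_exp kr_gt0 eps_gt0.
have [ra rb ab Ca] := scovers_reals C.
have {}T j : rv (stotal a b j) <= kr (eps K0) + kr (eps K0).
  have := T j; rewrite (srleP (sreal_total j ra rb) (sreal_add rK rK)).
  by rewrite (rv_add rK rK) rv_rofq qval_exp.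
have {}Ca x : sI01 x -> small Psi N0 x -> exists k, rv (ap a k) < rv x < rv (ap b k).
  move=> Ix s; have rx : sreal x by case: Ix.
  apply: (Ca x rx); split; first exact: Ix.
  have Ez : ap (mlam (fun _ : M T1 => sr0 M)) x = sr0 M by rewrite mlamE //; exact: dfn_const.
  have rI := sreal_ind Psi N0 x.
  rewrite Ez; apply/(srleP (@sreal_1 M) (sreal_abs (sreal_sub rI (@sreal_0 M)))).
  rewrite (rv_abs (sreal_sub rI (@sreal_0 M))) (rv_sub rI (@sreal_0 M)).
  by rewrite (rv_ind1 s) rv_0 rv_1 subr0 normr1.
have [y Hy] := cell_sup N0 ra rb ab.
(* The range [i <= n] includes [n], so the last of the [2^N0] cells has this number. *)
pose n := spred (spow2 N0).
have En : add n one = spow2 N0.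
  by apply: spredK => E; have := pow2_gt0 N0; rewrite E iN0 ltxx.
have e1 : 0 < kr (eps N0) by rewrite kr_gt0 eps_gt0.
have Iy i : ~ lt0 n i -> sI01 (ap y i).
  move=> /iN_le ni; have [ry /andP [y1 y2] _] := Hy i; apply/sI01P; split; first exact: ry.
  have p0 : 0 <= v (cell N0 i).
    by rewrite v_cell -kr0 kr_le mulr_ge0 ?iN_ge0 // ltW // eps_gt0.
  have p1 : v (cell N0 (add i one)) <= 1.
    rewrite v_cell -kr1 kr_le epsE ler_pdivrMr ?pow2_gt0 // mul1r -En !iND.
    by rewrite lerD2r.
  by rewrite (le_trans p0 y1) (le_trans y2 p1).
exists n, y; split; first exact: Iy.
move=> a' b' C' d rd; rewrite (srltP (@sreal_0 M) rd) rv_0 => d0.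
have [ra' rb' ab' Ca'] := scovers_reals C'.
(* The given cover has suprema of its own; they need not agree with the points [y]. *)
have [y' Hy'] := cell_sup N0 ra' rb' ab'.
have [i lt|j Hj] := cells_total ra rb ab ra' rb' ab' (N0 := N0).
  have [ry /andP [y1 y2] Fy] := Hy i; have [ry' /andP [y1' y2'] Fy'] := Hy' i.
  have [[k /Fy]|nc] := EM (exists k, rv (ap a k) < rv (ap y i) < rv (ap b k)); first by left.
  have ni : ~ lt0 n i.
    move=> /iN_lt H; have : iN i <= iN n by apply: iN_ltS; rewrite -iN1 -iND En; exact/iN_lt.
    by rewrite leNgt H.
  have Ii := Iy i ni.
  have big : kr (eps N0) < rv (ap Psi (ap y i)).
    by rewrite ltNge; apply/negP => /(smallP mPsi N0 Ii) s; apply: nc; exact: Ca.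
  have rP := sreal_Psi mPsi Ii.
  right; rewrite v_cellS in y2 y2'.
  (* [y' i] and [y i] lie in the same cell, at distance at most [2^-N0 < Psi (y i)]. So [y' i]
     belongs to the union, and the cover has an interval around it. *)
  have [k Hk] : exists k, rv (ap a' k) < rv (ap y' i) < rv (ap b' k).
    apply: (Ca' _ ry'); exists i; split; first exact: ni.
    split; [apply/(srltP (sreal_sub ry rP) ry')|apply/(srltP ry' (sreal_add ry rP))].
      by rewrite (rv_sub ry rP); lra.
    by rewrite (rv_add ry rP); lra.
  exact: Fy' Hk.
exists j; apply/(srleP (sreal_sub (@sreal_1 M) re) (sreal_add (sreal_total j ra' rb') rd)).
rewrite (rv_sub (@sreal_1 M) re) (rv_add (sreal_total j ra' rb') rd) rv_1.
by have := T j; lra.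
Qed.
End Main.

Theorem theorem3p22 : proves ACA0w (Imp WTE WHBUm).
Proof.
apply: completeness.
- by move=> G D A r; exact: ACA0w_sub.
- exact: aca_rca.
- move=> M0 ext ax; pose M := AModel ext ax.
  rewrite sat_imp -[sat WTE _]/(@sat M [] WTE (@enil M)) -[sat WHBUm _]/(@sat M [] WHBUm (@enil M)).
  rewrite sat_WTE sat_WHBUm; exact: WTE_WHBU.
Qed.
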